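(* (1) For every prime $p$, writing $t=p^{-s}$, the power series $\zeta_{2,2,p}(s)=\sum_{i=0}^\infty g(p^i,2,2)\,t^i$ satisfies $$\begin{aligned}\zeta_{2,2,p}(s)=\;&1+t+2t^2+4t^3+6t^4+8t^5+13t^6+17t^7+23t^8+31t^9+40t^{10}+50t^{11}+65t^{12}\\&+79t^{13}+97t^{14}+119t^{15}+143t^{16}+169t^{17}+203t^{18}+237t^{19}+O(t^{20}).\end{aligned}$$ (2) The abscissa of convergence of the Dirichlet series $\zeta_{2,2}(s)=\sum_{n=1}^\infty g(n,2,2)\,n^{-s}$ is $\alpha=1$, and $\zeta_{2,2}(s)$ has a meromorphic continuation to the whole complex plane. The continued function has a simple pole at $s=1$. (3) As $n\to\infty$, $$\sum_{m=1}^n g(m,2,2)\sim \frac{\pi^6}{540}\,\zeta(3)^2\, n = 2.5725\ldots\, n,$$ where $\zeta$ is the Riemann zeta function.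
   Context: For positive integers $c$ and $d$, $\mathcal{N}(c,d)$ denotes the set of isomorphism classes of finite nilpotent groups of nilpotency class at most $c$ that can be generated by at most $d$ elements (the trivial group is included). For a positive integer $n$, $g(n,c,d):=\#\{G\in\mathcal{N}(c,d) : |G|=n\}$. The Dirichlet generating function is $\zeta_{c,d}(s):=\sum_{n=1}^\infty g(n,c,d)\,n^{-s}$, with $s$ a complex variable, and for a prime $p$ the local function is $\zeta_{c,d,p}(s):=\sum_{i=0}^\infty g(p^i,c,d)\,p^{-is}$. Here $O(t^{20})$ denotes terms of degree at least $20$ in the power series in $t$. The notation $f(n)\sim h(n)$ means $\lim_{n\to\infty} f(n)/h(n)=1$. *)

(* Defs.v *)
From HB Require Import structures.
From mathcomp Require Import all_boot all_order all_algebra.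
From mathcomp Require Import all_fingroup all_solvable.

Set Implicit Arguments.
Unset Strict Implicit.
Unset Printing Implicit Defensive.

Section Counting.
Local Open Scope nat_scope.
Local Open Scope group_scope.

Definition nilpotent_cd (c d : nat) (gT : finGroupType) (G : {group gT}) : bool :=
  [&& nilpotent G, (nil_class G <= c)%N & ('m(G) <= d)%N].

(* By Cayley's theorem every group of order n is isomorphic to a subgroup of
   'S_n, so the isomorphism classes of groups of order n can be counted as
   the isomorphism classes of subgroups of 'S_n of order n. Lemma [gP] below
   shows that this count is the intended one, over all finite groups. *)
Definition g (n c d : nat) : nat :=
  #|equivalence_partition (fun G H : {group 'S_n} => G \isog H)
      [set G : {group 'S_n} | (#|G| == n) && nilpotent_cd c d G]|.

Lemma nilpotent_cd_isog c d (gT hT : finGroupType)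
    (G : {group gT}) (H : {group hT}) :
  G \isog H -> nilpotent_cd c d G = nilpotent_cd c d H.
Proof.
move=> GH; rewrite /nilpotent_cd.
by rewrite (isog_nil GH) (isog_nil_class GH) (isog_grank GH).
Qed.

Lemma isog_subgroup_Sn (gT : finGroupType) (G : {group gT}) (n : nat) :
  #|G| = n -> exists H : {group 'S_n}, G \isog H.
Proof.
move=> cG; have cT : #|[set: subg_of G]| = n.
  by rewrite -cG (card_isog (isog_subg G)).
rewrite cardsT in cT.
pose e (x : subg_of G) : 'I_n := cast_ord cT (enum_rank x).
pose e' (i : 'I_n) : subg_of G := enum_val (cast_ord (esym cT) i).
have eK : cancel e e' by move=> x; rewrite /e /e' cast_ordK enum_rankK.
have e'K : cancel e' e by move=> i; rewrite /e /e' enum_valK cast_ordKV.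
have inj x : injective (fun i => e (e' i * x)).
  by move=> i j /(can_inj eK) /mulIg /(can_inj e'K).
pose f x : 'S_n := perm (inj x).
have fM : {in [set: subg_of G] &, {morph f : x y / x * y}}.
  by move=> x y _ _; apply/permP=> i; rewrite permM !permE eK mulgA.
have injf : 'injm (Morphism fM).
  apply/injmP=> x y _ _ /permP/(_ (e 1)).
  by rewrite /= !permE eK !mul1g => /(can_inj eK).
exists [group of Morphism fM @* [set: subg_of G]].
by apply: isog_trans (isog_subg G) _; apply: sub_isog.
Qed.

Lemma gP (n c d : nat) :
  exists X : 'I_(g n c d) -> {group 'S_n},
    [/\ forall i, #|X i| = n /\ nilpotent_cd c d (X i),
        forall i j, X i \isog X j -> i = j
      & forall (gT : finGroupType) (G : {group gT}),
          #|G| = n -> nilpotent_cd c d G -> exists i, G \isog X i].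
Proof.
rewrite /g; set R := fun G H : {group 'S_n} => _.
set D := [set G | _]; set P := equivalence_partition R D.
have eqR : {in D & &, equivalence_rel R}.
  move=> G H K _ _ _; split; first exact: isog_refl.
  by move=> GH; rewrite /R (isog_transl _ GH).
have partP := equivalence_partitionP eqR.
have trP := transversalP partP.
set T := transversal P D in trP; have cT := card_transversal trP.
pose X (i : 'I_#|P|) : {group 'S_n} := enum_val (cast_ord (esym cT) i).
have XT i : X i \in T by exact: enum_valP.
have XD i : X i \in D := subsetP (transversal_sub trP) _ (XT i).
exists X; split.
- by move=> i; have := XD i; rewrite inE => /andP[/eqP].
- move=> i j ij; have := pblock_equivalence_partition eqR (XD i) (XD j).
  rewrite -/P /R ij => Xji; have [_ tiP _] := and3P partP.
  have /(pblock_inj trP (XT i) (XT j)) := esym (same_pblock tiP Xji).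
  by move=> /enum_val_inj /cast_ord_inj.
move=> gT G cG NG; have [H GH] := isog_subgroup_Sn cG.
have HD : H \in D.
  by rewrite inE -(card_isog GH) cG eqxx -(nilpotent_cd_isog _ _ GH).
have [/eqP covP _ _] := and3P partP.
have PH : pblock P H \in P by rewrite pblock_mem // covP.
pose K := transversal_repr H T (pblock P H).
have KT : K \in T := repr_mem_transversal trP _ PH.
have KD : K \in D := subsetP (transversal_sub trP) _ KT.
have := repr_mem_pblock trP H PH; rewrite -/K.
rewrite (pblock_equivalence_partition eqR HD KD) => HK.
exists (cast_ord cT (enum_rank_in KT K)).
by rewrite /X cast_ordK enum_rankK_in //; apply: isog_trans GH HK.
Qed.

(* Coefficients of the power series in t = p^(-s). *)
Definition local_zeta (c d p : nat) : nat -> nat := fun i => g (p ^ i)%N c d.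

End Counting.

From mathcomp Require Import complex.
From mathcomp Require Import all_classical all_reals all_analysis.
Import Order.TTheory GRing.Theory Num.Theory numFieldNormedType.Exports.

Section Analysis.
Variable R : realType.
Local Open Scope complex_scope.
Local Open Scope classical_set_scope.
Local Open Scope ring_scope.

(* R[i] as a normed space over itself, which carries its topology. *)
Notation C := (R[i])^o.

Definition cexp (z : C) : C :=
  (expR (complex.Re z))%:C * (cos (complex.Im z) +i* sin (complex.Im z)).

(* n^(-s) is exp(- s ln n); the series starts at n = 1. *)
Definition dirichlet_term (a : nat -> nat) (s : C) (n : nat) : C :=
  (a n)%:R * cexp (- s * (ln (n%:R : R))%:C).

Definition dirichlet_partial (a : nat -> nat) (s : C) (N : nat) : C :=
  \sum_(1 <= n < N.+1) dirichlet_term a s n.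

Definition dirichlet_converges (a : nat -> nat) (s : C) : Prop :=
  cvgn (dirichlet_partial a s).

Definition dirichlet_series (a : nat -> nat) (s : C) : C :=
  limn (dirichlet_partial a s).

Definition abscissa_of_convergence (a : nat -> nat) (alpha : R) : Prop :=
  (forall s : C, alpha < complex.Re s -> dirichlet_converges a s) /\
  (forall s : C, complex.Re s < alpha -> ~ dirichlet_converges a s).

(* Derivability is over the field R[i], so this is complex differentiability
   on a neighbourhood of z. *)
Definition holomorphic_at (f : C -> C) (z : C) : Prop :=
  \forall w \near z, derivable f w 1.

(* The value of a meromorphic function at a pole is irrelevant. *)
Definition meromorphic_at (f : C -> C) (z : C) : Prop :=
  exists (k : nat) (h : C -> C), holomorphic_at h z /\
    \forall w \near z^', (w - z) ^+ k * f w = h w.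

Definition simple_pole_at (f : C -> C) (z : C) : Prop :=
  exists h : C -> C, [/\ holomorphic_at h z, h z != 0 &
    \forall w \near z^', (w - z) * f w = h w].

(* Riemann's zeta function on the real half-line s > 1. *)
Definition zeta (s : R) : R :=
  limn (fun N : nat => \sum_(1 <= n < N.+1) (n%:R `^ (- s) : R)).

Definition asymp_equiv (f h : nat -> R) : Prop :=
  (fun n => f n / h n) @ \oo --> (1 : R).

End Analysis.

(* Main.v *)
Require Import Defs.
From HB Require Import structures.
From mathcomp Require Import all_boot all_order all_algebra.
From mathcomp Require Import all_fingroup all_solvable.
From mathcomp Require Import zify ring.

(* A group G of class at most 2 generated by x and y is determined by the order
   C of z = [x, y], by A and B with G / <z> of type Z/A x Z/AB, and by the
   exponents f1, f2 of the relations x^A = z^f1, y^(AB) = z^f2 (up to a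
   correction kap which makes them transform linearly under changes of
   generators). Generators can be changed so that f1 = I divides f2 = I E, with
   I E | C | A and E | B, and then A, B, C, I, E are invariants of G; every such
   quintuple is realized by a quotient of a Heisenberg group. Writing A = a C,
   B = b E, C = c1 c2 E with c1 = I, we get |G| = b a^2 c1^3 c2^3 E^4, so that
   zeta_{2,2}(s) = zeta(s) zeta(2s) zeta(3s)^2 zeta(4s). Part (1) is read off
   this product. The continuation of zeta is eta(s) / (1 - 2^(1-s)), where eta is
   continued by Euler's transformation of the alternating series. For part (3),
   sum g = sum_j b(j) floor(n / j), b being the coefficients of
   zeta(2s) zeta(3s)^2 zeta(4s), and dominated convergence gives the limit
   zeta(2) zeta(3)^2 zeta(4) of the averages. *)

Set Implicit Arguments.
Unset Strict Implicit.
Unset Printing Implicit Defensive.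

(** * Two-generator groups of class two *)

(** The obstacle in the classification is the prime 2: powers in class two bring binomial exponents,
    and in general only twice the correction [kap A B] vanishes modulo C. With the correction, x ->
    x y^(Bt) and y -> x^t y act as f1 -> f1 + t f2 and f2 -> f2 + t B f1, and powers prime to |G|
    scale f1 and f2 independently by units modulo C. These moves lead to I = gcd(f1, f2, C) and I E
    = gcd(f2, B I, C), which explains why E divides B. Under an arbitrary change of generators a kap
    term could survive in one parity case only, and there the new commutator would be a square in
    <z> and could not generate the derived group. On the analytic side each factor zeta(m s) is a
    quotient of entire functions whose denominator has only simple zeros, and the pole at 1 is
    genuine because eta(1) is nonzero. The growth constant is 2.5725008..., less than 10^-6 above
    2.5725. This dictates the precision of the bounds, which are taken on 2/5 zeta(2)^3 zeta(3)^2,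
    an equal expression in two rational series. *)

Section Arithmetic.
Local Open Scope nat_scope.

(** For a > 0 take t to be the part of n prime to a. A prime p | n divides exactly one of a and t,
    and if it divides a it does not divide b; in either case it divides exactly one of a and t b. *)
Lemma coprime_shift a b n :
  0 < n -> gcdn (gcdn a b) n = 1 -> exists t, coprime (a + t * b) n.
Proof.
move=> n0 abn; have [a0|a0] := posnP a.
  exists 1; rewrite a0 mul1n add0n.
  by move: abn; rewrite a0 gcd0n /coprime => ->.
pose t := n`_(\pi(a)^'); exists t.
have tP p : prime p -> p %| n -> (p %| t) = ~~ (p %| a).
  move=> pp pn; have t0 : 0 < t by rewrite /t part_gt0.
  have Et : (p \in primes t) = (p %| t) by rewrite mem_primes pp t0.
  rewrite -Et.
  by rewrite /t primes_part mem_filter !inE !mem_primes pp n0 pn a0 /= andbT.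
rewrite coprime_sym coprime_has_primes //; last by rewrite addn_gt0 a0.
apply/hasPn=> p; rewrite !mem_primes => /and3P[pp _ pd].
apply/negP=> /and3P[_ _ pn]; have [pa|pNa] := boolP (p %| a).
  move: pd; rewrite dvdn_addr // Euclid_dvdM // (tP p pp pn) pa /= => pb.
  have: p %| gcdn (gcdn a b) n by rewrite !dvdn_gcd pa pb pn.
  by rewrite abn dvdn1 => /eqP p1; rewrite p1 in pp.
by move: pd; rewrite dvdn_addl ?(negbTE pNa) // dvdn_mulr // (tP p pp pn).
Qed.

Lemma gcdn_shift a b n :
  0 < n -> exists t, gcdn (a + t * b) n = gcdn (gcdn a b) n.
Proof.
move=> n0; set d := gcdn (gcdn a b) n.
have d0 : 0 < d by rewrite gcdn_gt0 n0 orbT.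
have [/dvdnP[a' Ea] /dvdnP[b' Eb] /dvdnP[n' En]] :
    [/\ d %| a, d %| b & d %| n].
  have := dvdnn d; rewrite {2}/d !dvdn_gcd => /andP[/andP[]].
  by [].
have n'0 : 0 < n' by move: n0; rewrite En muln_gt0 => /andP[].
have abn' : gcdn (gcdn a' b') n' = 1.
  by apply/eqP; rewrite -(eqn_pmul2r d0) !muln_gcdl -Ea -Eb -En mul1n.
have [t ct] := coprime_shift n'0 abn'.
exists t; rewrite Ea Eb En mulnA -mulnDl -muln_gcdl.
by move: ct; rewrite /coprime => /eqP ->; rewrite mul1n.
Qed.

(** With d = gcd(f, C), the cofactor f / d is prime to C / d. Shifting it by multiples of C / d does
    not change its product with d modulo C and makes it prime to n. For n = |G| the unit u can then
    serve as the exponent of a generator. *)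
Lemma mul_coprime_modn f C n : 0 < n -> C %| n ->
  exists u, coprime u n /\ u * gcdn f C = f %[mod C].
Proof.
move=> n0 Cn; have C0 : 0 < C by exact: dvdn_gt0 Cn.
set d := gcdn f C; have d0 : 0 < d by rewrite gcdn_gt0 C0 orbT.
have /dvdnP[f' Ef] := dvdn_gcdl f C; have /dvdnP[C' EC] := dvdn_gcdr f C.
rewrite -/d in Ef EC.
have f'C' : gcdn f' C' = 1.
  by apply/eqP; rewrite -(eqn_pmul2r d0) muln_gcdl -Ef -EC mul1n.
have [|t ct] := @coprime_shift f' C' n n0; first by rewrite f'C' gcd1n.
exists (f' + t * C'); split=> //.
by rewrite mulnDl -mulnA -EC -Ef addnC modnMDl.
Qed.

Lemma bin2_mul2 n : 'C(n, 2) * 2 = n * n.-1.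
Proof. by rewrite bin2 -divn2 divnK ?dvdn2 ?oddM; case: n => //= n; case: odd. Qed.

Lemma binM2 a b : 'C(a * b, 2) = b * (b * 'C(a, 2)) + a * 'C(b, 2).
Proof.
have H n : 'C(n, 2) * 2 + n = n * n.
  by rewrite bin2_mul2; case: n => //= n; nia.
apply/eqP; rewrite -(eqn_pmul2r (isT : 0 < 2)); apply/eqP.
have := H a; have := H b; have := H (a * b).
set ca := 'C(a, 2); set cb := 'C(b, 2); set cab := 'C(a * b, 2).
nia.
Qed.

End Arithmetic.

Section TwoGenerators.
Local Open Scope group_scope.
Variables (gT : finGroupType) (x y : gT).
Local Notation z := [~ x, y].
Hypotheses (cxz : commute x z) (cyz : commute y z).
Local Notation G := <<[set x; y]>>.

Let Gx : x \in G. Proof. by rewrite mem_gen // !inE eqxx. Qed.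
Let Gy : y \in G. Proof. by rewrite mem_gen // !inE eqxx orbT. Qed.
Let Gz : z \in G. Proof. exact: groupR. Qed.

Lemma gen2_sub_cent : G \subset 'C(<[z]>).
Proof.
rewrite gen_subG subUset !sub1set /= cent_cycle; apply/andP.
by split; apply/cent1P; apply: commute_sym.
Qed.

Lemma gen2_commute u k : u \in G -> commute u (z ^+ k).
Proof.
move=> Gu; apply: commuteX; have := subsetP gen2_sub_cent u Gu.
by rewrite cent_cycle => /cent1P /commute_sym.
Qed.

Lemma gen2_norm : G \subset 'N(<[z]>).
Proof. exact: subset_trans gen2_sub_cent (cent_sub _). Qed.

Lemma gen2_normal : <[z]> <| G.
Proof. by rewrite /normal gen2_norm andbT cycle_subG. Qed.

Lemma gen2_quotient : G / <[z]> = <[coset <[z]> x]> * <[coset <[z]> y]>.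
Proof.
have nx := subsetP gen2_norm x Gx; have ny := subsetP gen2_norm y Gy.
have cxy : commute (coset <[z]> x) (coset <[z]> y).
  by apply/commgP; rewrite -morphR //= coset_id ?cycle_id.
rewrite -cent_joinEr; last first.
  by apply: cents_cycle; apply: commute_sym.
rewrite quotient_gen ?subUset ?sub1set ?nx ?ny //.
rewrite quotientE morphimU !morphim_set1 //.
by rewrite /cycle joing_idl joing_idr.
Qed.

Lemma gen2_der1 : G^`(1) = <[z]>.
Proof.
apply/eqP; rewrite eqEsubset; apply/andP; split; last first.
  by rewrite cycle_subG /= derg1 mem_commg.
rewrite der1_min ?gen2_norm // gen2_quotient.
rewrite abelianM !cycle_abelian /=; apply: cents_cycle.
have nx := subsetP gen2_norm x Gx; have ny := subsetP gen2_norm y Gy.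
by apply/commute_sym/commgP; rewrite -morphR //= coset_id ?cycle_id.
Qed.

Lemma gen2_nil : nilpotent G && (nil_class G <= 2)%N.
Proof.
have L3 : 'L_3(G) = 1.
  have: [~: G^`(1), G] = 1.
    by apply/commG1P; rewrite gen2_der1 centsC gen2_sub_cent.
  by [].
have nG : nilpotent G by apply/lcnP; exists 2%N.
by rewrite nG; apply/lcn_nil_classP.
Qed.

Lemma gen2_elt u : u \in G -> exists i j k, u = x ^+ i * y ^+ j * z ^+ k.
Proof.
move=> Gu; have nx := subsetP gen2_norm x Gx; have ny := subsetP gen2_norm y Gy.
have nu := subsetP gen2_norm u Gu.
have: coset <[z]> u \in G / <[z]> by exact: mem_quotient.
rewrite gen2_quotient => /imset2P[_ _ /cycleP[i ->] /cycleP[j ->]].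
rewrite -!morphX // -morphM ?groupX // => E.
set w := x ^+ i * y ^+ j in E *; have nw : w \in 'N(<[z]>) by rewrite groupM ?groupX.
have /cycleP[k Ek] : w^-1 * u \in <[z]>.
  apply: coset_idr; first by rewrite groupM ?groupV.
  by rewrite morphM ?groupV // morphV //= E mulVg.
by exists i, j, k; rewrite -Ek mulKVg.
Qed.

Lemma gen2_card_le : (#|G| <= #[coset <[z]> x] * #[coset <[z]> y] * #[z])%N.
Proof.
rewrite -(Lagrange (normal_sub gen2_normal)) -card_quotient ?gen2_norm //.
rewrite [X in (_ <= X)%N]mulnC leq_mul2l gen2_quotient.
by rewrite !orderE mul_cardG leq_pmulr ?orbT // cardG_gt0.
Qed.

Lemma gen2_commMl u v w : u \in G -> v \in G -> w \in G ->
  [~ u * v, w] = [~ u, w] * [~ v, w].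
Proof.
move=> Gu Gv Gw; rewrite commMgJ; congr (_ * _).
have: [~ u, w] \in <[z]> by rewrite -gen2_der1 mem_commg.
by case/cycleP=> k ->; rewrite /conjg -(gen2_commute k Gv) mulKg.
Qed.

(** Collecting the powers of x on the left moves y^j past x^i in 'C(n, 2) places, and each move
    costs the central factor z^(-ij). *)
Lemma gen2_powM i j k n : (x ^+ i * y ^+ j * z ^+ k) ^+ n =
  x ^+ (i * n) * y ^+ (j * n) * z ^+ (k * n) * z ^- (i * j * 'C(n, 2)).
Proof.
have cw : commute (x ^+ i * y ^+ j) (z ^+ k).
  by apply: gen2_commute; rewrite groupM ?groupX.
have czV : z^-1 = [~ y, x] by rewrite invg_comm.
have E : [~ y ^+ j, x ^+ i] = z ^- (i * j).
  rewrite commXXg -?czV; try exact: commuteV.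
  by rewrite expgVn mulnC.
rewrite expgMn // expMg_Rmul E.
- rewrite -!expgM -expgVn -expgM expgVn -!mulgA; do 2!congr (_ * _).
  by rewrite -!expgVn; apply/commuteX2/commute_sym/commuteV.
- by apply/commuteV/gen2_commute; rewrite groupX.
- by apply/commuteV/gen2_commute; rewrite groupX.
Qed.

Lemma gen2_commMr u v w : u \in G -> v \in G -> w \in G ->
  [~ u, v * w] = [~ u, v] * [~ u, w].
Proof.
move=> Gu Gv Gw; apply: invg_inj; rewrite [RHS]invMg !invg_comm.
rewrite gen2_commMl //.
have: [~ v, u] \in <[z]> by rewrite -gen2_der1 mem_commg.
case/cycleP=> k ->; apply/commute_sym/gen2_commute; exact: groupR.
Qed.

End TwoGenerators.

(** * Presentations, their normal form and its invariants *)

Section Classification.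
Local Open Scope nat_scope.
Local Open Scope group_scope.

(* The correction [kap A B] turns the dependence of [f1], [f2] on the generators
   into a linear one: without it, (x y)^n = x^n y^n [y, x]^(n(n-1)/2) would
   contribute binomial terms. *)
Definition kap (A B : nat) : nat := (B * 'C(A, 2))%N.

(** The order condition makes the relations complete: A (AB) C is the largest order that they allow,
    so a group attaining it is determined by the five parameters. *)
Definition presents (gT : finGroupType) (G : {group gT}) (x y : gT)
    (A B C f1 f2 : nat) : Prop :=
  [/\ G :=: <<[set x; y]>>, #|G| = (A * (A * B) * C)%N & (C %| A)%N] /\
  [/\ commute x [~ x, y], commute y [~ x, y], [~ x, y] ^+ C = 1,
      x ^+ A = [~ x, y] ^+ (f1 + kap A B)
    & y ^+ (A * B) = [~ x, y] ^+ (f2 + kap A B)].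

Section Presents.
Variables (gT : finGroupType) (G : {group gT}) (x y : gT).
Variables A B C f1 f2 : nat.
Hypothesis P : presents G x y A B C f1 f2.
Local Notation z := [~ x, y].
Local Notation kp := (kap A B).

Let GE : G :=: <<[set x; y]>>. Proof. by case: P => -[]. Qed.
Let cG : #|G| = (A * (A * B) * C)%N. Proof. by case: P => -[]. Qed.
Let CA : (C %| A)%N. Proof. by case: P => -[]. Qed.
Let cxz : commute x z. Proof. by case: P => _ []. Qed.
Let cyz : commute y z. Proof. by case: P => _ []. Qed.
Let zC : z ^+ C = 1. Proof. by case: P => _ []. Qed.
Let xA : x ^+ A = z ^+ (f1 + kp). Proof. by case: P => _ []. Qed.
Let yAB : y ^+ (A * B) = z ^+ (f2 + kp). Proof. by case: P => _ []. Qed.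

Lemma presents_gt0 : [/\ 0 < A, 0 < B & 0 < C]%N.
Proof. by have := cardG_gt0 G; rewrite cG; split; nia. Qed.

Let Gx : x \in G. Proof. by rewrite GE mem_gen // !inE eqxx. Qed.
Let Gy : y \in G. Proof. by rewrite GE mem_gen // !inE eqxx orbT. Qed.
Let Gz : z \in G. Proof. exact: groupR. Qed.
Let nx : x \in 'N(<[z]>).
Proof. by apply: (subsetP (gen2_norm cxz cyz)); rewrite -GE. Qed.
Let ny : y \in 'N(<[z]>).
Proof. by apply: (subsetP (gen2_norm cxz cyz)); rewrite -GE. Qed.

(** Each order divides the claimed value, and by [gen2_card_le] the product of the three is at least
    |G| = A (AB) C. *)
Lemma presents_orders :
  [/\ #[z] = C, #[coset <[z]> x] = A & #[coset <[z]> y] = (A * B)%N].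
Proof.
have [A0 B0 C0] := presents_gt0.
have dz : (#[z] %| C)%N by rewrite order_dvdn zC.
have dx : (#[coset <[z]> x] %| A)%N.
  by rewrite order_dvdn -morphX //= xA coset_id // mem_cycle.
have dy : (#[coset <[z]> y] %| A * B)%N.
  by rewrite order_dvdn -morphX //= yAB coset_id // mem_cycle.
have := gen2_card_le cxz cyz; rewrite -GE cG.
have := dvdn_leq C0 dz; have := dvdn_leq A0 dx.
have AB0 : (0 < A * B)%N by rewrite muln_gt0 A0.
have := dvdn_leq AB0 dy.
have := order_gt0 z; have := order_gt0 (coset <[z]> x).
have := order_gt0 (coset <[z]> y).
move: #[z] #[coset <[z]> x] #[coset <[z]> y] (A * B)%N AB0 => oz ox oy D D0.
move=> oy0 ox0 oz0 leD leA leC le.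
have Ez : oz = C.
  apply/eqP; rewrite eqn_leq leC /= -(leq_pmul2l (_ : 0 < A * D)%N); last by rewrite muln_gt0 A0.
  by apply: leq_trans le _; rewrite leq_mul2r leq_mul ?orbT.
subst oz; move: le; rewrite leq_pmul2r // => le.
have Ex : ox = A.
  apply/eqP; rewrite eqn_leq leA /= -(leq_pmul2r D0).
  by apply: leq_trans le _; rewrite leq_mul2l leD orbT.
subst ox; move: le; rewrite leq_pmul2l // => le.
by split=> //; apply/eqP; rewrite eqn_leq leD.
Qed.

Lemma presents_y_dvd m : y ^+ m \in <[z]> -> (A * B %| m)%N.
Proof.
case: presents_orders => _ _ <- h.
by rewrite order_dvdn -morphX //= coset_id.
Qed.

Lemma presents_modn m n : m = n %[mod C] -> z ^+ m = z ^+ n.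
Proof.
case: presents_orders => <- _ _ E.
by apply/eqP; rewrite eq_expg_mod_order E.
Qed.

Lemma presents_expz0 m : (C %| m)%N -> z ^+ m = 1.
Proof. by case/dvdnP=> q ->; rewrite mulnC expgM zC expg1n. Qed.

(** As 2 'C(A, 2) = A (A - 1) and C divides A, the element z^kap has order at most 2: its sign is
    immaterial and two copies of it cancel. *)
Lemma kap2 : (C %| kp * 2)%N.
Proof.
apply: (dvdn_trans CA).
by rewrite /kap -mulnA bin2_mul2 mulnCA dvdn_mulr.
Qed.

Lemma expz_kapV m : z ^- (m * kp) = z ^+ (m * kp).
Proof.
apply: (mulgI (z ^+ (m * kp))); rewrite mulgV -expgD addnn -muln2 -mulnA.
by rewrite presents_expz0 // dvdn_mull // kap2.
Qed.

(** By [binM2], 'C(AB, 2) = B kap + A 'C(B, 2), and the last term is a multiple of C. *)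
Lemma expz_binV m : z ^- (m * 'C(A * B, 2)) = z ^+ (m * B * kp).
Proof.
rewrite binM2 mulnDr -/kp mulnA expgD [z ^+ (m * (A * _))]presents_expz0.
  by rewrite mulg1 expz_kapV.
by rewrite mulnCA dvdn_mulr.
Qed.

Lemma commXgg (u : gT) m : [~ u ^+ m, u] = 1.
Proof. by apply/eqP/commgP/commute_sym/commuteX. Qed.

Lemma commgXg (u : gT) m : [~ u, u ^+ m] = 1.
Proof. by apply/eqP/commgP/commuteX. Qed.

Let modn_addl0 m n : (C %| m)%N -> (m + n = n %[mod C])%N.
Proof. by move=> Cm; apply/eqP; rewrite -[X in _ == X %[mod _]]add0n eqn_modDr mod0n. Qed.

Lemma mem_gen2l (u v : gT) : u \in <<[set u; v]>>.
Proof. by rewrite mem_gen // !inE eqxx. Qed.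

Lemma mem_gen2r (u v : gT) : v \in <<[set u; v]>>.
Proof. by rewrite mem_gen // !inE eqxx orbT. Qed.

(** In the A-th power, y^(ABt) contributes t (f2 + kap) and the commutators contribute t kap; the
    two copies of t kap cancel and the kap of x^A remains. The exponent of y is a multiple of B so
    that this power stays in <z>. *)
Lemma presents_addx t : presents G (x * y ^+ (B * t)) y A B C (f1 + t * f2) f2.
Proof.
have Ez : [~ x * y ^+ (B * t), y] = z.
  by rewrite (gen2_commMl cxz cyz) -?GE ?groupX // commXgg mulg1.
rewrite /presents Ez; split; split=> //.
- apply/eqP; rewrite GE eqEsubset !gen_subG !subUset !sub1set.
  rewrite !mem_gen2r !andbT groupM ?groupX ?mem_gen2l ?mem_gen2r // andbT.
  rewrite -(@groupMr _ _ (y ^+ (B * t)) x) ?mem_gen2l // groupX //.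
  exact: mem_gen2r.
- have := @gen2_commute _ _ _ cxz cyz (x * y ^+ (B * t)) 1.
  by rewrite expg1 -GE; apply; rewrite groupM ?groupX.
- have := gen2_powM cxz cyz 1 (B * t) 0 A; rewrite !expg1 mulg1 => ->.
  rewrite !mul1n mul0n mulg1 (_ : B * t * A = A * B * t)%N; last by lia.
  rewrite (_ : B * t * _ = t * kp)%N; last by rewrite /kap; lia.
  rewrite expgM yAB xA expz_kapV -expgM -!expgD.
  apply: presents_modn.
  have -> : (f1 + kp + (f2 + kp) * t + t * kp = t * (kp * 2) + (f1 + t * f2 + kp))%N by lia.
  by apply: modn_addl0; apply: dvdn_mull; exact: kap2.
Qed.

Lemma presents_addy t : presents G x (x ^+ t * y) A B C f1 (f2 + t * (B * f1)).
Proof.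
have Ez : [~ x, x ^+ t * y] = z.
  by rewrite (gen2_commMr cxz cyz) -?GE ?groupX // commgXg mul1g.
rewrite /presents Ez; split; split=> //.
- apply/eqP; rewrite GE eqEsubset !gen_subG !subUset !sub1set.
  rewrite !mem_gen2l /= groupM ?groupX ?mem_gen2l ?mem_gen2r // andbT.
  rewrite -(@groupMl _ _ (x ^+ t) y) ?mem_gen2r // groupX //.
  exact: mem_gen2l.
- have := @gen2_commute _ _ _ cxz cyz (x ^+ t * y) 1.
  by rewrite expg1 -GE; apply; rewrite groupM ?groupX.
- have := gen2_powM cxz cyz t 1 0 (A * B); rewrite !expg1 mulg1 => ->.
  rewrite mul1n mul0n mulg1 muln1 (_ : t * (A * B) = A * (B * t))%N; last by lia.
  rewrite expgM yAB xA expz_binV -expgM -!expgD.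
  apply: presents_modn.
  have -> : ((f1 + kp) * (B * t) + (f2 + kp) + t * B * kp
     = (t * B) * (kp * 2) + (f2 + t * (B * f1) + kp))%N by lia.
  by apply: modn_addl0; apply: dvdn_mull; exact: kap2.
Qed.

(** Since z becomes z^(al de), the factor [al] cancels in the relation for x^A and [de] is left to
    act on [f1]; symmetrically [al] acts on [f2]. So the two parameters scale independently.
    Exponents prime to |G| keep the two powers generating G. *)
Lemma presents_scale al de g1 g2 :
  coprime al #|G| -> coprime de #|G| ->
  (de * g1 = f1 %[mod C])%N -> (al * g2 = f2 %[mod C])%N ->
  presents G (x ^+ al) (y ^+ de) A B C g1 g2.
Proof.
move=> cal cde E1 E2.
have Ez : [~ x ^+ al, y ^+ de] = z ^+ (al * de) by rewrite commXXg.
(* Either e is odd and (e - 1) kap is a multiple of 2 kap, or e is even, so that |G| and A are odd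
   and C divides kap itself. *)
have kode e : coprime e #|G| -> (e * kp = kp %[mod C])%N.
  move=> ce; have [oe|ee] := boolP (odd e).
    have [h ->] : exists h, e = (h * 2).+1.
      by exists e./2; rewrite -[LHS]odd_double_half oe -muln2.
    have -> : ((h * 2).+1 * kp = h * (kp * 2) + kp)%N by lia.
    by apply: modn_addl0; apply: dvdn_mull; exact: kap2.
  have oG : odd #|G|.
    rewrite -coprimen2 coprime_sym; apply: coprime_dvdl ce.
    by rewrite dvdn2.
  have oA : odd A by move: oG; rewrite cG !oddM; case: odd.
  have Ck : (C %| kp)%N.
    apply: (dvdn_trans CA); rewrite /kap; apply: dvdn_mull.
    by rewrite -(@Gauss_dvdl _ _ 2) ?coprimen2 // bin2_mul2 dvdn_mulr.
  by rewrite -[LHS]modnMmr (eqP Ck) muln0 mod0n.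
rewrite /presents Ez; split; split=> //.
- apply/eqP; rewrite eqEsubset; apply/andP; split; last first.
    by rewrite gen_subG subUset !sub1set !groupX.
  have cyc u e : u \in G -> coprime e #|G| -> u \in <[u ^+ e]>.
    move=> Gu ce; have : generator <[u]> (u ^+ e).
      by rewrite generator_coprime coprime_sym (coprime_dvdr _ ce) // order_dvdG.
    by move=> /eqP <-; exact: cycle_id.
  rewrite GE gen_subG subUset !sub1set; apply/andP; split.
    apply: (subsetP _ _ (cyc _ _ Gx cal)); rewrite cycle_subG mem_gen //.
    by rewrite !inE eqxx.
  apply: (subsetP _ _ (cyc _ _ Gy cde)); rewrite cycle_subG mem_gen //.
  by rewrite !inE eqxx orbT.
- by apply: (gen2_commute cxz cyz); rewrite -GE groupX.
- by apply: (gen2_commute cxz cyz); rewrite -GE groupX.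
- by rewrite expgAC zC expg1n.
- rewrite expgAC xA -!expgM; apply: presents_modn.
  rewrite (_ : al * de * (g1 + kp) = al * (de * g1 + de * kp))%N; last by lia.
  by rewrite -[RHS]modnMmr -modnDm E1 (kode _ cde) modnDm modnMmr mulnC.
- rewrite expgAC yAB -!expgM; apply: presents_modn.
  rewrite (_ : al * de * (g2 + kp) = de * (al * g2 + al * kp))%N; last by lia.
  by rewrite -[RHS]modnMmr -modnDm E2 (kode _ cal) modnDm modnMmr mulnC.
Qed.

End Presents.

Section Invariance.
Variables (gT : finGroupType) (G : {group gT}) (x y : gT).
Variables A B C f1 f2 : nat.
Hypothesis P : presents G x y A B C f1 f2.
Local Notation z := [~ x, y].
Local Notation kp := (kap A B).

Let GE : G :=: <<[set x; y]>>. Proof. by case: P => -[]. Qed.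
Let cxz : commute x z. Proof. by case: P => _ []. Qed.
Let cyz : commute y z. Proof. by case: P => _ []. Qed.

Lemma presents_der1 : G^`(1) = <[z]>.
Proof. by rewrite GE; exact: gen2_der1. Qed.

Lemma presents_cardC : #|G^`(1)| = C.
Proof. by rewrite presents_der1 -orderE; case: (presents_orders P). Qed.

Lemma presents_exponent : exponent (G / G^`(1)) = (A * B)%N.
Proof.
have [oz ox oy] := presents_orders P.
rewrite presents_der1; apply/eqP; rewrite eqn_dvd; apply/andP; split.
  apply/exponentP => u; rewrite {1}GE gen2_quotient //.
  case/imset2P=> _ _ /cycleP[i ->] /cycleP[j ->] ->.
  have cab : abelian (G / <[z]>) by rewrite -presents_der1 der_abelian.
  have xG : coset <[z]> x \in G / <[z]> by rewrite mem_quotient // GE mem_gen2l.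
  have yG : coset <[z]> y \in G / <[z]> by rewrite mem_quotient // GE mem_gen2r.
  rewrite expgMn; last by apply/commuteX2/(centsP cab).
  rewrite -!expgM [X in X * _](_ : _ = 1); last first.
    by apply/eqP; rewrite -order_dvdn ox mulnCA dvdn_mulr.
  by rewrite mul1g; apply/eqP; rewrite -order_dvdn oy dvdn_mull.
rewrite -oy dvdn_exponent // mem_quotient // GE mem_gen2r //.
Qed.

Lemma expz_inj m n : z ^+ m = z ^+ n -> m = n %[mod C].
Proof.
by have [<- _ _] := presents_orders P => /eqP; rewrite eq_expg_mod_order => /eqP.
Qed.

Lemma coprime_of_order m : #[z ^+ m] = C -> coprime C m.
Proof.
have [_ _ C0] := presents_gt0 P; have [oz _ _] := presents_orders P.
rewrite orderXgcd oz => E; have d0 : (0 < gcdn C m)%N by rewrite gcdn_gt0 C0.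
rewrite /coprime -(eqn_pmul2l C0) muln1.
by rewrite -{1}E divnK // dvdn_gcdl.
Qed.

(** With both exponents even, [u, v] is an even power of z, and such a power can have order C only
    if C is odd. This excludes the parity case in which kap terms would survive a change of
    generators. *)
Lemma odd_of_even_gen u v i j k : v \in G ->
  u = x ^+ i * y ^+ j * z ^+ k -> #[[~ u, v]] = C ->
  ~~ odd i -> ~~ odd j -> odd C.
Proof.
move=> Gv -> oC ei ej.
have Gx : x \in G by rewrite GE mem_gen2l.
have Gy : y \in G by rewrite GE mem_gen2r.
have dbl n : ~~ odd n -> n = (n./2 * 2)%N by move=> en; rewrite muln2 even_halfK.
have sq s n : s \in G -> ~~ odd n -> exists q, [~ s ^+ n, v] = z ^+ (q * 2).
  move=> Gs /dbl ->; set h := n./2.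
  have : [~ s ^+ h, v] \in <[z]> by rewrite -presents_der1 mem_commg ?groupX.
  case/cycleP=> q Eq; exists q; rewrite muln2 -addnn expgD.
  by rewrite (gen2_commMl cxz cyz) -?GE ?groupX // Eq -expgD addnn -muln2.
have [p Ep] := sq x i Gx ei; have [q Eq] := sq y j Gy ej.
move: oC; rewrite (gen2_commMl cxz cyz) -?GE ?groupM ?groupX ?groupR //.
rewrite (gen2_commMl cxz cyz) -?GE ?groupX // Ep Eq.
have -> : [~ z ^+ k, v] = 1.
  apply/eqP/commgP/commute_sym/(gen2_commute cxz cyz); by rewrite -GE.
rewrite mulg1 -expgD -mulnDl => /coprime_of_order.
by rewrite coprimeMr coprimen2 => /andP[].
Qed.

Lemma kap_dvd_even : ~~ odd B || odd C -> (C %| kp)%N.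
Proof.
have [[_ cG CA] _] := P; case/orP => [eB|oC]; last first.
  by rewrite -(@Gauss_dvdl _ _ 2) ?coprimen2 ?kap2 //; exact: kap2 P.
have /dvdnP[q ->] : (2 %| B)%N by rewrite dvdn2.
by rewrite /kap -mulnA (mulnC 2) bin2_mul2 mulnCA dvdn_mulr.
Qed.

Lemma kap_coprime w : coprime w C -> (w * kp = kp %[mod C])%N.
Proof.
move=> cw; have [Ck|nCk] := boolP (C %| kp)%N.
  by rewrite -modnMmr (eqP Ck) muln0 mod0n.
have eC : ~~ odd C by apply: contra nCk => oC; rewrite kap_dvd_even ?oC ?orbT.
have ow : odd w.
  apply/negPn/negP=> ew; have : (2 %| gcdn w C)%N by rewrite dvdn_gcd !dvdn2 ew.
  by move/eqP: cw => ->.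
have [h ->] : exists h, w = (h * 2).+1.
  by exists w./2; rewrite -[LHS]odd_double_half ow -muln2.
rewrite (_ : (h * 2).+1 * kp = h * (kp * 2) + kp)%N; last by lia.
by rewrite -modnDml -modnMmr (eqP (kap2 P)) muln0 mod0n.
Qed.

(** If kap is nonzero modulo C, then C is even and B is odd, so m B + 1 has the parity of m + 1. One
    of m and n is odd, which makes both products even, and 2 kap vanishes modulo C. *)
Lemma kap_dvd_odd_sum m n : ~~ (~~ odd C && (~~ odd m && ~~ odd n)) ->
  (C %| kp * ((m * B).+1 * n.+1))%N /\ (C %| kp * (m.+1 * n.+1))%N.
Proof.
have [Ck _|nCk] := boolP (C %| kp)%N; first by split; apply: dvdn_mulr.
have := contra (@kap_dvd_even) nCk; rewrite negb_or negbK => /andP[oB eC].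
rewrite eC /= => omn.
have ev q : ~~ odd q -> (C %| kp * q)%N.
  move=> eq; have /dvdnP[h ->] : (2 %| q)%N by rewrite dvdn2.
  by rewrite mulnCA dvdn_mull // (kap2 P).
by split; apply: ev; rewrite oddM /= ?oddM ?oB ?andbT; move: omn;
  case: (odd m); case: (odd n).
Qed.

(** Write x' = x^i y^j z^k and [x', y'] = z^w, with w a unit modulo C. As x'^A lies in <z>, B
    divides j; for j = t B the power formula gives w g1 = f1 i + f2 t + kap (i + 1)(t + 1) modulo C.
    The kap term vanishes by parity, so common divisors of f1, f2 and C pass to g1. For y' the
    linear part is B f1 i + f2 j. *)
Lemma presents_dvd x' y' g1 g2 d : presents G x' y' A B C g1 g2 -> (d %| C)%N ->
  ((d %| f1 -> d %| f2 -> d %| g1) /\ (d %| B * f1 -> d %| f2 -> d %| g2))%N.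
Proof.
move=> Q dC; have [[GE' cG CA] [_ _ zC xA yAB]] := P.
have [[GE'' _ _] [_ _ zC' xA' yAB']] := Q.
have Gx' : x' \in G by rewrite GE'' mem_gen2l.
have Gy' : y' \in G by rewrite GE'' mem_gen2r.
have oz : #[z] = C by case: (presents_orders P).
have oz' : #[[~ x', y']] = C by case: (presents_orders Q).
have : [~ x', y'] \in <[z]> by rewrite -presents_der1 mem_commg.
case/cycleP=> w Ew.
have cw : coprime C w by apply: coprime_of_order; rewrite -Ew.
have kw : (w * kp = kp %[mod C])%N by rewrite kap_coprime // coprime_sym.
have inz m : [~ x', y'] ^+ m \in <[z]> by rewrite Ew -expgM mem_cycle.
(* Multiplication by w fixes kap and 2 kap vanishes modulo C, so kap can be moved to the other side;
   the unit w is then dropped. *)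
have fin g n : (w * (g + kp) = n %[mod C])%N ->
    (d %| n + kp)%N -> (d %| g)%N.
  move=> E dn; rewrite -(@Gauss_dvdr _ w); last first.
    exact: coprime_dvdl dC cw.
  have E2 : (w * g = n + kp %[mod C])%N.
    have kk0 : (w * kp + kp = 0 %[mod C])%N.
      by rewrite -modnDml kw modnDml addnn -muln2 mod0n; apply/eqP/(kap2 P).
    by rewrite -[RHS]modnDml -E modnDml mulnDr -addnA -[RHS]modnDmr kk0 modnDmr addn0.
  by rewrite /dvdn -(modn_dvdm _ dC) E2 (modn_dvdm _ dC).
split=> d1 d2.
- have : x' \in <<[set x; y]>> by rewrite -GE.
  case/(gen2_elt cxz cyz) => i [j [k Ex]].
  have := gen2_powM cxz cyz i j k A; rewrite -Ex xA' => E.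
  have : y ^+ (j * A) \in <[z]>.
    move: (inz (g1 + kp)%N); rewrite E.
    rewrite groupMr ?groupV ?mem_cycle // groupMr ?mem_cycle // groupMl //.
    by rewrite mulnC expgM xA -expgM mem_cycle.
  have [A1 B1 C1] := presents_gt0 P.
  move/(presents_y_dvd P); rewrite (mulnC j) dvdn_pmul2l // => /dvdnP[t Et].
  have Ei : (w * (g1 + kp) = (f1 + kp) * i + (f2 + kp) * t + (i * t) * kp %[mod C])%N.
    apply: expz_inj; rewrite expgM -Ew E Et.
    rewrite (_ : t * B * A = A * B * t)%N; last by lia.
    rewrite (_ : i * (t * B) * 'C(A, 2) = i * t * kp)%N; last by rewrite /kap; lia.
    rewrite (expz_kapV P) (presents_expz0 P (_ : C %| k * A)%N) ?dvdn_mull //.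
    by rewrite mulg1 (expgM y) yAB (mulnC i A) (expgM x) xA -!expgM -!expgD.
  apply: fin Ei _.
  rewrite (_ : _ + kp = f1 * i + f2 * t + kp * (i.+1 * t.+1))%N; last by lia.
  rewrite dvdn_add //; first by rewrite dvdn_add ?dvdn_mulr.
  apply: (dvdn_trans dC).
  (* If i and t were even, j = t B would be even too, and [x', y'] has order C, forcing C to be
     odd. *)
  apply: (kap_dvd_odd_sum _).2; apply/negP => /and3P[eC ei et].
  move: eC; rewrite (odd_of_even_gen Gy' Ex oz') //.
  by rewrite Et oddM negb_and et.
- have : y' \in <<[set x; y]>> by rewrite -GE.
  case/(gen2_elt cxz cyz) => i [j [k Ey]].
  have := gen2_powM cxz cyz i j k (A * B); rewrite -Ey yAB' => E.
  have Ei : (w * (g2 + kp) = (f1 + kp) * (i * B) + (f2 + kp) * j + (i * j * B) * kp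
       %[mod C])%N.
    apply: expz_inj; rewrite expgM -Ew E.
    rewrite (_ : i * (A * B) = A * (i * B))%N; last by lia.
    rewrite (expz_binV P) (presents_expz0 P (_ : C %| k * (A * B))%N); last first.
      by rewrite dvdn_mull // dvdn_mulr.
    by rewrite mulg1 (expgM x) xA (mulnC j) (expgM y) yAB -!expgM -!expgD.
  apply: fin Ei _.
  rewrite (_ : _ + kp = B * f1 * i + f2 * j + kp * ((i * B).+1 * j.+1))%N; last by lia.
  rewrite dvdn_add //; first by apply: dvdn_add; apply: dvdn_mulr.
  apply: (dvdn_trans dC).
  apply: (kap_dvd_odd_sum _).1; apply/negP => /and3P[eC ei ej].
  move: eC; have oz'' : #[[~ y', x']] = C by rewrite -invg_comm orderV.
  by rewrite (odd_of_even_gen Gx' Ey oz'').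
Qed.

End Invariance.

(** C is the order of G', AB the exponent of G / G', and |G| then yields A. In [presents_dvd], d = I
    gives I | I', and d = I E, which divides B I because E | B, gives I E | I' E'. Symmetry turns
    both into equalities. *)
Lemma presents_unique (gT : finGroupType) (G : {group gT}) x y x' y'
    A B C I E A' B' C' I' E' :
  presents G x y A B C I (I * E) -> presents G x' y' A' B' C' I' (I' * E') ->
  (I * E %| C)%N -> (E %| B)%N -> (I' * E' %| C')%N -> (E' %| B')%N ->
  [/\ A = A', B = B', C = C', I = I' & E = E'].
Proof.
move=> P Q IEC EB IEC' EB'.
have EC : C = C' by rewrite -(presents_cardC P) (presents_cardC Q).
subst C'.
have [A0 B0 C0] := presents_gt0 P; have [A0' B0' _] := presents_gt0 Q.
have EAB : (A * B = A' * B')%N by rewrite -(presents_exponent P) (presents_exponent Q).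
have [[_ c1 _] _] := P; have [[_ c2 _] _] := Q.
have EA : A = A'.
  by apply/eqP; move: c1; rewrite c2 EAB => /eqP; rewrite eqn_pmul2r // eqn_pmul2r ?muln_gt0 ?A0' // eq_sym.
subst A'; have EB2 : B = B' by apply/eqP; rewrite -(eqn_pmul2l A0) EAB.
subst B'.
have IC : (I %| C)%N by apply: dvdn_trans IEC; rewrite dvdn_mulr.
have IC' : (I' %| C)%N by apply: dvdn_trans IEC'; rewrite dvdn_mulr.
have EI : I = I'.
  apply/eqP; rewrite eqn_dvd (presents_dvd P Q IC).1 ?dvdn_mulr //.
  by rewrite (presents_dvd Q P IC').1 ?dvdn_mulr.
subst I'; have I0 : (0 < I)%N by exact: dvdn_gt0 IC.
split=> //; apply/eqP; rewrite -(eqn_pmul2l I0) eqn_dvd.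
rewrite (presents_dvd P Q IEC).2 // ?(presents_dvd Q P IEC').2 //.
  by rewrite mulnC dvdn_mul.
by rewrite mulnC dvdn_mul.
Qed.

(** In G x H let D be generated by (x, x') and (y, y'). It satisfies the same relations, hence |D|
    <= |G| = |H|, yet it projects onto both groups; so both projections are isomorphisms. *)
Lemma presents_isog (gT hT : finGroupType) (G : {group gT}) (H : {group hT})
    x y x' y' A B C f1 f2 :
  presents G x y A B C f1 f2 -> presents H x' y' A B C f1 f2 -> G \isog H.
Proof.
move=> P Q; have [[GE cG CA] [xz yz zC xA yAB]] := P.
have [[HE cH _] [xz' yz' zC' xA' yAB']] := Q.
pose X := (x, x'); pose Y := (y, y'); pose D := <<[set X; Y]>>.
have RE : [~ X, Y] = ([~ x, y], [~ x', y']) by [].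
have pE u v n : ((u, v) : gT * hT) ^+ n = (u ^+ n, v ^+ n).
  by elim: n => // n IH; rewrite !expgS IH.
have XZ : commute X [~ X, Y] by rewrite RE; congr (_, _).
have YZ : commute Y [~ X, Y] by rewrite RE; congr (_, _).
have [A0 B0 C0] := presents_gt0 P.
have := gen2_card_le XZ YZ; rewrite -/D => leD.
have nX : X \in 'N(<[ [~ X, Y] ]>) by apply: (subsetP (gen2_norm XZ YZ)); exact: mem_gen2l.
have nY : Y \in 'N(<[ [~ X, Y] ]>) by apply: (subsetP (gen2_norm XZ YZ)); exact: mem_gen2r.
have leDn : (#|D| <= A * (A * B) * C)%N.
  apply: leq_trans leD _; apply: leq_mul; first apply: leq_mul.
  - apply: dvdn_leq => //; rewrite order_dvdn -morphX //= coset_id //.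
    by rewrite pE xA xA' -pE -RE mem_cycle.
  - apply: dvdn_leq; first by rewrite muln_gt0 A0.
    rewrite order_dvdn -morphX //= coset_id //.
    by rewrite pE yAB yAB' -pE -RE mem_cycle.
  - by apply: dvdn_leq => //; rewrite order_dvdn RE pE zC zC'.
pose p1 := Morphism (in2W (@fst_morphM gT hT) : {in D &, {morph fst : x y / x * y}}).
pose p2 := Morphism (in2W (@snd_morphM gT hT) : {in D &, {morph snd : x y / x * y}}).
have XD : X \in D by exact: mem_gen2l.
have YD : Y \in D by exact: mem_gen2r.
have i1 : p1 @* D = G.
  rewrite morphim_gen ?subUset ?sub1set ?XD ?YD //= GE.
  by rewrite morphimU !morphim_set1.
have i2 : p2 @* D = H.
  rewrite morphim_gen ?subUset ?sub1set ?XD ?YD //= HE.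
  by rewrite morphimU !morphim_set1.
have j1 : 'injm p1.
  by rewrite -card_im_injm eqn_leq leq_morphim i1 cG.
have j2 : 'injm p2.
  by rewrite -card_im_injm eqn_leq leq_morphim i2 cH.
have g1 : D \isog G by rewrite -i1; apply: sub_isog.
have g2 : D \isog H by rewrite -i2; apply: sub_isog.
by apply: isog_trans g2; rewrite isog_sym.
Qed.

Lemma nilpotent_22_gen (gT : finGroupType) (G : {group gT}) :
  nilpotent_cd 2 2 G ->
  [~: G^`(1), G] = 1 /\ 'm(G) <= 2.
Proof.
by case/and3P=> nG clG mG; split=> //; apply/(lcn_nil_classP 2 nG).
Qed.

Lemma abelian_gen2 (gT : finGroupType) (G : {group gT}) :
  abelian G -> 'm(G) <= 2 ->
  exists u v, [/\ G :=: <[u]> * <[v]>, (#[u] %| #[v])%N & #|G| = (#[u] * #[v])%N].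
Proof.
move=> cG mG; have [b dG ab] := abelian_structure cG.
have sb : size b <= 2 by rewrite -(size_map order) ab size_abelian_type // -grank_abelian.
have := abelian_type_dvdn_sorted G; rewrite -ab.
case: b dG sb {ab} => [|v [|u [|]]] //= dG _.
- exists 1, 1; rewrite order1 muln1; move: dG; rewrite big_nil cycle1 mulg1 => <-.
  by split=> //; rewrite cards1.
- exists 1, v; move: dG; rewrite big_seq1 order1 mul1n cycle1 mul1g dvd1n => <-.
  by split.
rewrite andbT => uv; exists u, v; move: dG; rewrite big_cons big_seq1 => dG.
have := dprod_card dG; rewrite -!orderE mulnC => <-; split=> //.
by rewrite -(dprodWC dG).
Qed.

(** Lift two generators of the abelian quotient G / G' and let H be the subgroup that they generate.
    As G' is central, G = H G' is a central product, so H' = G' and therefore H = G. *)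
Lemma presents_ex (gT : finGroupType) (G : {group gT}) :
  nilpotent_cd 2 2 G -> exists x y A B C f1 f2, presents G x y A B C f1 f2.
Proof.
move=> /nilpotent_22_gen[L3 mG].
have cGG : G^`(1) \subset 'C(G) by apply/commG1P.
have nG : G \subset 'N(G^`(1)) := der_norm 1 G.
have [u [v [GuV uv cGb]]] := abelian_gen2 (der_abelian 0 G) (leq_trans (quotient_grank nG) mG).
have : u \in G / G^`(1) by rewrite /= GuV -{1}[u]mulg1 mem_mulg ?cycle_id ?group1.
case/morphimP=> x nx Gx Eu.
have : v \in G / G^`(1) by rewrite /= GuV -{1}[v]mul1g mem_mulg ?cycle_id ?group1.
case/morphimP=> y ny Gy Ev.
set H := <<[set x; y]>>%G.
have HG : H \subset G by rewrite gen_subG subUset !sub1set Gx.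
have GE0 : G :=: H * G^`(1).
  apply/eqP; rewrite eqEsubset mul_subG ?der_sub // andbT; apply/subsetP=> w Gw.
  have nw := subsetP nG w Gw.
  have : coset G^`(1) w \in G / G^`(1) by exact: mem_quotient.
  rewrite /= GuV => /imset2P[_ _ /cycleP[i ->] /cycleP[j ->]].
  rewrite Eu Ev /= -!morphX // -morphM ?groupX // => E.
  set h := x ^+ i * y ^+ j in E; have nh : h \in 'N(G^`(1)) by rewrite groupM ?groupX.
  rewrite -(mulKVg h w) mem_mulg //; first by rewrite groupM ?groupX ?mem_gen2l ?mem_gen2r.
  apply: coset_idr; first by rewrite groupM ?groupV.
  by rewrite morphM ?groupV // morphV //= E mulVg.
have cp : H \* G^`(1) = G.
  by rewrite cprodE -?GE0 // (subset_trans cGG) // centS.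
have HD : H^`(1) = G^`(1).
  have := der_cprod 1 cp; have /eqP -> : (G^`(1))^`(1) == 1.
    by apply/eqP/commG1P; rewrite (subset_trans cGG) // centS // der_sub.
  by rewrite cprodg1.
have GE : G :=: <<[set x; y]>>.
  rewrite GE0; apply/eqP; rewrite eqEsubset mul_subG //=; last by rewrite -HD der_sub.
  by rewrite mulg_subl ?group1.
have Dz : [~ x, y] \in G^`(1) by rewrite mem_commg.
have cz w : w \in G -> commute w [~ x, y].
  by move=> Gw; apply/commute_sym/(centsP cGG).
have GD := gen2_der1 (cz x Gx) (cz y Gy); rewrite -GE in GD.
have [B oB] := dvdnP uv.
have xz : x ^+ #[u] \in <[ [~ x, y] ]>.
  rewrite -GD; apply: coset_idr; first by rewrite groupX.
  by rewrite morphX //= -Eu expg_order.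
have yz : y ^+ #[v] \in <[ [~ x, y] ]>.
  rewrite -GD; apply: coset_idr; first by rewrite groupX.
  by rewrite morphX //= -Ev expg_order.
have [/cycleP[k1 E1] /cycleP[k2 E2]] := (xz, yz).
pose A := #[u]; pose C := #[[~ x, y]].
(* As 2 kap vanishes modulo C, adding kap here cancels the one built into [presents]. *)
exists x, y, A, B, C, (k1 + kap A B)%N, (k2 + kap A B)%N.
(* z^A = [x^A, y] is trivial, because x^A is a power of the central element z. *)
have CA : (C %| A)%N.
  rewrite order_dvdn -(commXg _ (cz x Gx)).
  by apply/commgP; rewrite E1; apply/commute_sym/commuteX/cz.
have k2C k : [~ x, y] ^+ (k + kap A B + kap A B) = [~ x, y] ^+ k.
  rewrite -addnA addnn -muln2 expgD.
  have /dvdnP[q ->] : (C %| kap A B * 2)%N.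
    by rewrite (dvdn_trans CA) // /kap -mulnA bin2_mul2 mulnCA dvdn_mulr.
  by rewrite [(q * C)%N]mulnC expgM expg_order expg1n mulg1.
split; split=> //; try exact: cz.
- have cD : #|G^`(1)| = C by rewrite GD.
  rewrite -(Lagrange (der_sub 1 G)) -card_quotient // cGb cD mulnC oB.
  by rewrite (mulnC B).
- exact: expg_order.
- by rewrite k2C.
- by rewrite k2C mulnC -oB.
Qed.

(** The shift of x makes gcd(h1, C) = I, that of y makes gcd(h2, C) = J = gcd(f2, B h1, C). Then I |
    J, and J divides B h1 and B C, hence B I, so E = J / I divides B. Units modulo C turn h1 and h2
    into I and J = I E. *)
Lemma presents_normal (gT : finGroupType) (G : {group gT}) x y A B C f1 f2 :
  presents G x y A B C f1 f2 -> exists x' y' I E,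
  [/\ presents G x' y' A B C I (I * E), (I * E %| C)%N & (E %| B)%N].
Proof.
move=> P; have [A0 B0 C0] := presents_gt0 P.
have [t Et] := gcdn_shift f1 f2 C0.
have {}P := presents_addx P t; set h1 := (f1 + t * f2)%N in P Et.
set I := gcdn (gcdn f1 f2) C in Et.
have [s Es] := gcdn_shift f2 (B * h1) C0.
have {}P := presents_addy P s; set h2 := (f2 + _)%N in P Es.
set J := gcdn (gcdn f2 (B * h1)) C in Es.
have IC : (I %| C)%N by rewrite dvdn_gcdr.
have I0 : (0 < I)%N by exact: dvdn_gt0 IC.
have IJ : (I %| J)%N.
  rewrite !dvdn_gcd IC andbT dvdn_mull /=; last by rewrite -Et dvdn_gcdl.
  by rewrite (dvdn_trans (dvdn_gcdl _ _)) ?dvdn_gcdr.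
have [E JE] := dvdnP IJ.
have EB : (E %| B)%N.
  rewrite -(dvdn_pmul2r I0) -JE -Et muln_gcdr dvdn_gcd; apply/andP; split.
    by rewrite (dvdn_trans (dvdn_gcdl _ _)) ?dvdn_gcdr.
  by rewrite dvdn_mull // dvdn_gcdr.
have [[_ cG _] _] := P.
have Cn : (C %| #|G|)%N by rewrite cG dvdn_mull.
have [de [cde Ede]] := mul_coprime_modn h1 (cardG_gt0 G) Cn.
have [al [cal Eal]] := mul_coprime_modn h2 (cardG_gt0 G) Cn.
rewrite Et in Ede; rewrite Es JE mulnC [(E * I)%N]mulnC in Eal.
exists ((x * y ^+ (B * t)) ^+ al), ((((x * y ^+ (B * t)) ^+ s) * y) ^+ de), I, E.
split=> //; first by apply: (presents_scale P cal cde Ede); rewrite mulnC.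
by rewrite mulnC -JE dvdn_gcdr.
Qed.

(** Read modulo <z>, the last hypothesis gives the orders A and AB of the images of x and y and the
    trivial intersection of their cyclic groups; at i = j = 0 it gives the order of z. The order of
    G follows. *)
Lemma presents_of_faithful (gT : finGroupType) (G : {group gT}) x y A B C f1 f2 :
  (0 < A)%N -> (0 < B)%N -> (0 < C)%N -> (C %| A)%N ->
  G :=: <<[set x; y]>> ->
  commute x [~ x, y] -> commute y [~ x, y] -> [~ x, y] ^+ C = 1 ->
  x ^+ A = [~ x, y] ^+ (f1 + kap A B) ->
  y ^+ (A * B) = [~ x, y] ^+ (f2 + kap A B) ->
  (forall i j k, x ^+ i * y ^+ j * [~ x, y] ^+ k = 1 ->
     [/\ (A %| i)%N, (A * B %| j)%N & i = 0%N -> j = 0%N -> (C %| k)%N]) ->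
  presents G x y A B C f1 f2.
Proof.
move=> A0 B0 C0 CA GE cx cy zC xA yAB H; split; split=> //.
set z := [~ x, y] in cx cy zC xA yAB H *.
have oz : #[z] = C.
  apply/eqP; rewrite eqn_dvd order_dvdn zC eqxx /=.
  by have [] := H 0%N 0%N #[z]; [rewrite !expg0 !mul1g expg_order | move=> _ _ ->].
have nG : G \subset 'N(<[z]>) by rewrite GE; exact: gen2_norm.
have Gx : x \in G by rewrite GE mem_gen2l.
have Gy : y \in G by rewrite GE mem_gen2r.
have nx := subsetP nG x Gx; have ny := subsetP nG y Gy.
have mem i j : x ^+ i * y ^+ j \in <[z]> -> (A %| i)%N /\ (A * B %| j)%N.
  case/cycleP=> k E; have [] // := H i j (k * (#[z].-1))%N.
  rewrite E -expgD -{1}[k]muln1 -mulnDr add1n prednK ?order_gt0 //.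
  by rewrite mulnC expgM expg_order expg1n.
have ox : #[coset <[z]> x] = A.
  apply/eqP; rewrite eqn_dvd; apply/andP; split.
    by rewrite order_dvdn -morphX //= xA coset_id // mem_cycle.
  apply: (mem _ 0%N _).1; rewrite expg0 mulg1.
  by apply: coset_idr; rewrite ?groupX // morphX //= expg_order.
have oy : #[coset <[z]> y] = (A * B)%N.
  apply/eqP; rewrite eqn_dvd; apply/andP; split.
    by rewrite order_dvdn -morphX //= yAB coset_id // mem_cycle.
  apply: (mem 0%N _ _).2; rewrite expg0 mul1g.
  by apply: coset_idr; rewrite ?groupX // morphX //= expg_order.
have nz : <[z]> <| G by rewrite GE; exact: gen2_normal.
rewrite -(Lagrange (normal_sub nz)) -card_quotient // -orderE oz mulnC; congr (_ * _)%N.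
rewrite {1}GE gen2_quotient // TI_cardMg -?orderE ?ox ?oy //.
apply/trivgP/subsetP=> _ /setIP[/cycleP[i ->] /cycleP[j E]].
have [] := mem i (j * (A * B).-1)%N.
  apply: coset_idr; first by rewrite groupM ?groupX.
  rewrite morphM ?groupX // !morphX //= E -expgD -{1}[j]muln1 -mulnDr add1n.
  by rewrite prednK ?muln_gt0 ?A0 // mulnC expgM -oy expg_order expg1n.
by move=> /dvdnP[q ->] _; rewrite mulnC expgM -ox expg_order expg1n inE.
Qed.

(* Upper unitriangular matrices [[1, a, c], [0, 1, b], [0, 0, 1]] over Z/M. *)
Definition heis (M : nat) : Type := ('Z_M * 'Z_M * 'Z_M)%type.
HB.instance Definition _ M := Finite.on (heis M).

Section HeisenbergGroup.
Import GRing.Theory.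
Local Open Scope ring_scope.
Variable M : nat.

Definition heis_mul (u v : heis M) : heis M :=
  (u.1.1 + v.1.1, u.1.2 + v.1.2, u.2 + v.2 + u.1.1 * v.1.2).
Definition heis_one : heis M := (0, 0, 0).
Definition heis_inv (u : heis M) : heis M :=
  (- u.1.1, - u.1.2, - u.2 + u.1.1 * u.1.2).

Fact heis_mulA : associative heis_mul.
Proof.
by move=> [[a b] c] [[a' b'] c'] [[a'' b''] c'']; congr (_, _, _) => /=; ring.
Qed.

Fact heis_mul1 : left_id heis_one heis_mul.
Proof. by move=> [[a b] c]; congr (_, _, _) => /=; ring. Qed.

Fact heis_mulV : left_inverse heis_one heis_inv heis_mul.
Proof. by move=> [[a b] c]; congr (_, _, _) => /=; ring. Qed.

HB.instance Definition _ :=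
  Finite_isGroup.Build (heis M) heis_mulA heis_mul1 heis_mulV.
End HeisenbergGroup.

(** * Realization by quotients of Heisenberg groups *)

Section Existence.
Import GRing.Theory.
Variables A B C f1 f2 : nat.
Hypotheses (A0 : (0 < A)%N) (B0 : (0 < B)%N) (C0 : (0 < C)%N) (CA : (C %| A)%N).
(** The factor 2 keeps M > 1, so that ['Z_M] is Z/M. As A C and A B C divide M, the equations A s =
    0 and A B t = 0 in Z/M force s and t to be multiples of C. *)
Let M := (2 * A * B * C)%N.
Let M1 : (1 < M)%N. Proof. by rewrite /M; nia. Qed.
Local Notation ZM := 'Z_M.
Local Notation h1 := (f1 + kap A B)%N.
Local Notation h2 := (f2 + kap A B)%N.

Let natZ m n : (m%:R = n%:R :> ZM)%R -> m = n %[mod M].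
Proof. by move/(congr1 val); rewrite /= !val_Zp_nat. Qed.

Let dvd_of_mul k l (s : ZM) : (k * l %| M)%N -> (0 < k)%N ->
  (k%:R * s = 0 :> ZM)%R -> exists s', (s = l%:R * s' :> ZM)%R.
Proof.
move=> kM k0; rewrite -(natr_Zp s) -natrM => E.
have : (M %| k * s)%N.
  by apply/eqP; rewrite (natZ (E : _ = 0%:R)%R) mod0n.
move/(dvdn_trans kM); rewrite dvdn_pmul2l // => /dvdnP[q ->].
by exists (q%:R)%R; rewrite -natrM mulnC.
Qed.

Let dvd_nat k n (s : ZM) : (k %| M)%N -> (n%:R = k%:R * s :> ZM)%R -> (k %| n)%N.
Proof.
move=> kM; rewrite -(natr_Zp s) -natrM => /natZ E.
by rewrite /dvdn -(modn_dvdm _ kM) E (modn_dvdm _ kM) modnMr.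
Qed.

(** The subgroup generated by the relators (A, 0, -h1), (0, AB, -h2) and (0, 0, C). Cross terms of
    products and conjugates are multiples of A, hence of C, and are absorbed by r. *)
Definition heis_rel : {set heis M} := [set v |
  [exists s : ZM, exists t : ZM, exists r : ZM,
    v == (A%:R * s, (A * B)%:R * t, - h1%:R * s - h2%:R * t + C%:R * r)%R]].

Lemma heis_relP (v : heis M) : reflect (exists s t r : ZM,
   v = (A%:R * s, (A * B)%:R * t, - h1%:R * s - h2%:R * t + C%:R * r)%R)
  (v \in heis_rel).
Proof.
rewrite inE; apply: (iffP existsP) => [[s /existsP[t /existsP[r /eqP ->]]]|[s [t [r ->]]]].
  by exists s, t, r.
by exists s; apply/existsP; exists t; apply/existsP; exists r.
Qed.

Lemma heis_rel_group_set : group_set heis_rel.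
Proof.
apply/group_setP; split.
  by apply/heis_relP; exists 0%R, 0%R, 0%R; rewrite !mulr0 subr0 addr0.
move=> _ _ /heis_relP[s [t [r ->]]] /heis_relP[s' [t' [r' ->]]].
apply/heis_relP; have [q ->] := dvdnP CA.
exists (s + s')%R, (t + t')%R, (r + r' + q%:R * s * ((q * C * B)%:R * t'))%R.
rewrite /mulg /= /heis_mul /=; congr (_, _, _); rewrite ?natrM; ring.
Qed.

Canonical heis_rel_group := Group heis_rel_group_set.

Lemma heis_rel_normal : heis_rel <| [set: heis M].
Proof.
apply/andP; split; first exact: subsetT.
apply/subsetP=> -[[a b] c] _; rewrite inE; apply/subsetP=> _ /imsetP[_ /heis_relP[s [t [r ->]]] ->].
apply/heis_relP; have [q ->] := dvdnP CA.
exists s, t, (r + q%:R * s * b - a * (q * B)%:R * t)%R.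
rewrite /conjg /mulg /invg /= /heis_mul /heis_inv /=.
congr (_, _, _); rewrite ?natrM; ring.
Qed.

Let X : heis M := (1, 0, 0)%R.
Let Y : heis M := (0, 1, 0)%R.
Let Z : heis M := (0, 0, 1)%R.

Let XE n : X ^+ n = (n%:R, 0, 0)%R.
Proof.
elim: n => // n IH; rewrite expgS IH /mulg /= /heis_mul /=.
by congr (_, _, _); rewrite ?mulrS //; ring.
Qed.
Let YE n : Y ^+ n = (0, n%:R, 0)%R.
Proof.
elim: n => // n IH; rewrite expgS IH /mulg /= /heis_mul /=.
by congr (_, _, _); rewrite ?mulrS //; ring.
Qed.
Let ZE n : Z ^+ n = (0, 0, n%:R)%R.
Proof.
elim: n => // n IH; rewrite expgS IH /mulg /= /heis_mul /=.
by congr (_, _, _); rewrite ?mulrS //; ring.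
Qed.

Let XY : [~ X, Y] = Z.
Proof.
rewrite /commg /conjg /mulg /invg /= /heis_mul /heis_inv /=.
by congr (_, _, _); ring.
Qed.

Lemma presents_quotient_heis : exists (gT : finGroupType) (G : {group gT}) (x y : gT),
  presents G x y A B C f1 f2.
Proof.
have /andP[_ nN] := heis_rel_normal.
have nn u : u \in 'N(heis_rel) by apply: (subsetP nN).
pose x := coset heis_rel X; pose y := coset heis_rel Y.
have Ez : [~ x, y] = coset heis_rel Z by rewrite -XY morphR.
exists _, ([set: heis M] / heis_rel)%G, x, y.
apply: presents_of_faithful => //.
- rewrite /= (_ : [set: heis M] = <<[set X; Y]>>).
    by rewrite quotient_gen ?subUset ?sub1set ?nn // quotientE morphimU !morphim_set1.
  apply/eqP; rewrite eq_sym eqEsubset subsetT /=; apply/subsetP=> -[[a b] c] _.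
  (* With Y on the left the product has no cross term. *)
  have -> : ((a, b, c) : heis M) = Y ^+ b * X ^+ a * [~ X, Y] ^+ c.
    rewrite XY XE YE ZE !natr_Zp /mulg /= /heis_mul /=.
    by congr (_, _, _); ring.
  by rewrite !groupM ?groupX ?groupR ?mem_gen2l ?mem_gen2r.
- rewrite Ez /commute -!morphM //; congr coset.
  rewrite /mulg /= /heis_mul /=; congr (_, _, _); ring.
- rewrite Ez /commute -!morphM //; congr coset.
  rewrite /mulg /= /heis_mul /=; congr (_, _, _); ring.
- rewrite Ez -morphX //= ZE coset_id //; apply/heis_relP; exists 0%R, 0%R, 1%R.
  by congr (_, _, _); ring.
- rewrite Ez -!morphX //= XE ZE.
  have -> : (A%:R, 0, 0)%R = ((0, 0, h1%:R)%R : heis M) * ((A%:R, 0, - h1%:R)%R : heis M).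
    by rewrite /mulg /= /heis_mul /=; congr (_, _, _); ring.
  rewrite coset_kerr //; apply/heis_relP; exists 1%R, 0%R, 0%R.
  by congr (_, _, _); ring.
- rewrite Ez -!morphX //= YE ZE.
  have -> : (0, (A * B)%:R, 0)%R = ((0, 0, h2%:R)%R : heis M) * ((0, (A * B)%:R, - h2%:R)%R : heis M).
    by rewrite /mulg /= /heis_mul /=; congr (_, _, _); ring.
  rewrite coset_kerr //; apply/heis_relP; exists 0%R, 1%R, 0%R.
  by congr (_, _, _); ring.
move=> i j k; rewrite Ez -!morphX // -!morphM ?groupX ?nn //= => E.
have : X ^+ i * Y ^+ j * Z ^+ k \in heis_rel by exact: coset_idr.
have -> : X ^+ i * Y ^+ j * Z ^+ k = ((i%:R, j%:R, (i * j + k)%:R)%R : heis M).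
  by rewrite XE YE ZE /mulg /= /heis_mul /=; congr (_, _, _); rewrite ?natrD ?natrM; ring.
case/heis_relP=> s [t [r Es]]; have E1 := congr1 (fun v : heis M => v.1.1) Es.
have E2 := congr1 (fun v : heis M => v.1.2) Es.
have {Es} E3 := congr1 (fun v : heis M => v.2) Es.
rewrite /= in E1 E2 E3.
have dA : (A %| M)%N by rewrite /M -!mulnA mulnCA dvdn_mulr.
have dAB : (A * B %| M)%N by rewrite /M -!mulnA mulnCA (mulnCA 2) mulnA dvdn_mulr.
split; first exact: dvd_nat E1.
  exact: dvd_nat E2.
move=> i0 j0; move: E1 E2 E3; rewrite i0 j0 => /esym E1 /esym E2 E3.
have [s' Es] : exists s', (s = C%:R * s' :> ZM)%R.
  by apply: dvd_of_mul E1 => //; rewrite /M; apply/dvdnP; exists (2 * B)%N; lia.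
have [t' Et] : exists t', (t = C%:R * t' :> ZM)%R.
  apply: dvd_of_mul E2; rewrite ?muln_gt0 ?A0 //.
  by rewrite /M; apply/dvdnP; exists 2; lia.
apply: (@dvd_nat _ _ (- h1%:R * s' - h2%:R * t' + r)%R).
  by rewrite dvdn_mull.
by move: E3; rewrite mul0n add0n Es Et => ->; ring.
Qed.
End Existence.

Lemma presents_transport (gT hT : finGroupType) (G : {group gT}) (H : {group hT})
    x y A B C f1 f2 :
  G \isog H -> presents G x y A B C f1 f2 ->
  exists x' y', presents H x' y' A B C f1 f2.
Proof.
move=> GH P; have cGH := card_isog GH; case/isogP: GH => f injf fG.
have [[GE cG CA] [cx cy zC xA yAB]] := P.
have Gx : x \in G by rewrite GE mem_gen2l.
have Gy : y \in G by rewrite GE mem_gen2r.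
have Gz : [~ x, y] \in G by rewrite groupR.
exists (f x), (f y); rewrite /presents -!morphR // -!morphX // xA yAB zC !morphX // morph1.
split; split=> //; try by rewrite /commute -!morphM // -?cx -?cy.
- have -> : H :=: f @* <<[set x; y]>> by rewrite -GE -fG.
  by rewrite morphim_gen ?morphimU ?morphim_set1 // subUset !sub1set Gx.
- by rewrite -cGH.
Qed.

Lemma presents_nilpotent_cd (gT : finGroupType) (G : {group gT}) x y A B C f1 f2 :
  presents G x y A B C f1 f2 -> nilpotent_cd 2 2 G.
Proof.
move=> [[GE _ _] [cx cy _ _ _]]; rewrite /nilpotent_cd andbA {1 2}GE.
rewrite gen2_nil //= GE (leq_trans (grank_min _)) //.
by rewrite cards2; case: eqP.
Qed.

(** Counting by labels: Q matches labels with isomorphism classes. It is a relation ranging over all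
    group types because the groups realizing different labels live in different types. *)
Lemma g_eq_card n c d (T : finType) (D : {set T})
    (Q : T -> forall gT : finGroupType, {group gT} -> Prop) :
  (forall t, t \in D -> exists (gT : finGroupType) (G : {group gT}),
     [/\ Q t gT G, #|G| = n & nilpotent_cd c d G]) ->
  (forall t t' (gT hT : finGroupType) (G : {group gT}) (H : {group hT}),
     t \in D -> t' \in D -> Q t gT G -> Q t' hT H -> G \isog H -> t = t') ->
  (forall t (gT hT : finGroupType) (G : {group gT}) (H : {group hT}),
     Q t gT G -> Q t hT H -> G \isog H) ->
  (forall (gT : finGroupType) (G : {group gT}),
     #|G| = n -> nilpotent_cd c d G -> exists t, t \in D /\ Q t gT G) ->
  g n c d = #|D|.
Proof.
move=> Dex Dinj Diso Dsurj; have [X [Xn Xinj Xsurj]] := gP n c d.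
have /fin_all_exists[f Hf] i : exists t, t \in D /\ Q t _ (X i).
  by have [cX nX] := Xn i; exact: Dsurj.
have injf : injective f.
  move=> i j Eij; apply: Xinj; apply: Diso (Hf i).2 _.
  by rewrite Eij; exact: (Hf j).2.
rewrite -[LHS]card_ord -(card_imset predT injf); apply: eq_card => t.
apply/imsetP/idP => [[i _ ->]|Dt]; first exact: (Hf i).1.
have [gT [G [QG cG nG]]] := Dex t Dt; have [i Gi] := Xsurj gT G cG nG.
by exists i => //; apply: Dinj Gi => //; case: (Hf i).
Qed.

Definition tuple_weight (b a c1 c2 e : nat) : nat :=
  (b * (a ^ 2 * (c1 ^ 3 * (c2 ^ 3 * e ^ 4))))%N.

Lemma tuple_weight_gt0 b a c1 c2 e : (0 < tuple_weight b a c1 c2 e)%N ->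
  [/\ 0 < b, 0 < a, 0 < c1, 0 < c2 & 0 < e]%N.
Proof.
rewrite /tuple_weight; case: b => [|b]; first by rewrite mul0n.
case: a => [|a]; first by rewrite exp0n ?mul0n ?muln0.
case: c1 => [|c1]; first by rewrite exp0n ?mul0n ?muln0.
case: c2 => [|c2]; first by rewrite exp0n ?mul0n ?muln0.
by case: e => [|e] //; rewrite exp0n ?mul0n ?muln0.
Qed.

Lemma g22_card n : (0 < n)%N -> g n 2 2 =
  #|[set t : 'I_n.+1 * ('I_n.+1 * ('I_n.+1 * ('I_n.+1 * 'I_n.+1))) |
      tuple_weight t.1 t.2.1 t.2.2.1 t.2.2.2.1 t.2.2.2.2 == n]|.
Proof.
move=> n0.
pose Q (t : 'I_n.+1 * ('I_n.+1 * ('I_n.+1 * ('I_n.+1 * 'I_n.+1)))) (gT : finGroupType)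
    (G : {group gT}) := let: (b, (a, (c1, (c2, e)))) := t in
  exists x y, presents G x y (a * (c1 * c2 * e)) (b * e) (c1 * c2 * e) c1 (c1 * e).
apply: (g_eq_card (Q := Q)).
- move=> [b [a [c1 [c2 e]]]]; rewrite inE /= => /eqP Ew.
  have: (0 < tuple_weight b a c1 c2 e)%N by rewrite Ew.
  case/tuple_weight_gt0=> b0 a0 c10 c20 e0.
  have [gT [G [x [y P]]]] : exists (gT : finGroupType) (G : {group gT}) (x y : gT),
      presents G x y (a * (c1 * c2 * e)) (b * e) (c1 * c2 * e) c1 (c1 * e).
    apply: presents_quotient_heis; rewrite ?muln_gt0 ?b0 ?a0 ?c10 ?c20 ?e0 //.
    exact: dvdn_mull.
  exists gT, G; split; [by exists x, y | | exact: presents_nilpotent_cd P].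
  by have [[_ -> _] _] := P; rewrite -[RHS]Ew /tuple_weight; ring.
- move=> [b [a [c1 [c2 e]]]] [b' [a' [c1' [c2' e']]]] gT hT G H.
  rewrite !inE /= => /eqP Ew /eqP Ew' [x [y P]] [x' [y' P']] GH.
  have [x1 [y1 P1]] := presents_transport GH P.
  have IEC k1 k2 k3 : (k1 * k3 %| k1 * k2 * k3)%N by rewrite mulnAC dvdn_mulr.
  have [EA EB EC EI EE] := presents_unique P1 P' (IEC _ _ _) (dvdn_mull _ (dvdnn _))
    (IEC _ _ _) (dvdn_mull _ (dvdnn _)).
  have: (0 < tuple_weight b a c1 c2 e)%N by rewrite Ew.
  case/tuple_weight_gt0=> b0 a0 c10 c20 e0.
  have Ee : e = e' by apply/val_inj.
  have Ec1 : c1 = c1' by apply/val_inj.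
  subst e' c1'.
  have Ec2 : c2 = c2'.
    by apply/val_inj/eqP; move/eqP: EC; rewrite eqn_pmul2r // eqn_pmul2l.
  subst c2'; have C0 : (0 < c1 * c2 * e)%N by rewrite !muln_gt0 c10 c20.
  have Ea : a = a' by apply/val_inj/eqP; move/eqP: EA; rewrite eqn_pmul2r.
  have Eb : b = b' by apply/val_inj/eqP; move/eqP: EB; rewrite eqn_pmul2r.
  by subst.
- move=> [b [a [c1 [c2 e]]]] gT hT G H [x [y P]] [x' [y' P']].
  exact: presents_isog P P'.
move=> gT G cG nG; have [x [y [A [B [C [f1 [f2 P]]]]]]] := presents_ex nG.
have [x' [y' [I [E [P' IEC EB]]]]] := presents_normal P.
have [A0 B0 C0] := presents_gt0 P'; have [[_ cG' /dvdnP[a EA]] _] := P'.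
have [[c2 EC] [b Eb]] := (dvdnP IEC, dvdnP EB).
have wn : tuple_weight b a I c2 E = n.
  by rewrite -cG cG' EA Eb EC /tuple_weight; ring.
have [b0 a0 I0 c20 E0] : [/\ 0 < b, 0 < a, 0 < I, 0 < c2 & 0 < E]%N.
  by apply: tuple_weight_gt0; rewrite wn.
have pk k m : (0 < m)%N -> (0 < k)%N -> (m <= m ^ k)%N.
  by move=> m0 k0; rewrite -{1}[m]expn1 leq_pexp2l.
have lt_n m : (0 < m)%N -> (m %| n)%N -> (m < n.+1)%N by move=> m0 /(dvdn_leq n0).
have dn : [/\ b %| n, a %| n, I %| n, c2 %| n & E %| n]%N.
  have dX k m q : (0 < k)%N -> (m ^ k %| q)%N -> (m %| q)%N.
    by move=> k0; apply: dvdn_trans; rewrite -{1}[m]expn1 dvdn_exp2l.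
  rewrite -wn /tuple_weight; split; first exact: dvdn_mulr.
  - by apply: (dX 2) => //; rewrite mulnCA dvdn_mulr.
  - by apply: (dX 3) => //; rewrite 2!(mulnA, mulnCA) dvdn_mulr // dvdn_mull.
  - by apply: (dX 3) => //; do 3!(apply: dvdn_mull); apply: dvdn_mulr.
  - by apply: (dX 4) => //; do 4!(apply: dvdn_mull).
case: dn => db da dI dc de.
exists (Ordinal (lt_n _ b0 db), (Ordinal (lt_n _ a0 da), (Ordinal (lt_n _ I0 dI),
  (Ordinal (lt_n _ c20 dc), Ordinal (lt_n _ E0 de))))).
rewrite inE /= wn eqxx; split=> //; exists x', y'.
have EC' : (I * c2 * E = C)%N by rewrite EC mulnCA mulnA.
by rewrite EC' -EA -Eb.
Qed.

End Classification.

(** * Dirichlet convolutions *)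

Section Counting.
Local Open Scope nat_scope.

Definition dconv (a b : nat -> nat) (n : nat) : nat :=
  \sum_(i < n.+1) \sum_(j < n.+1 | i * j == n) a i * b j.

(** For k, n > 0 this is the coefficient of n^(-s) in zeta(k s); [power_conv] below gives the
    coefficients of a product of such factors. *)
Definition power_count (k n : nat) : nat := \sum_(i < n.+1) (i ^ k == n).

Fixpoint power_conv (s : seq nat) : nat -> nat :=
  if s is k :: s' then dconv (power_count k) (power_conv s') else fun n => n == 1.

Lemma dconv_bound a b n N : 0 < n -> n <= N ->
  dconv a b n = \sum_(i < N.+1) \sum_(j < N.+1 | i * j == n) a i * b j.
Proof.
move=> n0 nN; have nN1 : n.+1 <= N.+1 by [].
rewrite /dconv.
rewrite (big_ord_widen N.+1 (fun i => \sum_(j < n.+1 | i * j == n) a i * b j)) //.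
rewrite [RHS](bigID (fun i : 'I_N.+1 => i < n.+1)) /= [X in _ = _ + X]big1 ?addn0.
  apply: eq_bigr => i _.
  rewrite (big_ord_widen_cond N.+1 (fun j => i * j == n) (fun j => a i * b j)) //.
  apply: eq_bigl => j; case: eqP => //= E.
  have i0 : 0 < i by case: (posnP i) E n0 => // ->; rewrite mul0n => <-.
  by rewrite ltnS -E leq_pmull.
move=> i; rewrite -leqNgt => ni; apply: big1 => j /eqP E.
have j0 : 0 < j by case: (posnP j) E n0 => // ->; rewrite muln0 => <-.
by have := leq_pmulr i j0; rewrite E; lia.
Qed.

Lemma power_count_bound k n N : 0 < k -> n <= N ->
  power_count k n = \sum_(i < N.+1) (i ^ k == n).
Proof.
move=> k0 nN; rewrite /power_count (big_ord_widen N.+1 (fun i => nat_of_bool (i ^ k == n))) //.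
rewrite [RHS](bigID (fun i : 'I_N.+1 => i < n.+1)) /= [X in _ = _ + X]big1 ?addn0 //.
move=> i; rewrite -leqNgt => ni; case: eqP => // E.
have i0 : 0 < i by lia.
by have : i <= i ^ k; [rewrite -{1}[nat_of_ord i]expn1 leq_pexp2l | lia].
Qed.

Lemma sum_eq_mul (T : finType) (w : T -> nat) x m N : 0 < m -> m <= N ->
  \sum_(j < N.+1 | x * j == m) \sum_(t : T) (w t == j) =
  \sum_(t : T) (x * w t == m).
Proof.
move=> m0 mN; rewrite exchange_big; apply: eq_bigr => t _ /=.
have [E|nE] := eqVneq (x * w t) m; last first.
  apply: big1 => j /eqP E; case: eqP => // wj.
  by rewrite wj E eqxx in nE.
have x0 : 0 < x by case: (posnP x) E m0 => // ->; rewrite mul0n => <-.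
have wN : w t < N.+1 by rewrite ltnS (leq_trans _ mN) // -E leq_pmull.
rewrite (bigD1 (Ordinal wN)) /= ?E ?eqxx // big1 // => j /andP[_ nj].
by case: eqP => // wj; case/eqP: nj; apply: val_inj.
Qed.

(** If c counts the elements of each weight, convolution with [power_count k] adds a coordinate q
    that multiplies the weight by q^k. Five such steps produce [tuple_weight]. *)
Lemma power_conv_step (T : finType) (w : T -> nat) (c : nat -> nat) k N : 0 < k ->
  (forall j, 0 < j -> j <= N -> c j = \sum_(t : T) (w t == j)) ->
  forall m, 0 < m -> m <= N -> dconv (power_count k) c m =
    \sum_(u : 'I_N.+1 * T) (u.1 ^ k * w u.2 == m).
Proof.
move=> k0 Hc m m0 mN; rewrite (dconv_bound _ _ m0 mN).
transitivity (\sum_(i < N.+1) \sum_(j < N.+1 | i ^ k * j == m) c j); last first.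
  rewrite -(pair_bigA _ (fun (i : 'I_N.+1) t => nat_of_bool (i ^ k * w t == m))) /=.
  apply: eq_bigr => i _; rewrite -(sum_eq_mul _ _ m0 mN).
  apply: eq_bigr => j /eqP E; apply: Hc; last by rewrite -ltnS.
  by case: (posnP j) E m0 => // ->; rewrite muln0 => <-.
(* The root q of i = q^k becomes a summation variable; for fixed q and j the sum over i collapses to
   i = q^k. *)
transitivity (\sum_(q < N.+1) \sum_(i < N.+1) \sum_(j < N.+1 | i * j == m)
    (q ^ k == i) * c j).
  rewrite exchange_big; apply: eq_bigr => i _.
  rewrite (power_count_bound k0 (_ : i <= N)); last by rewrite -ltnS.
  rewrite /= [RHS]exchange_big; apply: eq_bigr => j _; rewrite big_distrl //.
apply: eq_bigr => q _.
rewrite (exchange_big_dep predT) //= [RHS]big_mkcond; apply: eq_bigr => j _.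
have [E|nE] := eqVneq (q ^ k * j) m; last first.
  apply: big1 => i /eqP E; case: eqP => // qi; by rewrite qi E eqxx in nE.
have j0 : 0 < j by case: (posnP j) E m0 => // ->; rewrite muln0 => <-.
have qN : q ^ k < N.+1 by rewrite ltnS (leq_trans _ mN) // -E leq_pmulr.
rewrite (bigD1 (Ordinal qN)) /= ?E ?eqxx // mul1n big1 ?addn0 // => i /andP[_ ni].
by case: eqP => // qi; case/eqP: ni; apply: val_inj.
Qed.

Lemma g22_power_conv n : 0 < n -> g n 2 2 = power_conv [:: 1; 2; 3; 3; 4] n.
Proof.
move=> n0; rewrite (g22_card n0) -sum1_card big_mkcond /=.
have H0 j : 0 < j -> j <= n -> power_conv [::] j = \sum_(t : unit) (1 == j).
  by move=> _ _; rewrite /= big_const card_unit /= addn0 eq_sym.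
have H1 := power_conv_step (isT : 0 < 4) H0.
have H2 := power_conv_step (isT : 0 < 3) H1.
have H3 := power_conv_step (isT : 0 < 3) H2.
have H4 := power_conv_step (isT : 0 < 2) H3.
have H5 := power_conv_step (isT : 0 < 1) H4.
rewrite /power_conv (H5 n n0 (leqnn n)).
pose f (u : 'I_n.+1 * ('I_n.+1 * ('I_n.+1 * ('I_n.+1 * ('I_n.+1 * unit))))) :=
  (u.1, (u.2.1, (u.2.2.1, (u.2.2.2.1, u.2.2.2.2.1)))).
have bf : bijective f.
  exists (fun v => (v.1, (v.2.1, (v.2.2.1, (v.2.2.2.1, (v.2.2.2.2, tt)))))).
    by move=> [? [? [? [? [? []]]]]].
  by move=> [? [? [? [? ?]]]].
rewrite (reindex f); last exact: onW_bij.
apply: eq_bigr => u _; rewrite inE /tuple_weight /= expn1 muln1.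
by case: (_ == _).
Qed.

Lemma dconv_divisors a b n : 0 < n ->
  dconv a b n = \sum_(d <- divisors n) a d * b (n %/ d).
Proof.
move=> n0; rewrite /dconv -(big_mkord xpredT (fun i => \sum_(j < n.+1 | i * j == n) a i * b j)).
transitivity (\sum_(0 <= i < n.+1 | i %| n) a i * b (n %/ i)).
  rewrite [RHS]big_mkcond /=; apply: eq_big_nat => i _.
  case: ifP => [/dvdnP[q E]|nd]; last first.
    by rewrite big_pred0 // => j; apply/eqP => E; rewrite -E dvdn_mulr in nd.
  have i0 : 0 < i by case: (posnP i) E n0 => // ->; rewrite muln0 => ->.
  have qn : q < n.+1 by rewrite ltnS E leq_pmulr.
  have -> : n %/ i = q by rewrite E mulnK.
  rewrite (bigD1 (Ordinal qn)) /=; last by rewrite [in X in _ == X]E mulnC.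
  rewrite big1 ?addn0 // => j /andP[/eqP Ej nj]; case/eqP: nj; apply: val_inj => /=.
  by apply/eqP; rewrite -(eqn_pmul2l i0) Ej mulnC -E.
rewrite -big_filter; apply: perm_big; apply: uniq_perm.
- by rewrite filter_uniq // iota_uniq.
- exact: divisors_uniq.
move=> i; rewrite mem_filter mem_index_iota -dvdn_divisors //=.
by have [/dvdn_leq|] := boolP (i %| n); rewrite ?andbF // => /(_ n0); rewrite ltnS.
Qed.

(** The coefficient of t^i in the product of 1 / (1 - t^k) over k in s, written with lists so that
    it can be evaluated by computation. *)
Fixpoint local_coef (s : seq nat) (i : nat) : nat :=
  if s is k :: s' then
    sumn [seq (k %| u) * local_coef s' (i - u) | u <- iota 0 i.+1]
  else i == 0.

Lemma power_count_pfactor k p u : prime p -> 0 < k ->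
  power_count k (p ^ u) = (k %| u).
Proof.
move=> pp k0; have p0 := prime_gt0 pp; have p1 := prime_gt1 pp.
have [/dvdnP[q E]|nk] := boolP (k %| u).
  have qn : p ^ q < (p ^ u).+1 by rewrite ltnS leq_exp2l // E leq_pmulr.
  rewrite /power_count (bigD1 (Ordinal qn)) //= -expnM -E eqxx big1 //.
  move=> i ni; case: eqP => // Ei; case/eqP: ni; apply: val_inj => /=.
  by apply/eqP; rewrite -(eqn_exp2r _ _ k0) Ei -expnM -E.
rewrite /power_count big1 // => i _; case: eqP => // Ei.
case/negP: nk; have i0 : 0 < i.
  by case: (posnP i) Ei => // ->; rewrite exp0n // => /eqP; rewrite eq_sym expn_eq0 -leqn0 leqNgt p0.
have -> : u = k * logn p i by rewrite -lognX Ei pfactorK.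
exact: dvdn_mulr.
Qed.

Lemma power_conv_pfactor s p i : prime p -> 0 \notin s ->
  power_conv s (p ^ i) = local_coef s i.
Proof.
move=> pp; have p0 := prime_gt0 pp; have p1 := prime_gt1 pp.
elim: s i => [|k s IH] i; first by move=> _ /=; rewrite -[1](expn0 p) eqn_exp2l.
rewrite in_cons negb_or eq_sym -lt0n => /andP[k0 s0] /=.
rewrite -[_ + _]/(sumn [seq (k %| u) * local_coef s (i - u) | u <- iota 0 i.+1]).
rewrite sumnE big_map dconv_divisors ?expn_gt0 ?p0 //.
have /(perm_big _) -> : perm_eq (divisors (p ^ i)) [seq p ^ u | u <- iota 0 i.+1].
  apply: uniq_perm; rewrite ?divisors_uniq //.
    by rewrite map_inj_uniq ?iota_uniq // => u v /eqP; rewrite eqn_exp2l // => /eqP.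
  move=> d; rewrite -dvdn_divisors ?expn_gt0 ?p0 //.
  apply/(dvdn_pfactor _ _ pp)/mapP => [[u ui ->]|[u ui ->]]; exists u => //.
    by rewrite mem_iota.
  by move: ui; rewrite mem_iota.
rewrite big_map; apply: eq_big_seq => u; rewrite mem_iota ltnS => /= ui.
by rewrite power_count_pfactor // -expnB // IH.
Qed.

Lemma local_zeta22 p : prime p -> mkseq (local_zeta 2 2 p) 20 =
  [:: 1; 1; 2; 4; 6; 8; 13; 17; 23; 31; 40; 50; 65; 79; 97; 119; 143; 169; 203; 237].
Proof.
move=> pp; transitivity (mkseq (local_coef [:: 1; 2; 3; 3; 4]) 20); last first.
  by vm_compute.
apply: eq_mkseq => i; rewrite /local_zeta g22_power_conv ?expn_gt0 ?prime_gt0 //.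
exact: power_conv_pfactor.
Qed.

Lemma g22_gt0 n : 0 < n -> 0 < g n 2 2.
Proof.
case: n => // n _; rewrite g22_card //; apply/card_gt0P.
pose o : 'I_n.+2 := Ordinal (isT : 1 < n.+2).
(* The tuple of the cyclic group: b is the group order and the other entries are 1. *)
exists (ord_max, (o, (o, (o, o)))).
by rewrite inE /= /tuple_weight !exp1n !muln1.
Qed.

End Counting.

From mathcomp Require Import complex.
From mathcomp Require Import all_classical all_reals all_analysis.
From mathcomp Require Import lra.
Import Order.TTheory GRing.Theory Num.Theory numFieldNormedType.Exports.
Local Open Scope ring_scope.

(** * Complex series and derivatives *)

Section Continuation.
Import Normc.
Local Open Scope classical_set_scope.
Local Open Scope ring_scope.
Local Open Scope complex_scope.

Section ComplexModulus.
Variable R : realType.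
Implicit Types z w : R[i].

Lemma norm_normc z : `|z| = (normc z)%:C. Proof. by []. Qed.

Lemma normc_ge0 z : 0 <= normc z.
Proof. by case: z => a b; exact: sqrtr_ge0. Qed.

Lemma normc_real (x : R) : normc x%:C = `|x|.
Proof. by rewrite /= expr0n /= addr0 sqrtr_sqr. Qed.

Lemma normcC z w : normc (z - w) = normc (w - z).
Proof. by rewrite -opprB normcN. Qed.

Lemma le_normcB z w : normc (z - w) <= normc z + normc w.
Proof. by rewrite -(normcN w); exact: le_normcD. Qed.

Lemma normc_eq0 z : (normc z == 0) = (z == 0).
Proof. by apply/eqP/eqP => [/eq0_normc //|->]; rewrite normc0. Qed.

Lemma normc_gt0 z : (0 < normc z) = (z != 0).
Proof. by rewrite lt_neqAle normc_ge0 andbT eq_sym normc_eq0. Qed.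

Lemma le_normc_sum I (r : seq I) (P : pred I) (F : I -> R[i]) :
  normc (\sum_(i <- r | P i) F i) <= \sum_(i <- r | P i) normc (F i).
Proof.
elim/big_rec2 : _ => [|i y z _ h]; first by rewrite normc0.
by apply: le_trans (le_normcD _ _) _; rewrite lerD2l.
Qed.

Lemma normc_ge_Re z : `|complex.Re z| <= normc z.
Proof. by case: z => a b /=; rewrite -sqrtr_sqr ler_wsqrtr // lerDl sqr_ge0. Qed.

Lemma normc_ge_Im z : `|complex.Im z| <= normc z.
Proof. by case: z => a b /=; rewrite -sqrtr_sqr ler_wsqrtr // lerDr sqr_ge0. Qed.

Lemma normc_le_ReIm z : normc z <= `|complex.Re z| + `|complex.Im z|.
Proof.
case: z => a b /=; rewrite -[X in _ <= X]ger0_norm ?addr_ge0 //.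
rewrite -[X in _ <= X]sqrtr_sqr ler_wsqrtr // sqrrD -!normrX.
rewrite !(ger0_norm (sqr_ge0 _)) addrAC lerDl mulrn_wge0 // mulr_ge0 //.
Qed.

Lemma ReD z w : complex.Re (z + w) = complex.Re z + complex.Re w.
Proof. by case: z; case: w. Qed.
Lemma ImD z w : complex.Im (z + w) = complex.Im z + complex.Im w.
Proof. by case: z; case: w. Qed.
Lemma ReN z : complex.Re (- z) = - complex.Re z. Proof. by case: z. Qed.
Lemma ImN z : complex.Im (- z) = - complex.Im z. Proof. by case: z. Qed.
Lemma ReM z w : complex.Re (z * w) =
  complex.Re z * complex.Re w - complex.Im z * complex.Im w.
Proof. by case: z; case: w. Qed.
Lemma ImM z w : complex.Im (z * w) =
  complex.Re z * complex.Im w + complex.Im z * complex.Re w.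
Proof. by case: z; case: w. Qed.
Lemma Re_sum I (r : seq I) (P : pred I) (F : I -> R[i]) :
  complex.Re (\sum_(i <- r | P i) F i) = \sum_(i <- r | P i) complex.Re (F i).
Proof. by elim/big_rec2 : _ => // i y z _ <-; rewrite ReD. Qed.
Lemma Im_sum I (r : seq I) (P : pred I) (F : I -> R[i]) :
  complex.Im (\sum_(i <- r | P i) F i) = \sum_(i <- r | P i) complex.Im (F i).
Proof. by elim/big_rec2 : _ => // i y z _ <-; rewrite ImD. Qed.

Lemma complex_eq z w :
  complex.Re z = complex.Re w -> complex.Im z = complex.Im w -> z = w.
Proof. by case: z; case: w => /= a b c d -> ->. Qed.

Lemma natrC n : (n%:R : R[i]) = (n%:R : R)%:C.
Proof. by rewrite rmorph_nat. Qed.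

Lemma normc_nat n : normc (n%:R : R[i]) = n%:R.
Proof. by rewrite natrC normc_real ger0_norm. Qed.

(** Cauchy-Schwarz in the plane: the left side is the real part of z times the conjugate of w. *)
Lemma dot_le_normc z w : complex.Re z * complex.Re w + complex.Im z * complex.Im w
  <= normc z * normc w.
Proof.
have -> : complex.Re z * complex.Re w + complex.Im z * complex.Im w =
    complex.Re (z * w^*).
  by case: z => a b; case: w => c d /=; ring.
apply: le_trans (ler_norm _) _; apply: le_trans (normc_ge_Re _) _.
rewrite normcM; have -> // : normc w^* = normc w.
by case: w => a b /=; rewrite sqrrN.
Qed.

Lemma normc_sqr z : normc z ^+ 2 = complex.Re z ^+ 2 + complex.Im z ^+ 2.
Proof. by case: z => a b /=; rewrite sqr_sqrtr ?addr_ge0 ?sqr_ge0. Qed.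

End ComplexModulus.

Section RealVariable.
Variable R : realType.

(** Componentwise, so that the real differentiation rules and the real mean value theorem apply. *)
Definition is_cderive (g : R -> R[i]) (x : R) (d : R[i]) : Prop :=
  is_derive x 1 (@complex.Re R \o g) (complex.Re d) /\
  is_derive x 1 (@complex.Im R \o g) (complex.Im d).

Lemma is_cderiveB g h x d e : is_cderive g x d -> is_cderive h x e ->
  is_cderive (fun t => g t - h t) x (d - e).
Proof.
move=> [g1 g2] [h1 h2]; split; rewrite ?ReD ?ImD ?ReN ?ImN.
  have -> : @complex.Re R \o (fun t => g t - h t) = (@complex.Re R \o g) - (@complex.Re R \o h).
    by apply/funext => t /=; rewrite ReD ReN.
  exact: is_deriveB.
have -> : @complex.Im R \o (fun t => g t - h t) = (@complex.Im R \o g) - (@complex.Im R \o h).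
  by apply/funext => t /=; rewrite ImD ImN.
exact: is_deriveB.
Qed.

Lemma is_cderive_const c x : is_cderive (fun _ => c) x 0.
Proof. by split; [exact: (is_derive_cst (complex.Re c))|exact: (is_derive_cst (complex.Im c))]. Qed.

Lemma is_cderiveZ c g x d : is_cderive g x d -> is_cderive (fun t => c * g t) x (c * d).
Proof.
move=> [g1 g2]; split; rewrite ?ReM ?ImM.
  have -> : @complex.Re R \o (fun t => c * g t) =
    (complex.Re c \*: (@complex.Re R \o g)) - (complex.Im c \*: (@complex.Im R \o g)).
    by apply/funext => t /=; rewrite ReM.
  exact: is_deriveB.
have -> : @complex.Im R \o (fun t => c * g t) =
  (complex.Re c \*: (@complex.Im R \o g)) + (complex.Im c \*: (@complex.Re R \o g)).
  by apply/funext => t /=; rewrite ImM.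
exact: is_deriveD.
Qed.

Lemma is_cderive_real (u : R -> R) (x d : R) : is_derive x 1 u d ->
  is_cderive (fun t => (u t)%:C) x d%:C.
Proof. by move=> h; split => //=; exact: (is_derive_cst 0). Qed.

Lemma is_cderive_shift g x a d : is_cderive g (x + a) d ->
  is_cderive (fun t => g (t + a)) x d.
Proof.
have sh : is_derive x 1 (fun t : R => t + a) 1.
  have -> : (fun t => t + a) = (id + cst a : R -> R) by [].
  by apply: is_derive_eq; rewrite addr0.
move=> [g1 g2]; split.
  have := @is_derive1_comp _ (@complex.Re R \o g) (fun t => t + a) x _ _ g1 sh.
  by rewrite mulr1.
have := @is_derive1_comp _ (@complex.Im R \o g) (fun t => t + a) x _ _ g2 sh.
by rewrite mulr1.
Qed.

Lemma is_cderive_cexp (a : R[i]) (u : R -> R) (x d : R) : is_derive x 1 u d ->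
  is_cderive (fun t => cexp (a * (u t)%:C)) x (a * d%:C * cexp (a * (u x)%:C)).
Proof.
move=> du.
have dz b : is_derive x 1 (fun t => b * u t) (b * d) by exact: is_deriveZ.
have E t : cexp (a * (u t)%:C) =
   (expR (complex.Re a * u t) * cos (complex.Im a * u t)) +i*
   (expR (complex.Re a * u t) * sin (complex.Im a * u t)).
  rewrite /cexp ReM ImM /= !mulr0 subr0 add0r.
  by apply: complex_eq; rewrite /= ?mul0r ?subr0 ?addr0.
have de : is_derive x 1 (fun t => expR (complex.Re a * u t))
    (expR (complex.Re a * u x) * (complex.Re a * d)).
  exact: is_derive1_comp.
have dc : is_derive x 1 (fun t => cos (complex.Im a * u t))
    (- sin (complex.Im a * u x) * (complex.Im a * d)).
  exact: is_derive1_comp.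
have ds : is_derive x 1 (fun t => sin (complex.Im a * u t))
    (cos (complex.Im a * u x) * (complex.Im a * d)).
  exact: is_derive1_comp.
split.
  have -> : @complex.Re R \o (fun t => cexp (a * (u t)%:C)) =
    (fun t => expR (complex.Re a * u t)) * (fun t => cos (complex.Im a * u t)).
    by apply/funext => t; rewrite [LHS](congr1 (@complex.Re R) (E t)).
  apply: is_derive_eq; rewrite E; case: a {E dz de dc ds} => ar ai /=.
  by rewrite /GRing.scale /=; ring.
have -> : @complex.Im R \o (fun t => cexp (a * (u t)%:C)) =
  (fun t => expR (complex.Re a * u t)) * (fun t => sin (complex.Im a * u t)).
  by apply/funext => t; rewrite [LHS](congr1 (@complex.Im R) (E t)).
apply: is_derive_eq; rewrite E; case: a {E dz de dc ds} => ar ai /=.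
by rewrite /GRing.scale /=; ring.
Qed.

(** Project g onto the direction c = g b - g a. The real mean value theorem for phi = <c, g> gives
    |c|^2 = phi b - phi a <= |c| M (b - a). *)
Lemma cmean_value (g dg : R -> R[i]) a b M : a <= b ->
  (forall x, a <= x <= b -> is_cderive g x (dg x)) ->
  (forall x, a <= x <= b -> normc (dg x) <= M) ->
  normc (g b - g a) <= M * (b - a).
Proof.
move=> ab dgx leM; set c := g b - g a.
have [c0|c0] := eqVneq c 0.
  rewrite c0 normc0 mulr_ge0 ?subr_ge0 //.
  by apply: le_trans (normc_ge0 _) (leM a _); rewrite lexx.
pose phi t := complex.Re c * complex.Re (g t) + complex.Im c * complex.Im (g t).
pose dphi t := complex.Re c * complex.Re (dg t) + complex.Im c * complex.Im (dg t).
have dp x : a <= x <= b -> is_derive x 1 phi (dphi x).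
  move=> /dgx[h1 h2].
  have -> : phi = (complex.Re c \*: (@complex.Re R \o g)) + (complex.Im c \*: (@complex.Im R \o g)).
    by [].
  exact: is_deriveD.
have [|t|x /[!in_itv]/= xab] := @MVT_segment _ phi dphi a b ab.
- by move=> x; rewrite in_itv /= => /andP[ax xb]; apply: dp; rewrite !ltW.
- apply/continuous_in_subspaceT => ? -/[!(@mem_setE R)] /[!in_itv]/= tab.
  by apply/differentiable_continuous/derivable1_diffP; have [] := dp _ tab.
have -> : phi b - phi a = normc c ^+ 2.
  by rewrite normc_sqr /phi /c !ReD !ImD !ReN !ImN; ring.
move=> E; rewrite -(ler_pM2l (_ : 0 < normc c)) ?normc_gt0 //.
rewrite -expr2 E mulrA ler_wpM2r ?subr_ge0 //.
apply: le_trans (dot_le_normc _ _) _.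
by rewrite ler_wpM2l ?normc_ge0 ?leM.
Qed.

End RealVariable.

Section ComplexExponential.
Variable R : realType.
Implicit Types z w h : R[i].

Lemma cexpD z w : cexp (z + w) = cexp z * cexp w.
Proof.
rewrite /cexp ReD ImD expRD cosD sinD; case: z => a b; case: w => c d /=.
by apply: complex_eq => /=; ring.
Qed.

Lemma cexp_real (x : R) : cexp x%:C = (expR x)%:C.
Proof. by rewrite /cexp /= cos0 sin0; apply: complex_eq => /=; ring. Qed.

Lemma cexp0 : cexp 0 = 1 :> R[i].
Proof. by rewrite -[0]/((0 : R)%:C) cexp_real expR0. Qed.

Lemma normc_cexp z : normc (cexp z) = expR (complex.Re z).
Proof.
rewrite /cexp normcM normc_real ger0_norm ?expR_ge0 //=.
by rewrite cos2Dsin2 sqrtr1 mulr1.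
Qed.

Lemma is_derive_half_sq (t : R) : is_derive t 1 (fun t : R => t ^+ 2 / 2) t.
Proof.
have -> : (fun t : R => t ^+ 2 / 2) = (2^-1 \*: (id ^+ 2)) :> (R -> R).
  by apply/funext => u /=; rewrite mulrC.
by apply: is_derive_eq; rewrite /= expr1 /GRing.scale /= mulr1 mulrA mulVf ?mul1r.
Qed.

Lemma is_cderive_ray h (t : R) :
  is_cderive (fun t => cexp (h * t%:C)) t (h * cexp (h * t%:C)).
Proof. by have := is_cderive_cexp h (is_derive_id t 1); rewrite mulr1. Qed.

Lemma is_cderive_line h (t : R) : is_cderive (fun t => h * t%:C) t h.
Proof.
by have := is_cderiveZ h (is_cderive_real (is_derive_id t 1)); rewrite mulr1.
Qed.

Lemma normc_ray h (t : R) : 0 <= t <= 1 -> normc (h * t%:C) <= normc h.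
Proof.
move=> /andP[t0 t1]; rewrite normcM normc_real (ger0_norm t0).
by rewrite -[X in _ <= X]mulr1 ler_wpM2l ?normc_ge0.
Qed.

(** The mean value inequality along t -> cexp (h t), 0 <= t <= 1. The next two Taylor remainders
    repeat the argument, each bounding its derivative by the preceding estimate. *)
Lemma normc_cexpB1 h : normc (cexp h - 1) <= normc h * expR (normc h).
Proof.
have := @cmean_value R (fun t => cexp (h * t%:C) - 1) (fun t => h * cexp (h * t%:C) - 0)
  0 1 (normc h * expR (normc h)) ler01.
rewrite !mulr1 mulr0 cexp0 subrr !subr0 mulr1; apply.
  by move=> x _; apply: is_cderiveB; [exact: is_cderive_ray|exact: is_cderive_const].
move=> x x01; rewrite subr0 normcM ler_wpM2l ?normc_ge0 // normc_cexp ler_expR.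
apply: le_trans (ler_norm _) _; apply: le_trans (normc_ge_Re _) _; exact: normc_ray.
Qed.

Lemma normc_cexpB2 h : normc (cexp h - 1 - h) <= normc h ^+ 2 * expR (normc h).
Proof.
have := @cmean_value R (fun t => cexp (h * t%:C) - 1 - h * t%:C)
  (fun t => h * cexp (h * t%:C) - 0 - h)
  0 1 (normc h ^+ 2 * expR (normc h)) ler01.
rewrite !mulr1 mulr0 cexp0 subrr !subr0 mulr1; apply.
  move=> x _; apply: is_cderiveB; last exact: is_cderive_line.
  by apply: is_cderiveB; [exact: is_cderive_ray|exact: is_cderive_const].
move=> x x01; rewrite subr0 -[X in _ - X]mulr1 -mulrBr normcM expr2 -mulrA.
rewrite ler_wpM2l ?normc_ge0 //; apply: le_trans (normc_cexpB1 _) _.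
by apply: ler_pM; rewrite ?normc_ge0 ?expR_ge0 ?ler_expR ?normc_ray.
Qed.

Lemma normc_cexpB3 h :
  normc (cexp h - 1 - h - h ^+ 2 / 2) <= normc h ^+ 3 * expR (normc h).
Proof.
have := @cmean_value R (fun t => cexp (h * t%:C) - 1 - h * t%:C - h ^+ 2 * (t ^+ 2 / 2)%:C)
  (fun t => h * cexp (h * t%:C) - 0 - h - h ^+ 2 * t%:C)
  0 1 (normc h ^+ 3 * expR (normc h)) ler01.
rewrite !mulr1 mulr0 cexp0 subrr !subr0 mulr1 expr0n /= mul0r mulr0 subr0.
rewrite expr1n mul1r (_ : (2^-1)%:C = 2^-1); last by rewrite fmorphV rmorph_nat.
rewrite (subr0 (_ - h ^+ 2 / 2)); apply.
  move=> x _; apply: is_cderiveB; last first.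
    by apply: is_cderiveZ; apply: is_cderive_real; exact: is_derive_half_sq.
  apply: is_cderiveB; last exact: is_cderive_line.
  by apply: is_cderiveB; [exact: is_cderive_ray|exact: is_cderive_const].
move=> x x01; rewrite subr0.
rewrite (_ : _ - _ = h * (cexp (h * x%:C) - 1 - h * x%:C)); last by ring.
rewrite normcM exprS -mulrA ler_wpM2l ?normc_ge0 //.
apply: le_trans (normc_cexpB2 _) _.
by apply: ler_pM; rewrite ?exprn_ge0 ?normc_ge0 ?expR_ge0 ?ler_expR ?normc_ray //
  lerXn2r ?nnegrE ?normc_ge0 ?normc_ray.
Qed.

End ComplexExponential.

Section ComplexTopology.
Variable R : realType.
Notation C := ((R[i])^o).

Lemma gt0C (e : R[i]) : 0 < e -> exists2 x : R, 0 < x & e = x%:C.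
Proof.
case: e => a b; rewrite ltcE /= => /andP[/eqP -> a0]; by exists a.
Qed.

Lemma nearC (z : C) (P : C -> Prop) :
  (\forall w \near z, P w) <-> exists2 d : R, 0 < d & forall w, normc (w - z) < d -> P w.
Proof.
split.
  case/nbhs_normP => e /= e0 He; have [d d0 Ed] := gt0C e0.
  exists d => // w wd; apply: He; rewrite /= Ed norm_normc ltcR.
  by rewrite normcC.
move=> [d d0 H]; apply/nbhs_normP; exists d%:C; first by rewrite /= ltcR.
by move=> w /=; rewrite norm_normc ltcR normcC; exact: H.
Qed.

Lemma cvgC T (F : set_system T) {FF : Filter F} (f : T -> C) (l : C) :
  (forall e : R, 0 < e -> \forall t \near F, normc (f t - l) < e) -> f @ F --> l.
Proof.
move=> H; apply/cvgrPdist_lt => e e0; have [d d0 ->] := gt0C e0.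
have := H d d0; apply: filterS => t; by rewrite norm_normc ltcR normcC.
Qed.

Lemma cvgCP T (F : set_system T) {FF : Filter F} (f : T -> C) (l : C) :
  f @ F --> l -> forall e : R, 0 < e -> \forall t \near F, normc (f t - l) < e.
Proof.
move=> /cvgrPdist_lt H e e0; have e0' : 0 < e%:C :> R[i] by rewrite ltcR.
have := H _ e0'; apply: filterS => t; by rewrite norm_normc ltcR normcC.
Qed.

(** Stated without division by h, so that sums, multiples and series of functions need only linear
    estimates. *)
Definition has_cderiv (f : R[i] -> R[i]) (z l : R[i]) : Prop :=
  forall e : R, 0 < e -> exists2 d : R, 0 < d &
    forall h, normc h < d -> normc (f (z + h) - f z - h * l) <= e * normc h.

Lemma has_cderiv_derivable (f : C -> C) (z : C) (l : R[i]) :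
  has_cderiv f z l -> derivable f z 1.
Proof.
move=> H; apply/cvg_ex; exists l; apply: cvgC => e e0.
have e20 : 0 < e / 2 by rewrite divr_gt0.
have [d d0 Hd] := H _ e20.
rewrite near_withinE; apply/nearC; exists d => // h; rewrite subr0 => hd h0.
rewrite /= (_ : h *: 1 + z = z + h); last by rewrite addrC /GRing.scale /= mulr1.
have -> : h^-1 *: (f (z + h) - f z) - l = h^-1 * (f (z + h) - f z - h * l).
  by rewrite [in RHS]mulrBr mulrA mulVf // mul1r.
rewrite normcM normcV; apply: le_lt_trans (_ : (normc h)^-1 * (e / 2 * normc h) < e).
  by rewrite ler_wpM2l ?invr_ge0 ?normc_ge0 // Hd.
rewrite mulrCA mulVf ?mulr1 ?normc_eq0 //; lra.
Qed.

Lemma has_cderiv_cexp z : has_cderiv (@cexp R) z (cexp z).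
Proof.
move=> e e0; pose K := expR (complex.Re z) * expR 1.
have K0 : 0 < K by rewrite mulr_gt0 ?expR_gt0.
exists (Num.min 1 (e / K)); first by rewrite lt_min ltr01 divr_gt0.
move=> h; rewrite lt_min => /andP[h1 he].
rewrite cexpD (_ : _ - _ = cexp z * (cexp h - 1 - h)); last by ring.
rewrite normcM normc_cexp.
apply: le_trans (_ : expR (complex.Re z) * (normc h ^+ 2 * expR 1) <= _).
  rewrite ler_wpM2l ?expR_ge0 //; apply: le_trans (normc_cexpB2 _) _.
  by rewrite ler_wpM2l ?exprn_ge0 ?normc_ge0 // ler_expR ltW.
rewrite (_ : _ * _ = K * normc h * normc h); last by rewrite /K; ring.
by rewrite ler_wpM2r ?normc_ge0 // mulrC -ler_pdivlMr // ltW.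
Qed.

Lemma has_cderiv_continuous f z l : has_cderiv f z l ->
  forall e : R, 0 < e -> exists2 d : R, 0 < d &
    forall h, normc h < d -> normc (f (z + h) - f z) < e.
Proof.
move=> H e e0; have [d d0 Hd] := H 1 ltr01.
have K0 : 0 < 1 + normc l by rewrite ltr_pwDl ?normc_ge0.
exists (Num.min d (e / (1 + normc l))); first by rewrite lt_min d0 divr_gt0.
move=> h; rewrite lt_min => /andP[hd he].
have -> : f (z + h) - f z = (f (z + h) - f z - h * l) + h * l by ring.
apply: le_lt_trans (le_normcD _ _) _; rewrite normcM.
apply: le_lt_trans (_ : normc h * (1 + normc l) < _).
  by rewrite mulrDr mulr1 lerD2r -[X in _ <= X]mul1r Hd.
by rewrite -ltr_pdivlMr.
Qed.

End ComplexTopology.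

Section RealSeries.
Variable R : realType.
Implicit Types u v : nat -> R.

Lemma le_series_lim u n : (forall k, 0 <= u k) -> cvgn (series u) ->
  series u n <= limn (series u).
Proof.
move=> u0 cu; apply: nondecreasing_cvgn_le => //.
by apply: nondecreasing_series.
Qed.

Lemma series_bounded_cvg u (M : R) : (forall k, 0 <= u k) ->
  (forall n, series u n <= M) -> cvgn (series u).
Proof.
move=> u0 uM; apply: nondecreasing_is_cvgn; first exact: nondecreasing_series.
by exists M => _ [n _ <-].
Qed.

Lemma series_tail u : (forall k, 0 <= u k) -> cvgn (series u) ->
  forall e : R, 0 < e -> exists K, forall n, (K <= n)%N -> series u n - series u K <= e.
Proof.
move=> u0 cu e e0; have /cvgrPdist_le/(_ e e0) := cu.
case=> K _ HK; exists K => n Kn.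
have := HK K (leqnn K); have := le_series_lim n u0 cu.
rewrite ler_norml => h /andP[_]; lra.
Qed.

(** Induction works for the sharper bound 2 - 1/n, since 1/(n+1)^2 <= 1/n - 1/(n+1). *)
Lemma cvg_series_invsq : cvgn (series (fun k => (k.+1%:R ^- 2) : R)).
Proof.
apply: (@series_bounded_cvg _ 2) => [k|n]; first by rewrite invr_ge0 exprn_ge0.
suff: series (fun k => (k.+1%:R ^- 2) : R) n <= 2 - (n%:R)^-1 *+ (0 < n)%N.
  by move/le_trans; apply; rewrite gerDl oppr_le0 mulrn_wge0 ?invr_ge0.
elim: n => [|n IH]; first by rewrite /series /= big_geq // mulr0n subr0.
rewrite seriesSr; case: n IH => [|n] IH.
  by rewrite /series /= big_geq // add0r expr1n invr1 mulr1n; lra.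
rewrite /= !mulr1n in IH *; apply: (le_trans (lerD IH (lexx _))).
have n1 : 0 < n.+1%:R :> R by rewrite ltr0n.
have n2 : 0 < n.+2%:R :> R by rewrite ltr0n.
have E : n.+2%:R = n.+1%:R + 1 :> R by rewrite -[n.+2]addn1 natrD.
rewrite -subr_ge0; set a := n.+1%:R in n1 E *; rewrite E in n2 *.
have -> : 2 - (a + 1)^-1 - (2 - a^-1 + (a + 1) ^- 2) = (a * (a + 1) ^+ 2)^-1.
  by field; rewrite !gt_eqF.
by rewrite invr_ge0 mulr_ge0 ?exprn_ge0 ?ltW.
Qed.

End RealSeries.

Section ComplexSeries.
Variable R : realType.
Notation C := ((R[i])^o).
Implicit Types a b : nat -> C.

Definition abs_summable (a : nat -> R[i]) : Prop := cvgn (series (fun n => normc (a n))).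

Lemma abs_summable_le a (M : nat -> R) : (forall k, normc (a k) <= M k) ->
  cvgn (series M) -> abs_summable a.
Proof.
move=> aM; apply: series_le_cvg => // k; first exact: normc_ge0.
exact: le_trans (normc_ge0 _) (aM k).
Qed.

Lemma Re_series a n : complex.Re (series a n) = series (fun k => complex.Re (a k)) n.
Proof. by rewrite /series /= Re_sum. Qed.

Lemma Im_series a n : complex.Im (series a n) = series (fun k => complex.Im (a k)) n.
Proof. by rewrite /series /= Im_sum. Qed.

Lemma cvgC_ReIm (u : nat -> C) (x y : R) :
  (fun n => complex.Re (u n)) @ \oo --> x -> (fun n => complex.Im (u n)) @ \oo --> y ->
  u @ \oo --> (x +i* y : C).
Proof.
move=> ux uy; apply: cvgC => e e0; have e20 : 0 < e / 2 by rewrite divr_gt0.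
near=> n; apply: le_lt_trans (normc_le_ReIm _) _.
rewrite ReD ImD ReN ImN /= [e]splitr ltrD //.
  by rewrite distrC; near: n; apply: cvgr_dist_lt.
by rewrite distrC; near: n; apply: cvgr_dist_lt.
Unshelve. all: by end_near. Qed.

Lemma abs_summable_cvg a : abs_summable a -> cvgn (series a).
Proof.
move=> sa; have H (f : R[i] -> R) : (forall z, `|f z| <= normc z) ->
    cvgn (series (fun k => f (a k))).
  move=> fz; apply: normed_cvg; apply: series_le_cvg sa => k.
  - exact: normr_ge0.
  - exact: normc_ge0.
  - exact: fz.
apply/cvg_ex; exists (limn (series (fun k => complex.Re (a k))) +i*
  limn (series (fun k => complex.Im (a k)))).
apply: cvgC_ReIm.
  under eq_fun do rewrite Re_series; exact: H (@normc_ge_Re R).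
under eq_fun do rewrite Im_series; exact: H (@normc_ge_Im R).
Qed.

Lemma cvgC_unique (u : nat -> C) (l l' : C) : u @ \oo --> l -> u @ \oo --> l' -> l = l'.
Proof. exact: cvg_unique. Qed.

Lemma cvgC_lim (u : nat -> C) (l : C) : u @ \oo --> l -> limn u = l.
Proof. exact: cvg_lim. Qed.

Lemma normc_lim_le (u : nat -> C) (l : C) (M : R) : u @ \oo --> l ->
  (\forall n \near \oo, normc (u n) <= M) -> normc l <= M.
Proof.
move=> ul uM; apply/ler_addgt0Pr => e e0.
have H := cvgCP ul e0.
near \oo => n.
have -> : l = u n - (u n - l) by rewrite subKr.
apply: le_trans (le_normcB _ _) _; apply: lerD; first by near: n.
apply: ltW; near: n; exact: H.
Unshelve. all: by end_near. Qed.

Lemma cvgCMl (c : C) (u : nat -> C) (l : C) : u @ \oo --> l ->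
  (fun n => c * u n) @ \oo --> (c * l : C).
Proof.
move=> ul; apply: cvgC => e e0; have K0 : 0 < 1 + normc c by rewrite ltr_pwDl ?normc_ge0.
have [N _ HN] := cvgCP ul (divr_gt0 e0 K0); exists N => // n Nn.
have := HN n Nn; rewrite /= ltr_pdivlMr // -mulrBr normcM => h; apply: le_lt_trans h.
by rewrite mulrC ler_wpM2l ?normc_ge0 // lerDr.
Qed.

Lemma cvgCD (u v : nat -> C) (l m : C) : u @ \oo --> l -> v @ \oo --> m ->
  (fun n => u n + v n) @ \oo --> (l + m : C).
Proof.
move=> ul vm; apply: cvgC => e e0; have e20 : 0 < e / 2 by rewrite divr_gt0.
have [N _ HN] := cvgCP ul e20; have [K _ HK] := cvgCP vm e20.
exists (maxn N K) => // n; rewrite /= geq_max => /andP[Nn Kn].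
rewrite (_ : _ - _ = (u n - l) + (v n - m)); last by ring.
apply: le_lt_trans (le_normcD _ _) _; rewrite [e]splitr ltrD //; [exact: HN|exact: HK].
Qed.

Lemma cvgCB (u v : nat -> C) (l m : C) : u @ \oo --> l -> v @ \oo --> m ->
  (fun n => u n - v n) @ \oo --> (l - m : C).
Proof.
move=> ul vm; have := cvgCD ul (cvgCMl (c := -1) vm).
have -> : (fun n => u n + -1 * v n) = (fun n => u n - v n).
  by apply/funext => n; rewrite mulN1r.
by rewrite mulN1r.
Qed.

Lemma series_recl a n : series a n.+1 = a 0%N + series (fun k => a k.+1) n.
Proof. by rewrite /series /= big_nat_recl. Qed.

End ComplexSeries.

Section ComplexDerivatives.
Variable R : realType.
Notation C := ((R[i])^o).

Lemma has_cderivD (f g : R[i] -> R[i]) z l m : has_cderiv f z l -> has_cderiv g z m ->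
  has_cderiv (fun w => f w + g w) z (l + m).
Proof.
move=> Hf Hg e e0; have e20 : 0 < e / 2 by rewrite divr_gt0.
have [d1 d10 H1] := Hf _ e20; have [d2 d20 H2] := Hg _ e20.
exists (Num.min d1 d2); first by rewrite lt_min d10.
move=> h; rewrite lt_min => /andP[hd1 hd2].
rewrite (_ : _ - _ = (f (z + h) - f z - h * l) + (g (z + h) - g z - h * m)); last by ring.
apply: le_trans (le_normcD _ _) _; rewrite [e]splitr mulrDl.
by apply: lerD; [exact: H1|exact: H2].
Qed.

Lemma has_cderiv_const (c : R[i]) z : has_cderiv (fun=> c) z 0.
Proof.
move=> e e0; exists 1 => // h _.
by rewrite subrr mulr0 subr0 normc0 mulr_ge0 ?normc_ge0 // ltW.
Qed.

Lemma has_cderivZ (c : R[i]) (f : R[i] -> R[i]) z l : has_cderiv f z l -> has_cderiv (fun w => c * f w) z (c * l).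
Proof.
move=> H e e0; have K0 : 0 < 1 + normc c by rewrite ltr_pwDl ?normc_ge0.
have [d d0 Hd] := H _ (divr_gt0 e0 K0).
exists d => // h hd; rewrite (_ : _ - _ = c * (f (z + h) - f z - h * l)); last by ring.
rewrite normcM; apply: le_trans (ler_wpM2l (normc_ge0 _) (Hd h hd)) _.
rewrite mulrA ler_wpM2r ?normc_ge0 // mulrA ler_pdivrMr // mulrC.
by rewrite ler_wpM2l ?(ltW e0) // lerDr.
Qed.

Lemma has_cderiv_scale (c : R[i]) (f : R[i] -> R[i]) z l : has_cderiv f (c * z) l ->
  has_cderiv (fun w => f (c * w)) z (c * l).
Proof.
move=> H e e0; have K0 : 0 < 1 + normc c by rewrite ltr_pwDl ?normc_ge0.
have [d d0 Hd] := H _ (divr_gt0 e0 K0).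
exists (d / (1 + normc c)); first by rewrite divr_gt0.
move=> h; rewrite ltr_pdivlMr // => hd.
have ch : normc (c * h) <= normc h * (1 + normc c).
  by rewrite normcM mulrC ler_wpM2l ?normc_ge0 // lerDr.
rewrite mulrDr [h * _]mulrCA mulrA.
apply: le_trans (Hd _ (le_lt_trans ch hd)) _.
by rewrite mulrAC ler_pdivrMr // -mulrA ler_wpM2l // ltW.
Qed.

Lemma has_cderiv_sum n (f : nat -> R[i] -> R[i]) z (l : nat -> R[i]) :
  (forall k, has_cderiv (f k) z (l k)) ->
  has_cderiv (fun w => \sum_(0 <= k < n) f k w) z (\sum_(0 <= k < n) l k).
Proof.
move=> H; elim: n => [|n IH].
  rewrite big_geq //; have := has_cderiv_const 0 z.
  by congr has_cderiv; apply/funext => w; rewrite big_geq.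
rewrite big_nat_recr //=; have := has_cderivD IH (H n).
by congr has_cderiv; apply/funext => w; rewrite big_nat_recr.
Qed.

(* Termwise differentiation needs no bound on the derivatives beyond the
   summable Lipschitz constants [M k]. *)
Lemma has_cderiv_series (f : nat -> R[i] -> R[i]) (z : R[i]) (l : nat -> R[i])
    (M : nat -> R) (r : R) :
  0 < r -> cvgn (series M) ->
  (forall k, has_cderiv (f k) z (l k)) ->
  (forall k h, normc h < r -> normc (f k (z + h) - f k z) <= M k * normc h) ->
  (forall h, normc h < r -> cvgn (series (fun k => f k (z + h) : C))) ->
  has_cderiv (fun w => limn (series (fun k => f k w : C))) z (limn (series (l : nat -> C))).
Proof.
move=> r0 cM df LM cf.
(* The constants bound the derivatives too: at a small real increment x the difference quotient is
   at most M k and arbitrarily close to l k. *)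
have lM k : normc (l k) <= M k.
  apply/ler_addgt0Pr => e e0; have [d d0 Hd] := df k e e0.
  pose x := Num.min d r / 2; have m0 : 0 < Num.min d r by rewrite lt_min d0.
  have x0 : 0 < x by rewrite divr_gt0.
  have xm : x < Num.min d r by rewrite /x; lra.
  have nx : normc x%:C = x by rewrite normc_real gtr0_norm.
  move: (xm); rewrite lt_min => /andP[xd xr].
  have h1 := Hd x%:C; have h2 := LM k x%:C; rewrite nx in h1 h2.
  rewrite -(ler_pM2r x0) mulrDl.
  have -> : normc (l k) * x = normc (x%:C * l k) by rewrite normcM nx mulrC.
  have -> : x%:C * l k = (f k (z + x%:C) - f k z) - (f k (z + x%:C) - f k z - x%:C * l k).
    by ring.
  apply: le_trans (le_normcB _ _) _; apply: lerD; [exact: h2|exact: h1].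
have M0 k : 0 <= M k := le_trans (normc_ge0 _) (lM k).
have cl : cvgn (series (l : nat -> C)) := abs_summable_cvg (abs_summable_le lM cM).
move=> e e0; have e40 : 0 < e / 4 by rewrite divr_gt0.
have e20 : 0 < e / 2 by rewrite divr_gt0.
have [K HK] := series_tail M0 cM e40.
have [d d0 Hd] := has_cderiv_sum K df e20.
exists (Num.min d r); first by rewrite lt_min d0.
move=> h; rewrite lt_min => /andP[hd hr].
have cz : cvgn (series (fun k => f k z : C)).
  by have := cf 0; rewrite addr0; apply; rewrite normc0.
pose D k : C := f k (z + h) - f k z - h * l k.
have cD : series D @ \oo --> (limn (series (fun k => f k (z + h) : C)) -
    limn (series (fun k => f k z : C)) - h * limn (series (l : nat -> C)) : C).
  have -> : series D = (fun n => series (fun k => f k (z + h) : C) n -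
      series (fun k => f k z : C) n - (h : C) * series (l : nat -> C) n).
    by apply/funext => n; rewrite /series /= mulr_sumr -!sumrB.
  have H3 := cvgCMl (c := h) cl.
  have H12 := cvgCB (cf h hr) cz.
  exact: cvgCB H12 H3.
apply: normc_lim_le cD _; near=> n.
have Kn : (K <= n)%N by near: n; exists K.
rewrite /series /= (big_cat_nat _ Kn) //=.
apply: le_trans (le_normcD _ _) _; rewrite [e]splitr mulrDl; apply: lerD.
  by have := Hd h hd; rewrite mulr_sumr -!sumrB.
apply: le_trans (le_normc_sum _ _ _) _.
(* The increment of f k and its linear part each contribute M k |h|, so a tail of at most e / 4
   costs at most e / 2 times |h|. *)
apply: (@le_trans _ _ (\sum_(K <= k < n) M k * (2 * normc h))).
  apply: ler_sum => k _; apply: le_trans (le_normcB _ _) _.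
  rewrite mulrCA mulrA mulrDl mul1r mulrDl; apply: lerD; first exact: LM.
  by rewrite normcM mulrC ler_wpM2r ?normc_ge0.
rewrite -mulr_suml.
have : \sum_(K <= k < n) M k <= e / 4.
  have := HK n Kn; rewrite /series /= (big_cat_nat _ Kn) //=.
  by rewrite addrAC subrr add0r.
move=> h1; have := ler_wpM2r (_ : 0 <= 2 * normc h) h1.
rewrite mulr_ge0 ?normc_ge0 // => /(_ isT) /le_trans; apply.
by rewrite mulrA; apply: ler_wpM2r; [exact: normc_ge0|lra].
Unshelve. all: by end_near. Qed.

End ComplexDerivatives.

(** * Finite differences and the powers x^(-s) *)

Section FiniteDifferences.
Variable R : realType.
Implicit Types f g : R -> R[i].

(** The sign is that of Euler's transformation, which replaces a_k by a_k - a_(k+1) in an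
    alternating sum. *)
Definition fdiff f : R -> R[i] := fun x => f x - f (x + 1).

Lemma iter_fdiffB r f g x :
  iter r fdiff (fun t => f t - g t) x = iter r fdiff f x - iter r fdiff g x.
Proof.
elim: r x => // r IH x.
by rewrite /= /fdiff !IH; ring.
Qed.

Lemma is_cderive_iter_fdiff (G : nat -> R -> R[i]) :
  (forall i x, 0 < x -> is_cderive (G i) x (G i.+1 x)) ->
  forall r i x, 0 < x ->
    is_cderive (iter r fdiff (G i)) x (iter r fdiff (G i.+1) x).
Proof.
move=> dG; elim=> [|r IH] i x x0; first exact: dG.
apply: is_cderiveB; first exact: IH.
by apply: is_cderive_shift; apply: IH; rewrite addr_gt0.
Qed.

(** Differencing commutes with differentiation, so the mean value inequality on [x, x + 1] trades
    one difference for one derivative at each of the r steps. [G i] stands for the i-th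
    derivative. *)
Lemma iter_fdiff_le r (G : nat -> R -> R[i]) x M :
  (forall i x, 0 < x -> is_cderive (G i) x (G i.+1 x)) -> 0 < x ->
  (forall y, x <= y -> normc (G r y) <= M) -> normc (iter r fdiff (G 0%N) x) <= M.
Proof.
elim: r G x => [|r IH] G x dG x0 GM; first by apply: GM.
rewrite /= /fdiff normcC.
have := @cmean_value R (iter r fdiff (G 0%N)) (iter r fdiff (G 1%N)) x (x + 1) M.
rewrite (_ : x + 1 - x = 1) ?mulr1; last by ring.
apply; first by rewrite lerDl.
  move=> y /andP[xy _]; apply: is_cderive_iter_fdiff => //.
  exact: lt_le_trans xy.
move=> y /andP[xy _]; apply: (IH (fun i => G i.+1)).
- by move=> i; exact: dG.
- exact: lt_le_trans xy.
- by move=> u yu; apply: GM; exact: le_trans yu.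
Qed.

End FiniteDifferences.

Section ComplexPower.
Variable R : realType.
Implicit Types s h : R[i].

(* [cpow x s] is x^(-s), the sign convention of Dirichlet series. *)
Definition cpow (x : R) s : R[i] := cexp (- s * (ln x)%:C).

Lemma normc_cpow (x : R) s : normc (cpow x s) = expR (- complex.Re s * ln x).
Proof. by rewrite /cpow normc_cexp ReM ReN /= mulr0 subr0. Qed.

Lemma cpowD (x : R) s h : cpow x (s + h) = cpow x s * cpow x h.
Proof. by rewrite /cpow -cexpD; congr cexp; ring. Qed.

Lemma cpowM (x y : R) s : 0 < x -> 0 < y -> cpow (x * y) s = cpow x s * cpow y s.
Proof. by move=> x0 y0; rewrite /cpow -cexpD lnM ?posrE // rmorphD mulrDr. Qed.

Lemma cpow1 s : cpow 1 s = 1.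
Proof. by rewrite /cpow ln1 mulr0 cexp0. Qed.

Lemma cpowXn (x : R) k s : 0 < x -> cpow (x ^+ k) s = cpow x (k%:R * s).
Proof.
by move=> x0; rewrite /cpow lnXn // rmorphMn -mulr_natl; congr cexp; ring.
Qed.

Lemma cpow_real1 (x : R) : 0 < x -> cpow x 1 = (x^-1)%:C.
Proof.
move=> x0; rewrite /cpow mulN1r -rmorphN /= cexp_real expRN lnK ?posrE //.
Qed.

(** The constant in front of x^(-s-i) in the i-th derivative of x^(-s) with respect to x. *)
Definition pow_coef i s : R[i] := \prod_(0 <= j < i) - (s + j%:R).

Definition pow_deriv s i (x : R) : R[i] := pow_coef i s * cpow x (s + i%:R).

Lemma is_cderive_pow_deriv s i (x : R) : 0 < x ->
  is_cderive (pow_deriv s i) x (pow_deriv s i.+1 x).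
Proof.
move=> x0; have := is_cderiveZ (pow_coef i s)
  (is_cderive_cexp (- (s + i%:R)) (is_derive1_ln x0)).
congr is_cderive; rewrite /pow_deriv /pow_coef big_nat_recr //= -addn1 natrD addrA.
by rewrite cpowD cpow_real1 // /cpow; ring.
Qed.

Lemma pow_coef_lipschitz i s : exists2 K : R, 0 <= K & forall h, normc h <= 1 ->
  normc (pow_coef i (s + h) - pow_coef i s) <= K * normc h.
Proof.
elim: i => [|i [K K0 HK]].
  by exists 0 => // h _; rewrite /pow_coef !big_geq // subrr normc0 mul0r.
exists (K * (normc (s + i%:R) + 1) + normc (pow_coef i s)).
  by rewrite addr_ge0 ?mulr_ge0 ?addr_ge0 ?normc_ge0.
move=> h h1; rewrite /pow_coef !big_nat_recr //=.
rewrite -/(pow_coef i (s + h)) -/(pow_coef i s).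
rewrite (_ : _ - _ = - ((pow_coef i (s + h) - pow_coef i s) * (s + i%:R + h))
  - pow_coef i s * h); last by ring.
apply: le_trans (le_normcB _ _) _; rewrite normcN !normcM mulrDl lerD2r.
rewrite mulrAC; apply: ler_pM; rewrite ?normc_ge0 //; first exact: HK.
by apply: le_trans (le_normcD _ _) _; rewrite lerD2l.
Qed.

Lemma pow_deriv_le s i (x : R) : 1 <= x -> 2 <= complex.Re s + i%:R ->
  normc (pow_deriv s i x) <= normc (pow_coef i s) * expR (- 2 * ln x).
Proof.
move=> x1 s2; rewrite normcM ler_wpM2l ?normc_ge0 // normc_cpow ler_expR.
rewrite ler_wpM2r ?ln_ge0 // lerN2 ReD natrC //.
Qed.

(** Varying s costs at most two powers of x: for |h| <= 1, |x^(-h) - 1| <= |h| (ln x) x <= |h| x^2.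
    Starting from x^(-4), the summable x^(-2) is left. *)
Lemma pow_deriv_lipschitz i s : 4 <= complex.Re s + i%:R ->
  exists2 K : R, 0 <= K & forall h (x : R), normc h <= 1 -> 1 <= x ->
    normc (pow_deriv (s + h) i x - pow_deriv s i x) <= K * expR (- 2 * ln x) * normc h.
Proof.
move=> s4; have [K K0 HK] := pow_coef_lipschitz i s.
exists (K + normc (pow_coef i s)); first by rewrite addr_ge0 ?normc_ge0.
move=> h x h1 x1; have L0 : 0 <= ln x by exact: ln_ge0.
set L := ln x in L0 *.
have Rh : - complex.Re h <= 1.
  apply: le_trans h1; apply: le_trans (normc_ge_Re h).
  by rewrite -normrN ler_norm.
rewrite /pow_deriv (_ : s + h + i%:R = s + i%:R + h); last by ring.
rewrite (_ : _ - _ = (pow_coef i (s + h) - pow_coef i s) * cpow x (s + i%:R + h) +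
   pow_coef i s * (cpow x (s + i%:R) * (cpow x h - 1))); last first.
  by rewrite cpowD; ring.
apply: le_trans (le_normcD _ _) _.
rewrite (normcM (pow_coef i (s + h) - pow_coef i s)) (normcM (pow_coef i s)).
rewrite (normcM (cpow x (s + i%:R))) mulrDl mulrDl.
have si : complex.Re (s + i%:R) = complex.Re s + i%:R by rewrite ReD natrC.
apply: lerD.
  rewrite [X in _ <= X]mulrAC; apply: ler_pM; rewrite ?normc_ge0 ?HK //.
  rewrite normc_cpow ler_expR ler_wpM2r // ReD si; lra.
rewrite -[X in _ <= X]mulrA ler_wpM2l ?normc_ge0 // normc_cpow si -/L.
have hL : normc (- h * L%:C) <= L.
  rewrite normcM normcN normc_real (ger0_norm L0).
  by rewrite -[X in _ <= X]mul1r ler_wpM2r.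
have e1 : normc (cpow x h - 1) <= normc h * (expR L * expR L).
  apply: le_trans (normc_cexpB1 _) _; rewrite normcM normcN normc_real (ger0_norm L0).
  rewrite -mulrA ler_wpM2l ?normc_ge0 //; apply: ler_pM; rewrite ?expR_ge0 //.
    by apply: le_trans (expR_ge1Dx L); rewrite lerDr.
  by rewrite ler_expR; move: hL; rewrite normcM normcN normc_real (ger0_norm L0).
apply: le_trans (ler_wpM2l (expR_ge0 _) e1) _.
rewrite mulrCA [X in _ <= X]mulrC ler_wpM2l ?normc_ge0 // -!expRD ler_expR.
have := ler_wpM2r L0 s4; lra.
Qed.

Lemma pow_deriv0 s : pow_deriv s 0 = cpow ^~ s.
Proof. by apply/funext => x; rewrite /pow_deriv /pow_coef big_geq // mul1r addr0. Qed.

Lemma expRN2_ln_nat k : expR (- 2 * ln k.+1%:R) = k.+1%:R ^- 2 :> R.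
Proof.
rewrite mulNr expRN; congr (_^-1).
by rewrite expRM_natl lnK // posrE ltr0n.
Qed.

Lemma has_cderiv_cpow (x : R) s : exists l, has_cderiv (cpow x) s l.
Proof.
exists (- (ln x)%:C * cexp (- (ln x)%:C * s)).
have -> : cpow x = (fun w => cexp (- (ln x)%:C * w)).
  by apply/funext => w; rewrite /cpow !mulNr mulrC.
exact: has_cderiv_scale (has_cderiv_cexp (- (ln x)%:C * s)).
Qed.

Lemma has_cderiv_iter_fdiff_cpow r (x : R) s :
  exists l, has_cderiv (fun w => iter r (@fdiff R) (cpow ^~ w) x) s l.
Proof.
elim: r x => [|r IH] x; first exact: has_cderiv_cpow.
have [l1 H1] := IH x; have [l2 H2] := IH (x + 1).
exists (l1 + -1 * l2); have := has_cderivD H1 (has_cderivZ (-1) H2).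
set f := fun w => _ + _; have -> : f = fun w => iter r.+1 (@fdiff R) (cpow ^~ w) x.
  by apply/funext => w; rewrite /f /= /fdiff mulN1r.
by [].
Qed.

End ComplexPower.

(** * Analytic continuation of zeta *)

Section Eta.
Variable R : realType.
Notation C := ((R[i])^o).
Implicit Types s h : R[i].

Definition alt_sign k : R[i] := (-1) ^+ k.

Lemma alt_signS k : alt_sign k.+1 = - alt_sign k.
Proof. by rewrite /alt_sign exprS mulN1r. Qed.

Lemma normc_alt_sign k : normc (alt_sign k) = 1.
Proof.
rewrite /alt_sign; elim: k => [|k IH]; first by rewrite expr0 normc1.
by rewrite exprS normcM IH normcN normc1 mulr1.
Qed.

Lemma abs_summable_alt (a : nat -> R[i]) : abs_summable a ->
  abs_summable (fun k => alt_sign k * a k).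
Proof.
rewrite /abs_summable.
have -> // : (fun n => normc (alt_sign n * a n)) = (fun n => normc (a n)).
by apply/funext => n; rewrite normcM normc_alt_sign mul1r.
Qed.

Lemma abs_summable_diff (a : nat -> R[i]) : abs_summable a ->
  abs_summable (fun k => a k - a k.+1).
Proof.
move=> sa; have a0 k : 0 <= normc (a k) by exact: normc_ge0.
apply: (@series_bounded_cvg _ _ (2 * limn (series (fun n => normc (a n))))).
  by move=> k; exact: normc_ge0.
move=> n; apply: (@le_trans _ _ (series (fun n => normc (a n)) n +
   series (fun n => normc (a n.+1)) n)).
  rewrite /series /= -big_split /=; apply: ler_sum => k _; exact: le_normcB.
have h1 := le_series_lim n a0 sa; have := le_series_lim n.+1 a0 sa.
rewrite {1}/series /= big_nat_recl //= => h2; have := a0 0%N.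
rewrite {2}/series /=; lra.
Qed.

Lemma limn_alt_diff (a : nat -> C) : abs_summable a ->
  limn (series (fun k => alt_sign k * (a k - a k.+1) : C)) =
  2 * limn (series (fun k => alt_sign k * a k : C)) - a 0%N.
Proof.
move=> sa; have ca := abs_summable_cvg (abs_summable_alt sa).
set S := limn (series (fun k => alt_sign k * a k : C)).
have c1 : (fun n => series (fun k => alt_sign k * a k : C) n.+1) @ \oo --> (S : C).
  by have := ca; rewrite -(cvg_shiftS (series _)).
have c2 := cvgCD ca c1.
apply: cvgC_lim; apply: cvgC => e e0; have [N _ HN] := cvgCP c2 e0.
exists N => // n Nn; have := HN n Nn; rewrite /= series_recl.
have -> : series (fun k => alt_sign k * (a k - a k.+1) : C) n =
    series (fun k => alt_sign k * a k : C) n +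
    series (fun k => alt_sign k.+1 * a k.+1 : C) n.
  rewrite /series /= -big_split /=; apply: eq_bigr => k _.
  by rewrite alt_signS mulrBr mulNr.
rewrite -/S (_ : alt_sign 0 = 1) ?mul1r; last exact: expr0.
apply: le_lt_trans.
by rewrite le_eqVlt; apply/orP; left; apply/eqP; congr normc; ring.
Qed.

Definition eta_term r s (k : nat) : R[i] := iter r (@fdiff R) (fun x => cpow x s) k.+1%:R.

Lemma eta_termS r s k : eta_term r.+1 s k = eta_term r s k - eta_term r s k.+1.
Proof. by rewrite /eta_term /= /fdiff natr1. Qed.

Definition eta_head r s : R[i] := \sum_(0 <= j < r) 2 ^- j.+1 * eta_term j s 0.

Definition eta_tail r s : R[i] := limn (series (fun k => alt_sign k * eta_term r s k : C)).

(* [r] steps of Euler's transformation of the alternating series for eta; the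
   value does not depend on [r] (as soon as the tail converges absolutely),
   and the tail converges for Re s > 1 - r. *)
Definition eta_approx r s : R[i] := eta_head r s + 2 ^- r * eta_tail r s.

Lemma eta_approxS r s : abs_summable (eta_term r s) ->
  eta_approx r.+1 s = eta_approx r s.
Proof.
move=> sa; rewrite /eta_approx /eta_head big_nat_recr //= -addrA; congr (_ + _).
rewrite {1}/eta_tail; under eq_fun do rewrite eta_termS.
rewrite limn_alt_diff // -/(eta_tail r s) exprS invfM.
have : (2 : R[i]) != 0 by rewrite pnatr_eq0.
by move=> n2; field; rewrite ?expf_neq0 ?n2.
Qed.

(** The r-th difference is bounded by the r-th derivative, of order x^(-Re s - r): each step of
    Euler's transformation gains one power of k. *)
Lemma eta_term_le r s k : 2 <= complex.Re s + r%:R ->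
  normc (eta_term r s k) <= normc (pow_coef r s) * k.+1%:R ^- 2.
Proof.
move=> s2; rewrite /eta_term -pow_deriv0 -expRN2_ln_nat.
apply: iter_fdiff_le; rewrite ?ltr0n //.
  by move=> i x; exact: is_cderive_pow_deriv.
move=> y ky; have y1 : 1 <= y by apply: le_trans ky; rewrite ler1n.
apply: le_trans (pow_deriv_le y1 s2) _; rewrite ler_wpM2l ?normc_ge0 // ler_expR.
by rewrite ler_wnM2l ?ler_ln ?posrE ?ltr0n // (lt_le_trans _ y1).
Qed.

Lemma cvg_series_Minvsq (K : R) : cvgn (series (fun k => K * k.+1%:R ^- 2)).
Proof. exact: (@is_cvg_seriesZ R _ K (@cvg_series_invsq R)). Qed.

Lemma eta_term_summable r s : 2 <= complex.Re s + r%:R -> abs_summable (eta_term r s).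
Proof.
move=> s2; apply: (@abs_summable_le R (eta_term r s)
  (fun k => normc (pow_coef r s) * k.+1%:R ^- 2)).
  by move=> k; exact: eta_term_le.
exact: cvg_series_Minvsq.
Qed.

Lemma eta_approx_stable r r' s : 2 <= complex.Re s + r%:R -> (r <= r')%N ->
  eta_approx r' s = eta_approx r s.
Proof.
move=> s2 /subnK <-; elim: (r' - r)%N => // d IH.
rewrite addSn eta_approxS //; apply: eta_term_summable.
by rewrite natrD; have : 0 <= d%:R :> R by []; lra.
Qed.

Lemma eta_term_lipschitz r s : 4 <= complex.Re s + r%:R ->
  exists2 K : R, 0 <= K & forall k h, normc h <= 1 ->
    normc (eta_term r (s + h) k - eta_term r s k) <= K * k.+1%:R ^- 2 * normc h.
Proof.
move=> s4; have [K K0 HK] := pow_deriv_lipschitz s4; exists K => // k h h1.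
rewrite /eta_term -!pow_deriv0 -iter_fdiffB -expRN2_ln_nat.
apply: (iter_fdiff_le (G := fun i x => pow_deriv (s + h) i x - pow_deriv s i x)).
- by move=> i x x0; apply: is_cderiveB; exact: is_cderive_pow_deriv.
- by rewrite ltr0n.
move=> y ky; have y1 : 1 <= y by apply: le_trans ky; rewrite ler1n.
apply: le_trans (HK h y h1 y1) _; rewrite ler_wpM2r ?normc_ge0 // ler_wpM2l // ler_expR.
by rewrite ler_wnM2l ?ler_ln ?posrE ?ltr0n // (lt_le_trans _ y1).
Qed.

Lemma has_cderiv_eta_approx r s : 4 <= complex.Re s + r%:R ->
  exists l, has_cderiv (eta_approx r) s l.
Proof.
move=> s4.
have Ht j k : exists l, has_cderiv (fun w => eta_term j w k) s l.
  exact: has_cderiv_iter_fdiff_cpow.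
have /choice[lh Hlh] j : exists l, has_cderiv (fun w => 2 ^- j.+1 * eta_term j w 0) s l.
  by have [l Hl] := Ht j 0%N; exists (2 ^- j.+1 * l); exact: has_cderivZ.
have /choice[lt Hlt] k : exists l, has_cderiv (fun w => alt_sign k * eta_term r w k) s l.
  by have [l Hl] := Ht r k; exists (alt_sign k * l); exact: has_cderivZ.
have [K K0 HK] := eta_term_lipschitz s4.
have Htail := @has_cderiv_series R (fun k w => alt_sign k * eta_term r w k) s lt
  (fun k => K * k.+1%:R ^- 2) 1 ltr01 (@cvg_series_Minvsq K) Hlt.
have Hhead := has_cderiv_sum r Hlh.
exists (\sum_(0 <= k < r) lh k + 2 ^- r * limn (series (lt : nat -> C))).
apply: has_cderivD Hhead _; apply: has_cderivZ; apply: Htail.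
  move=> k h h1; rewrite -mulrBr normcM normc_alt_sign mul1r HK //.
  exact: ltW.
move=> h h1; apply/abs_summable_cvg/abs_summable_alt/eta_term_summable.
rewrite ReD; have := normc_ge_Re h; rewrite ler_norml => /andP[]; lra.
Qed.

(** This order exceeds |s| + 2 >= 2 - Re s, so the terms of the tail are at most a constant times
    (k+1)^(-2). *)
Definition eta_order s : nat := (Num.truncn (normc s) + 3)%N.

Definition dirichlet_eta s : R[i] := eta_approx (eta_order s) s.

Lemma eta_orderP s : 2 <= complex.Re s + (eta_order s)%:R.
Proof.
have := truncnS_gt (normc s); have := normc_ge_Re s.
by rewrite ler_norml => /andP[]; rewrite /eta_order natrD -natr1; lra.
Qed.

Lemma dirichlet_etaE r s : 2 <= complex.Re s + r%:R ->
  dirichlet_eta s = eta_approx r s.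
Proof.
move=> s2; have so := eta_orderP s.
have [le|/ltnW le] := leqP r (eta_order s).
  exact: eta_approx_stable.
by rewrite /dirichlet_eta -(eta_approx_stable so le).
Qed.

Lemma has_cderiv_near (f g : R[i] -> R[i]) z l (d : R) : 0 < d ->
  (forall h, normc h < d -> f (z + h) = g (z + h)) ->
  has_cderiv f z l -> has_cderiv g z l.
Proof.
move=> d0 fg H e e0; have [r r0 Hr] := H e e0.
exists (Num.min r d); first by rewrite lt_min r0.
move=> h; rewrite lt_min => /andP[hr hd].
have fz : f z = g z by rewrite -[z]addr0 fg // normc0.
by rewrite -fg // -fz; exact: Hr.
Qed.

Lemma has_cderiv_eta s : exists l, has_cderiv dirichlet_eta s l.
Proof.
(* One fixed order r then represents eta on the whole disc of radius 1 around s, where 2 <= Re w + r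
   still holds. *)
have [r s4] : exists r : nat, 4 <= complex.Re s + r%:R.
  by exists (eta_order s + 2)%N; have := eta_orderP s; rewrite natrD; lra.
have [l Hl] := has_cderiv_eta_approx s4; exists l.
apply: has_cderiv_near ltr01 _ Hl => h h1; rewrite -dirichlet_etaE //.
by rewrite ReD; have := normc_ge_Re h; rewrite ler_norml => /andP[]; lra.
Qed.

Lemma eta_approx_summable s r : abs_summable (eta_term 0 s) ->
  eta_approx r s = eta_approx 0 s.
Proof.
move=> sa; have H j : abs_summable (eta_term j s).
  elim: j => // j IH; have := abs_summable_diff IH.
  by congr abs_summable; apply/funext => k; rewrite eta_termS.
by elim: r => // r IH; rewrite eta_approxS.
Qed.

Lemma eta_term0 s k : eta_term 0 s k = cpow k.+1%:R s. Proof. by []. Qed.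

(* Sum the alternating series over pairs: it is the full series minus twice
   its even-indexed part, which is [2 ^ (- s)] times the full series. *)
Lemma eta_zeta s : abs_summable (fun k => cpow k.+1%:R s) ->
  dirichlet_eta s = (1 - 2 * cpow 2 s) * limn (series (fun k => cpow k.+1%:R s : C)).
Proof.
move=> sa; rewrite /dirichlet_eta eta_approx_summable //.
rewrite /eta_approx /eta_head big_geq // add0r expr0 invr1 mul1r /eta_tail.
have ca := abs_summable_cvg sa; set Z := limn (series (fun k => cpow k.+1%:R s : C)).
have caa := abs_summable_cvg (abs_summable_alt sa).
set S := limn _.
have E n : series (fun k => alt_sign k * cpow k.+1%:R s : C) (n * 2)%N =
   series (fun k => cpow k.+1%:R s : C) (n * 2)%N -
   (2 * cpow 2 s : C) * series (fun k => cpow k.+1%:R s : C) n.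
  elim: n => [|n IH]; first by rewrite /series /= !big_geq // mulr0 subr0.
  rewrite mulSn addnC addn2 !seriesSr IH /alt_sign !exprS.
  have -> : (-1) ^+ (n * 2) = 1 :> R[i] by rewrite mulnC exprM sqrrN !expr1n.
  have -> : (n * 2).+2%:R = 2 * n.+1%:R :> R by rewrite -natrM; congr _%:R; lia.
  by rewrite cpowM ?ltr0n //; ring.
have dbl : (fun n => (n * 2)%N) @ \oo --> \oo.
  by move=> A [N _ HN]; exists N => // n /= Nn; apply: HN => /=; lia.
have c1 : (fun n => series (fun k => alt_sign k * cpow k.+1%:R s : C) (n * 2)%N) @ \oo --> (S : C).
  exact: (cvg_comp _ _ dbl caa).
have c2 : (fun n => series (fun k => cpow k.+1%:R s : C) (n * 2)%N) @ \oo --> (Z : C).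
  exact: (cvg_comp _ _ dbl ca).
have c3 := cvgCB c2 (cvgCMl (c := 2 * cpow 2 s) ca).
have -> : S = Z - 2 * cpow 2 s * Z.
  by apply: (cvgC_unique c1); under eq_fun do rewrite E.
by ring.
Qed.

End Eta.

(** * Convolutions and products of Dirichlet series *)

Section MultiplicativeConvolution.
Variable K : comNzRingType.
Implicit Types u v : nat -> K.

Definition mconv u v (n : nat) : K :=
  \sum_(i < n.+1) \sum_(j < n.+1 | (i * j)%N == n) u i * v j.

Lemma mconv_bound u v n N : (0 < n)%N -> (n <= N)%N ->
  mconv u v n = \sum_(i < N.+1) \sum_(j < N.+1 | (i * j)%N == n) u i * v j.
Proof.
move=> n0 nN; have nN1 : (n.+1 <= N.+1)%N by [].
rewrite /mconv.
rewrite (big_ord_widen N.+1 (fun i => \sum_(j < n.+1 | (i * j)%N == n) u i * v j)) //.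
rewrite [RHS](bigID (fun i : 'I_N.+1 => i < n.+1)%N) /= [X in _ = _ + X]big1 ?addr0.
  apply: eq_bigr => i _.
  rewrite (big_ord_widen_cond N.+1 (fun j => i * j == n)%N (fun j => u i * v j)) //.
  apply: eq_bigl => j; case: eqP => //= E.
  have i0 : (0 < i)%N by case: (posnP i) E n0 => // ->; rewrite mul0n => <-.
  by rewrite ltnS -E leq_pmull.
move=> i; rewrite -leqNgt => ni; apply: big1 => j /eqP E.
have j0 : (0 < j)%N by case: (posnP j) E n0 => // ->; rewrite muln0 => <-.
by have := leq_pmulr i j0; rewrite E; lia.
Qed.

Lemma sum_mconv u v N : \sum_(1 <= n < N.+1) mconv u v n =
  \sum_(1 <= i < N.+1) \sum_(1 <= j < N.+1 | (i * j <= N)%N) u i * v j.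
Proof.
transitivity (\sum_(1 <= n < N.+1) \sum_(1 <= i < N.+1)
    \sum_(1 <= j < N.+1 | (i * j)%N == n) u i * v j).
  apply: eq_big_nat => n /andP[n0]; rewrite ltnS => nN; rewrite (mconv_bound _ _ n0 nN).
  rewrite -(big_mkord xpredT (fun i => \sum_(j < N.+1 | (i * j)%N == n) u i * v j)) /=.
  rewrite big_ltn // big1 ?add0r; last first.
    by move=> j; rewrite mul0n => /eqP E; rewrite -E in n0.
  apply: eq_big_nat => i _.
  rewrite -(big_mkord (fun j => (i * j)%N == n) (fun j => u i * v j)) big_ltn_cond //.
  by rewrite muln0 eq_sym gtn_eqF.
rewrite exchange_big_nat; apply: eq_big_nat => i /andP[i0 _].
rewrite (exchange_big_dep_nat xpredT) //= [RHS]big_mkcond; apply: eq_big_nat => j /andP[j0 _].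
rewrite (eq_bigl (fun n => n == (i * j)%N)); last by move=> n; rewrite eq_sym.
rewrite -big_filter; case: leqP => ijN.
  rewrite (_ : [seq n <- index_iota 1 N.+1 | n == (i * j)%N] = [:: (i * j)%N]) ?big_seq1 //.
  by apply: filter_pred1_uniq; rewrite ?iota_uniq // mem_index_iota muln_gt0 i0 j0.
rewrite big_filter big_nat_cond big1 // => n /andP[/andP[_ nN] /eqP E].
by move: nN; rewrite E ltnS leqNgt ijN.
Qed.

End MultiplicativeConvolution.

Section RealConvolution.
Variable R : realType.
Implicit Types u v : nat -> R.

Definition psum (T : nmodType) (u : nat -> T) (N : nat) : T := \sum_(1 <= n < N.+1) u n.

Lemma psum_series (T : nmodType) (u : nat -> T) N :
  psum u N = \sum_(0 <= k < N) u k.+1.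
Proof. by rewrite /psum big_add1. Qed.

Lemma psum_mconv_le u v N : (forall n, 0 <= u n) -> (forall n, 0 <= v n) ->
  psum (mconv u v) N <= psum u N * psum v N.
Proof.
move=> u0 v0; rewrite /psum sum_mconv mulr_suml; apply: ler_sum => i _.
rewrite mulr_sumr big_mkcond; apply: ler_sum => j _.
by case: ifP => // _; rewrite mulr_ge0.
Qed.

Lemma psum_le u N M : (forall n, 0 <= u n) -> (N <= M)%N -> psum u N <= psum u M.
Proof.
move=> u0 NM; rewrite /psum [leRHS](big_cat_nat (_ : 1 <= N.+1)%N (_ : N.+1 <= M.+1)%N) //=.
by rewrite lerDl sumr_ge0.
Qed.

Lemma psum_mconv_ge u v M N : (forall n, 0 <= u n) -> (forall n, 0 <= v n) ->
  (M * M <= N)%N -> psum u M * psum v M <= psum (mconv u v) N.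
Proof.
move=> u0 v0 MN; rewrite /psum sum_mconv.
have MN1 : (M <= N)%N by case: M MN => // M MN; apply: leq_trans MN; rewrite leq_pmulr.
rewrite [leRHS](big_cat_nat (_ : 1 <= M.+1)%N (_ : M.+1 <= N.+1)%N) //=.
apply: ler_wpDr; first by apply: sumr_ge0 => i _; apply: sumr_ge0 => j _; exact: mulr_ge0.
rewrite mulr_suml; apply: ler_sum_nat => i /andP[i1 iM].
rewrite mulr_sumr [leRHS](big_cat_nat (_ : 1 <= M.+1)%N (_ : M.+1 <= N.+1)%N) //=.
apply: ler_wpDr; first by apply: sumr_ge0 => j _; exact: mulr_ge0.
rewrite [leRHS]big_mkcond; apply: ler_sum_nat => j /andP[j1 jM].
rewrite ifT //; apply: leq_trans MN; apply: leq_mul; by rewrite -ltnS.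
Qed.

(** When M^2 <= N, the region i j <= N contains the square of side M and lies in the square of side
    N. So the partial sum is squeezed between two products of partial sums, both tending to U V. *)
Lemma psum_mconv_cvg u v (U V : R) : (forall n, 0 <= u n) -> (forall n, 0 <= v n) ->
  psum u @ \oo --> U -> psum v @ \oo --> V -> psum (mconv u v) @ \oo --> U * V.
Proof.
move=> u0 v0 cu cv.
have cuv : (fun N => psum u N * psum v N) @ \oo --> U * V by exact: cvgM.
apply/cvgrPdist_le => e e0; have /cvgrPdist_le/(_ e e0)[M _ HM] := cuv.
exists (M * M + M)%N => // N /= MN.
have MN1 : (M * M <= N)%N by apply: leq_trans MN; rewrite leq_addr.
have MN2 : (M <= N)%N by apply: leq_trans MN; rewrite leq_addl.
have := HM M (leqnn M); have := HM N MN2; rewrite /= !ler_norml => /andP[h1 h2] /andP[h3 h4].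
have := psum_mconv_ge u0 v0 MN1; have := psum_mconv_le N u0 v0; lra.
Qed.

End RealConvolution.

Section DirichletSeries.
Variable R : realType.
Notation C := ((R[i])^o).
Implicit Types s : R[i].

Lemma cvgCM (u v : nat -> C) (l m : C) : u @ \oo --> l -> v @ \oo --> m ->
  (fun n => u n * v n) @ \oo --> (l * m : C).
Proof.
move=> ul vm; apply: cvgC => e e0.
pose K := 1 + normc l + normc m.
have K0 : 0 < K by have := normc_ge0 l; have := normc_ge0 m; rewrite /K; lra.
pose d := Num.min 1 (e / (2 * K)).
have d0 : 0 < d by rewrite lt_min ltr01 divr_gt0 // mulr_gt0.
have [N _ HN] := cvgCP ul d0; have [M _ HM] := cvgCP vm d0.
exists (maxn N M) => // n; rewrite /= geq_max => /andP[Nn Mn].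
have := HN n Nn; have := HM n Mn; rewrite /= /d !lt_min => /andP[v1 ve] /andP[u1 ue].
rewrite (_ : _ - _ = (u n - l) * (v n - m) + (u n - l) * m + l * (v n - m)); last by ring.
apply: le_lt_trans (le_normcD _ _) _; rewrite normcM.
apply: le_lt_trans (lerD (le_normcD _ _) (lexx _)) _; rewrite !normcM.
rewrite ltr_pdivlMr ?mulr_gt0 // in ue; rewrite ltr_pdivlMr ?mulr_gt0 // in ve.
have a0 := normc_ge0 (u n - l); have b0 := normc_ge0 (v n - m).
have l0 := normc_ge0 l; have m0 := normc_ge0 m.
move: ue ve; rewrite /K; move: (normc (u n - l)) (normc (v n - m)) (normc l) (normc m) a0 b0 l0 m0 u1 v1.
move=> a b x y a0 b0 x0 y0 a1 b1 h1 h2.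
have : a * b <= a * 1 by apply: ler_wpM2l => //; exact: ltW.
have : 0 <= a * x by exact: mulr_ge0.
have : 0 <= b * y by exact: mulr_ge0.
lra.
Qed.

Definition dir_coef (a : nat -> nat) s (n : nat) : R[i] := (a n)%:R * cpow n%:R s.

Lemma dir_coef_dconv a b s n : (0 < n)%N ->
  dir_coef (dconv a b) s n = mconv (dir_coef a s) (dir_coef b s) n.
Proof.
move=> n0; rewrite /dir_coef /dconv /mconv natr_sum mulr_suml; apply: eq_bigr => i _.
rewrite natr_sum mulr_suml; apply: eq_bigr => j /eqP E.
have i0 : (0 < i)%N by case: (posnP i) E n0 => // ->; rewrite mul0n => <-.
have j0 : (0 < j)%N by case: (posnP j) E n0 => // ->; rewrite muln0 => <-.
rewrite -[in cpow n%:R]E !natrM cpowM ?ltr0n //; ring.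
Qed.

(* Absolute convergence of the Dirichlet series of [a] at [s], with sum [l]. *)
Definition dir_sum (a : nat -> nat) s (l : R[i]) : Prop :=
  (exists M : R, forall N, psum (fun n => normc (dir_coef a s n)) N <= M) /\
  psum (dir_coef a s) @ \oo --> (l : C).

Lemma dir_sum_abs a s l : dir_sum a s l ->
  cvgn (psum (fun n => normc (dir_coef a s n))).
Proof.
case=> [[M HM] _]; apply: nondecreasing_is_cvgn.
  by move=> N N' NN; apply: psum_le => // n; exact: normc_ge0.
by exists M => _ [n _ <-].
Qed.

Lemma normc_mconv_le (u v : nat -> R[i]) n :
  normc (mconv u v n) <= mconv (fun n => normc (u n)) (fun n => normc (v n)) n.
Proof.
apply: le_trans (le_normc_sum _ _ _) _; apply: ler_sum => i _.
by apply: le_trans (le_normc_sum _ _ _) _; apply: ler_sum => j _; rewrite normcM.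
Qed.

(** Both sides are sums over the part i j > N of the square i, j <= N, the right one with absolute
    values. *)
Lemma psum_mconv_distance (u v : nat -> R[i]) N :
  normc (psum (mconv u v) N - psum u N * psum v N) <=
  psum (fun n => normc (u n)) N * psum (fun n => normc (v n)) N -
  psum (mconv (fun n => normc (u n)) (fun n => normc (v n))) N.
Proof.
rewrite normcC /psum !sum_mconv !mulr_suml -!sumrB.
apply: le_trans (le_normc_sum _ _ _) _; apply: ler_sum => i _.
rewrite !mulr_sumr.
rewrite [X in normc (X - _)](bigID (fun j => i * j <= N)%N) /=.
rewrite [X in _ <= X - _](bigID (fun j => i * j <= N)%N) /=.
rewrite addrAC subrr add0r [X in _ <= X]addrAC subrr add0r.
by apply: le_trans (le_normc_sum _ _ _) _; apply: ler_sum => j _; rewrite normcM.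
Qed.

(** The product of partial sums tends to l m, and its distance to the convolution is controlled by
    the absolute values, for which both terms of the bound tend to the same A B. *)
Lemma dir_sum_dconv a b s l m : dir_sum a s l -> dir_sum b s m ->
  dir_sum (dconv a b) s (l * m).
Proof.
move=> Ha Hb; have /cvg_ex[A cA] := dir_sum_abs Ha; have /cvg_ex[B cB] := dir_sum_abs Hb.
set u := dir_coef a s in cA; set v := dir_coef b s in cB.
have nn (w : nat -> R[i]) n : 0 <= normc (w n) by exact: normc_ge0.
have cAB := psum_mconv_cvg (nn u) (nn v) cA cB.
have Ec N : psum (dir_coef (dconv a b) s) N = psum (mconv u v) N.
  by apply: eq_big_nat => n /andP[n0 _]; rewrite dir_coef_dconv.
split.
  have [MA HA] := Ha.1; have [MB HB] := Hb.1; exists (MA * MB) => N.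
  apply: (@le_trans _ _ (psum (mconv (fun n => normc (u n)) (fun n => normc (v n))) N)).
    rewrite /psum; apply: ler_sum_nat => n /andP[n0 _].
    by rewrite dir_coef_dconv //; exact: normc_mconv_le.
  apply: le_trans (psum_mconv_le _ (nn u) (nn v)) _.
  by apply: ler_pM; [exact: sumr_ge0|exact: sumr_ge0|exact: HA|exact: HB].
have cuv := cvgCM Ha.2 Hb.2; apply: cvgC => e e0.
have e20 : 0 < e / 2 by rewrite divr_gt0.
have e40 : 0 < e / 4 by rewrite divr_gt0.
have [N1 _ H1] := cvgCP cuv e20.
have cAB2 : (fun N => psum (fun n => normc (u n)) N * psum (fun n => normc (v n)) N)
    @ \oo --> A * B by exact: cvgM.
have /cvgrPdist_lt/(_ _ e40)[N2 _ H2] := cAB.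
have /cvgrPdist_lt/(_ _ e40)[N3 _ H3] := cAB2.
exists (maxn N1 (maxn N2 N3)) => // N; rewrite /= !geq_max => /and3P[h1 h2 h3].
rewrite Ec (_ : _ - _ = (psum (mconv u v) N - psum u N * psum v N) +
  (psum u N * psum v N - l * m)); last by ring.
apply: le_lt_trans (le_normcD _ _) _; rewrite [e]splitr; apply: ler_ltD; last exact: H1.
apply: le_trans (psum_mconv_distance _ _ _) _.
have := H2 N h2; have := H3 N h3; rewrite /= !ltr_norml => /andP[+ +] /andP[+ +].
lra.
Qed.

End DirichletSeries.

Section ZetaSeries.
Variable R : realType.
Notation C := ((R[i])^o).
Implicit Types s : R[i].

Lemma ln_succ_ge (n : nat) : (n.+2%:R)^-1 <= ln n.+2%:R - ln n.+1%:R :> R.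
Proof.
have n1 : 0 < n.+1%:R :> R by rewrite ltr0n.
have n2 : 0 < n.+2%:R :> R by rewrite ltr0n.
have E : n.+2%:R = n.+1%:R + 1 :> R by rewrite natr1.
have := @le_ln1Dx R (- n.+2%:R^-1).
have -> : 1 - n.+2%:R^-1 = n.+1%:R / n.+2%:R :> R.
  rewrite E; move: (n.+1%:R : R) n1 => a a0.
  by field; apply: lt0r_neq0; lra.
by rewrite ln_div ?posrE // ltrN2 invf_lt1 // ltr1n => /(_ isT); rewrite lerNr opprB.
Qed.

(* Telescoping: [d (n+1)^(-1-d) <= n^(-d) - (n+1)^(-d)]. *)
Lemma summable_cpow s : 1 < complex.Re s -> abs_summable (fun k => cpow (k.+1%:R : R) s).
Proof.
move=> s1; set d := complex.Re s - 1; have d0 : 0 < d by rewrite /d; lra.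
apply: (@series_bounded_cvg _ _ (1 + d^-1)) => [k|n]; first exact: normc_ge0.
apply: (@le_trans _ _ (1 + d^-1 * (1 - expR (- d * ln n.-1.+1%:R)))); last first.
  by rewrite lerD2l -[leRHS]mulr1 ler_wpM2l ?invr_ge0 ?(ltW d0) // gerDl oppr_le0 expR_ge0.
elim: n => [|n IH].
  by rewrite /series /= big_geq // ln1 mulr0 expR0 subrr mulr0 addr0.
rewrite seriesSr; case: n IH => [|n] IH.
  rewrite (_ : series _ 0%N = 0); last by rewrite /series /= big_geq.
  by rewrite normc_cpow add0r ln1 !mulr0 expR0 subrr mulr0 addr0.
apply: le_trans (lerD IH (lexx _)) _.
rewrite normc_cpow -[n.+2.-1]/(n.+1) -[n.+1.-1]/n.
rewrite -!addrA lerD2l -(ler_pM2l d0) mulrDr !mulrA divff ?gt_eqF // !mul1r.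
have -> : - complex.Re s * ln n.+2%:R = - d * ln n.+2%:R - ln n.+2%:R by rewrite /d; ring.
rewrite expRD expRN lnK ?posrE ?ltr0n //.
set q := expR (- d * ln n.+2%:R).
have -> : expR (- d * ln n.+1%:R) = q * expR (d * (ln n.+2%:R - ln n.+1%:R)).
  by rewrite /q -expRD; congr expR; ring.
have q0 : 0 <= q by exact: expR_ge0.
have h1 : 1 + d * n.+2%:R^-1 <= expR (d * (ln n.+2%:R - ln n.+1%:R)).
  apply: le_trans (expR_ge1Dx _); rewrite lerD2l ler_wpM2l ?(ltW d0) //.
  exact: ln_succ_ge.
have := ler_wpM2l q0 h1.
by move: (expR _) (n.+2%:R^-1) => X Y; lra.
Qed.

Definition zeta_sum s : R[i] := limn (series (fun k => cpow (k.+1%:R : R) s : C)).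

Lemma sum_power_count (T : nmodType) (w : nat -> T) m N : (0 < m)%N ->
  \sum_(1 <= n < N.+1) w n *+ power_count m n =
  \sum_(1 <= i < N.+1 | (i ^ m <= N)%N) w (i ^ m)%N.
Proof.
move=> m0; transitivity (\sum_(1 <= n < N.+1) \sum_(1 <= i < N.+1 | (i ^ m)%N == n) w n).
  apply: eq_big_nat => n /andP[n0]; rewrite ltnS => nN.
  rewrite (power_count_bound m0 nN) -(big_mkord xpredT (fun i => nat_of_bool ((i ^ m)%N == n))).
  rewrite big_ltn // exp0n // (_ : (0%N == n) = false) ?add0n; last by rewrite eq_sym gtn_eqF.
  rewrite -sumrMnr [RHS]big_mkcond; apply: eq_bigr => i _.
  by case: eqP; rewrite ?mulr1n ?mulr0n.
rewrite (exchange_big_dep_nat xpredT) //= [RHS]big_mkcond; apply: eq_big_nat => i /andP[i0 _].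
rewrite (eq_bigl (fun n => n == (i ^ m)%N)); last by move=> n; rewrite eq_sym.
rewrite -big_filter; case: leqP => imN.
  rewrite (_ : [seq n <- index_iota 1 N.+1 | n == (i ^ m)%N] = [:: (i ^ m)%N]) ?big_seq1 //.
  by apply: filter_pred1_uniq; rewrite ?iota_uniq // mem_index_iota expn_gt0 i0.
rewrite big_filter big_nat_cond big1 // => n /andP[/andP[_ nN] /eqP E].
by move: nN; rewrite E ltnS leqNgt imN.
Qed.

Lemma dir_sum_power_count m s : (0 < m)%N -> 1 < complex.Re (m%:R * s) ->
  dir_sum (power_count m) s (zeta_sum (m%:R * s)).
Proof.
move=> m0 s1; have sa := summable_cpow s1.
have cX i : (0 < i)%N -> cpow ((i ^ m)%N%:R : R) s = cpow i%:R (m%:R * s).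
  by move=> i0; rewrite natrX cpowXn ?ltr0n.
pose w i : R[i] := cpow (i%:R : R) (m%:R * s).
have Ew N : psum w N = series (fun k => cpow (k.+1%:R : R) (m%:R * s) : C) N.
  exact: psum_series.
have En N : psum (fun i => normc (w i)) N =
    series (fun k => normc (cpow (k.+1%:R : R) (m%:R * s))) N by exact: psum_series.
have w0 i : 0 <= normc (w i) by exact: normc_ge0.
split.
  exists (limn (series (fun k => normc (cpow (k.+1%:R : R) (m%:R * s))))) => N.
  apply: le_trans (le_series_lim N _ sa); last by move=> k; exact: normc_ge0.
  rewrite -En /psum.
  rewrite (eq_bigr (fun n => normc (cpow (n%:R : R) s) *+ power_count m n)); last first.
    by move=> n _; rewrite /dir_coef normcM normc_nat mulr_natl.
  rewrite sum_power_count // big_mkcond; apply: ler_sum_nat => i /andP[i0 _].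
  by case: ifP => _ //; rewrite cX.
apply: cvgC => e e0; have e20 : 0 < e / 2 by rewrite divr_gt0.
have cw : series (fun k => cpow (k.+1%:R : R) (m%:R * s) : C) @ \oo -->
    (zeta_sum (m%:R * s) : C) by exact: (abs_summable_cvg sa).
have [N1 _ H1] := cvgCP cw e20.
have [K HK] := series_tail (fun k => normc_ge0 _) sa e20.
(* If K^m <= N, every i <= K satisfies i^m <= N, so the two partial sums differ only by terms beyond
   K. *)
exists (maxn N1 (maxn K (K ^ m))) => // N; rewrite /= !geq_max => /and3P[h1 h2 h3].
have := H1 N h1; rewrite /= -Ew => h.
rewrite (_ : _ - _ = (psum (dir_coef (power_count m) s) N - psum w N) +
  (psum w N - zeta_sum (m%:R * s))); last by ring.
apply: le_lt_trans (le_normcD _ _) _; rewrite [e]splitr; apply: ler_ltD => //.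
rewrite normcC; have -> : psum (dir_coef (power_count m) s) N =
    \sum_(1 <= i < N.+1 | (i ^ m <= N)%N) w i.
  rewrite /psum (eq_bigr (fun n => cpow (n%:R : R) s *+ power_count m n)); last first.
    by move=> n _; rewrite /dir_coef mulr_natl.
  rewrite sum_power_count // big_nat_cond [RHS]big_nat_cond.
  by apply: eq_bigr => i /andP[/andP[i0 _] _]; rewrite cX.
rewrite /psum (bigID (fun i => i ^ m <= N)%N) /= addrAC subrr add0r.
apply: le_trans (HK N h2); rewrite -!En /psum.
rewrite [X in _ <= X - _](big_cat_nat (_ : 1 <= K.+1)%N (_ : K.+1 <= N.+1)%N) //=.
rewrite addrAC subrr add0r; apply: le_trans (le_normc_sum _ _ _) _.
rewrite (big_cat_nat (_ : 1 <= K.+1)%N (_ : K.+1 <= N.+1)%N) //= big_nat_cond big1 ?add0r.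
  by rewrite big_mkcond; apply: ler_sum => i _; case: ifP.
move=> i /andP[/andP[_ iK]] /negP[]; apply: leq_trans h3.
by rewrite leq_exp2r.
Qed.

Lemma dir_sum_unit s : dir_sum (fun n => (n == 1)%N) s 1.
Proof.
have E N : (0 < N)%N -> psum (dir_coef (fun n => (n == 1)%N) s) N = 1.
  move=> N0; rewrite /psum big_ltn // big_nat_cond big1 ?addr0.
    by rewrite /dir_coef eqxx cpow1 mulr1.
  by move=> i /andP[/andP[i1 _] _]; rewrite /dir_coef gtn_eqF // mul0r.
split; last first.
  by apply: cvgC => e e0; exists 1%N => // n /= n1; rewrite E // subrr normc0.
exists 1 => -[|N]; first by rewrite /psum big_geq.
rewrite /psum big_ltn // big_nat_cond big1 ?addr0.
  by rewrite /dir_coef eqxx cpow1 mulr1 normc1.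
by move=> i /andP[/andP[i1 _] _]; rewrite /dir_coef gtn_eqF // mul0r normc0.
Qed.

Lemma dir_sum_power_conv l s :
  (forall m, m \in l -> (0 < m)%N /\ 1 < complex.Re (m%:R * s)) ->
  dir_sum (power_conv l) s (\prod_(m <- l) zeta_sum (m%:R * s)).
Proof.
elim: l => [|m l IH] H; first by rewrite big_nil; exact: dir_sum_unit.
rewrite big_cons; apply: dir_sum_dconv.
  by have [m0 ms] := H m (mem_head _ _); exact: dir_sum_power_count.
by apply: IH => k kl; apply: H; rewrite in_cons kl orbT.
Qed.

(** At the zeros of the denominator the value is 0 by the convention on division; [meromorphic_at]
    and [simple_pole_at] test only punctured neighbourhoods. *)
Definition zeta_cont s : R[i] := dirichlet_eta s / (1 - 2 * cpow (2 : R) s).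

Lemma normc_2cpow2 s : 1 < complex.Re s -> normc (2 * cpow (2 : R) s) < 1.
Proof.
move=> s1; rewrite normcM normc_nat normc_cpow.
have -> : (2 : R) * expR (- complex.Re s * ln 2) = expR ((1 - complex.Re s) * ln 2).
  rewrite mulrBl mul1r expRD lnK ?posrE ?ltr0n //; congr (_ * expR _); ring.
rewrite -[ltRHS]expR0 ltr_expR nmulr_rlt0 ?ln_gt0 ?ltr1n //; lra.
Qed.

Lemma zeta_contE s : 1 < complex.Re s -> zeta_cont s = zeta_sum s.
Proof.
move=> s1; rewrite /zeta_cont eta_zeta; last exact: summable_cpow.
rewrite mulrAC divff ?mul1r // subr_eq0; apply/eqP => E.
by have := normc_2cpow2 s1; rewrite -E normc1 ltxx.
Qed.

Definition g22_cont s : R[i] := \prod_(m <- [:: 1; 2; 3; 3; 4]%N) zeta_cont (m%:R * s).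

Lemma dir_sum_g22 s : 1 < complex.Re s -> dir_sum (fun n => g n 2 2) s (g22_cont s).
Proof.
move=> s1; have Rm m : (0 < m)%N -> 1 < complex.Re (m%:R * s).
  move=> m0; rewrite natrC ReM /= mul0r subr0.
  by rewrite (lt_le_trans s1) // ler_peMl ?ler1n // ltW // (lt_trans ltr01).
have l0 m : m \in [:: 1; 2; 3; 3; 4]%N -> (0 < m)%N by rewrite !inE => /or4P[|||/orP[]] /eqP ->.
have [|[M HM] Hc] := @dir_sum_power_conv [:: 1; 2; 3; 3; 4]%N s.
  by move=> m /l0 m0; split=> //; exact: Rm.
have Eg n : (0 < n)%N -> dir_coef (fun n => g n 2 2) s n =
    dir_coef (power_conv [:: 1; 2; 3; 3; 4]%N) s n.
  by move=> n0; rewrite /dir_coef g22_power_conv.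
have Ep N : psum (dir_coef (fun n => g n 2 2) s) N =
    psum (dir_coef (power_conv [:: 1; 2; 3; 3; 4]%N) s) N.
  by apply: eq_big_nat => n /andP[n0 _]; rewrite Eg.
have Ez : g22_cont s = \prod_(m <- [:: 1; 2; 3; 3; 4]%N) zeta_sum (m%:R * s).
  rewrite /g22_cont big_seq [RHS]big_seq; apply: eq_bigr => m /l0 m0.
  by rewrite zeta_contE //; exact: Rm.
split.
  exists M => N; apply: le_trans (HM N); rewrite /psum; apply: ler_sum_nat => n /andP[n0 _].
  by rewrite Eg.
have -> : psum (dir_coef (fun n => g n 2 2) s) =
    psum (dir_coef (power_conv [:: 1; 2; 3; 3; 4]%N) s) by apply/funext.
by rewrite Ez.
Qed.

End ZetaSeries.

(** * Meromorphy and the pole at 1 *)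

Section Meromorphic.
Variable R : realType.
Notation C := ((R[i])^o).
Implicit Types (f N D : R[i] -> R[i]) (z w : R[i]).

Definition entire f := forall z, exists l, has_cderiv f z l.

Lemma entire_derivable f z : entire f -> derivable (f : C -> C) z 1.
Proof. by move=> /(_ z)[l]; exact: has_cderiv_derivable. Qed.

Lemma holomorphic_entire f z : entire f -> holomorphic_at (f : C -> C) z.
Proof. by move=> ef; apply/nearC; exists 1 => // w _; exact: entire_derivable. Qed.

Lemma holomorphicM (f g : C -> C) (z : C) : holomorphic_at f z -> holomorphic_at g z ->
  holomorphic_at (fun w => f w * g w : C) z.
Proof.
move=> /nearC[d d0 Hd] /nearC[e e0 He]; apply/nearC; exists (Num.min d e).
  by rewrite lt_min d0.
move=> w; rewrite lt_min => /andP[wd we].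
exact: (derivableM (Hd w wd) (He w we)).
Qed.

Lemma holomorphicV (f : C -> C) (z : C) : holomorphic_at f z ->
  (\forall w \near z, f w != 0) -> holomorphic_at (fun w => (f w)^-1 : C) z.
Proof.
move=> /nearC[d d0 Hd] /nearC[e e0 He]; apply/nearC; exists (Num.min d e).
  by rewrite lt_min d0.
move=> w; rewrite lt_min => /andP[wd we].
exact: (derivableV (He w we) (Hd w wd)).
Qed.

Lemma near_neq0 f z l : has_cderiv f z l -> f z != 0 ->
  \forall w \near (z : C), f w != 0.
Proof.
move=> Hf fz; have fz0 : 0 < normc (f z) by rewrite normc_gt0.
have [d d0 Hd] := has_cderiv_continuous Hf fz0.
apply/nearC; exists d => // w wd; apply/eqP => fw.
by have := Hd (w - z) wd; rewrite (addrC z) subrK fw sub0r normcN ltxx.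
Qed.

Lemma has_cderiv_id z : has_cderiv id z 1.
Proof.
move=> e e0; exists 1 => // h _.
rewrite (_ : _ - _ = 0) ?normc0 ?mulr_ge0 ?normc_ge0 ?(ltW e0) //=; ring.
Qed.

Lemma entire_subr z : entire (fun w => w - z).
Proof. by move=> w; exists (1 + 0); exact: has_cderivD (has_cderiv_id w) (has_cderiv_const (- z) w). Qed.

Lemma entire_scale f (c : R[i]) : entire f -> entire (fun w => f (c * w)).
Proof. by move=> ef w; have [l Hl] := ef (c * w); exists (c * l); exact: has_cderiv_scale. Qed.

Lemma entire_cpow (x : R) : entire (cpow x).
Proof. by move=> w; exact: has_cderiv_cpow. Qed.

Lemma entire_affine f (a c : R[i]) : entire f -> entire (fun w => a + c * f w).
Proof.
move=> ef w; have [l Hl] := ef w; exists (0 + c * l).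
by apply: has_cderivD; [exact: has_cderiv_const|exact: has_cderivZ].
Qed.

(* The entire function (1 - exp (- b (w - z))) / (w - z). *)
Definition expq (b z w : R[i]) : R[i] :=
  if w == z then b else (1 - cexp (- b * (w - z))) / (w - z).

(** At the removable singularity, (1 - exp (- b h)) / h = b - b^2 h / 2 + O(h^2), the error being
    that of [normc_cexpB3] divided by h. *)
Lemma has_cderiv_expq b z : has_cderiv (expq b z) z (- (b ^+ 2 / 2)).
Proof.
move=> e e0; pose K := normc b ^+ 3 * expR (normc b) + 1.
have K0 : 0 < K by rewrite ltr_wpDl // mulr_ge0 ?exprn_ge0 ?normc_ge0 ?expR_ge0.
exists (Num.min 1 (e / K)); first by rewrite lt_min ltr01 divr_gt0.
move=> h; rewrite lt_min => /andP[h1 he].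
have [->|h0] := eqVneq h 0.
  by rewrite addr0 subrr mul0r subr0 normc0 mulr0.
have -> : expq b z (z + h) - expq b z z - h * - (b ^+ 2 / 2) =
    - h^-1 * (cexp (- b * h) - 1 - (- b * h) - (- b * h) ^+ 2 / 2).
  rewrite /expq eqxx (addrC z h) !addrK -subr_eq0 addrK (negbTE h0).
  by field; rewrite ?h0 ?pnatr_eq0.
rewrite normcM normcN normcV.
apply: le_trans (ler_wpM2l _ (normc_cexpB3 _)) _; first by rewrite invr_ge0 normc_ge0.
have bh : normc (- b * h) = normc b * normc h by rewrite normcM normcN.
have nh0 : 0 < normc h by rewrite normc_gt0.
apply: (@le_trans _ _ (K * normc h * normc h)).
  rewrite bh; have -> : (normc h)^-1 * ((normc b * normc h) ^+ 3 * expR (normc b * normc h)) =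
      normc b ^+ 3 * expR (normc b * normc h) * normc h * normc h.
    by field; rewrite gt_eqF.
  do 2!(apply: ler_wpM2r; first exact: normc_ge0).
  apply: (@le_trans _ _ (normc b ^+ 3 * expR (normc b))).
    rewrite ler_wpM2l ?exprn_ge0 ?normc_ge0 // ler_expR -[leRHS]mulr1.
    by rewrite ler_wpM2l ?normc_ge0 // ltW.
  by rewrite lerDl.
by rewrite ler_wpM2r ?normc_ge0 // mulrC -ler_pdivlMr // ltW.
Qed.

Lemma derivable_expq b z w : derivable (expq b z : C -> C) w 1.
Proof.
have [->|wz] := eqVneq w z; first exact: has_cderiv_derivable (has_cderiv_expq b z).
pose num (u : R[i]) : R[i] := 1 + - cexp (b * z) * cexp (- b * u).
have en : entire num.
  apply: entire_affine; apply: entire_scale => u; exists (cexp u).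
  exact: has_cderiv_cexp.
have wz0 : w - z != 0 by rewrite subr_eq0.
have dv := derivableV (wz0 : (fun u : C => u - z : C) w != 0)
  (entire_derivable (z := w) (entire_subr z)).
apply: near_eq_derivable (derivableM (entire_derivable (z := w) en) dv).
apply/nearC; exists (normc (w - z)); first by rewrite normc_gt0.
move=> u uw; rewrite /expq; case: eqP => [uz|_].
  by move: uw; rewrite uz normcC ltxx.
rewrite /= /num; congr (_ / _); rewrite mulNr -cexpD; congr (1 - cexp _); ring.
Qed.

Lemma holomorphic_expqV b z : b != 0 ->
  holomorphic_at (fun w => (expq b z w)^-1 : C) (z : C).
Proof.
move=> b0; apply: holomorphicV.
  by apply/nearC; exists 1 => // w _; exact: derivable_expq.
by apply: near_neq0 (has_cderiv_expq b z) _; rewrite /expq eqxx.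
Qed.

Definition zeta_den (m : nat) w : R[i] := 1 - 2 * cpow (2 : R) (m%:R * w).

Lemma entire_zeta_den m : entire (zeta_den m).
Proof.
have -> : zeta_den m = fun w => 1 + (-2) * cpow (2 : R) (m%:R * w).
  by apply/funext => w; rewrite /zeta_den mulNr.
by apply: entire_affine; apply: entire_scale; exact: entire_cpow.
Qed.

Lemma entire_eta m : entire (fun w => dirichlet_eta (m%:R * w)).
Proof. by apply: entire_scale => z; exact: has_cderiv_eta. Qed.

Lemma holomorphic_zeta_cont m z : zeta_den m z != 0 ->
  holomorphic_at (fun w => zeta_cont (m%:R * w) : C) (z : C).
Proof.
move=> Dz; have [l Hl] := entire_zeta_den m z.
apply: (@holomorphicM (fun w => dirichlet_eta (m%:R * w)) (fun w => (zeta_den m w)^-1)).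
  exact: holomorphic_entire (entire_eta m).
apply: holomorphicV; first exact: holomorphic_entire (entire_zeta_den m).
exact: near_neq0 Hl Dz.
Qed.

Definition zeta_pole (m : nat) z w : R[i] :=
  dirichlet_eta (m%:R * w) * (expq (m%:R * (ln 2)%:C) z w)^-1.

(** At a zero z of the denominator 2 * 2^(-m z) = 1, so the denominator at w is 1 - exp (- m ln 2 (w
    - z)). The factor w - z splits off, with quotient [expq] nonzero at z: every zero is simple. *)
Lemma zeta_poleE m z w : zeta_den m z = 0 -> w != z ->
  (w - z) * zeta_cont (m%:R * w) = zeta_pole m z w.
Proof.
move=> Dz wz; have wz0 : w - z != 0 by rewrite subr_eq0.
rewrite /zeta_pole /expq (negbTE wz) /zeta_cont -/(zeta_den m w).
have -> : zeta_den m w = 1 - cexp (- (m%:R * (ln 2)%:C) * (w - z)).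
  have /eqP := Dz; rewrite /zeta_den subr_eq0 => /eqP E.
  have -> : m%:R * w = m%:R * z + m%:R * (w - z) by ring.
  by rewrite cpowD mulrA -E mul1r /cpow; congr (1 - cexp _); ring.
by rewrite invfM invrK mulrCA; congr (_ * _); rewrite mulrC.
Qed.

Lemma holomorphic_zeta_pole m z : (0 < m)%N ->
  holomorphic_at (zeta_pole m z : C -> C) (z : C).
Proof.
move=> m0; apply: (@holomorphicM (fun w => dirichlet_eta (m%:R * w))
  (fun w => (expq (m%:R * (ln 2)%:C) z w)^-1)).
  exact: holomorphic_entire (entire_eta m).
apply: holomorphic_expqV; rewrite mulf_neq0 //; first by rewrite pnatr_eq0 -lt0n.
by rewrite -normc_eq0 normc_real normr_eq0 gt_eqF // ln_gt0 // ltr1n.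
Qed.

Lemma meromorphic_holomorphic (f : C -> C) (z : C) : holomorphic_at f z -> meromorphic_at f z.
Proof.
move=> hf; exists 0%N, f; split=> //; rewrite near_withinE; apply: nearW => w _.
by rewrite expr0 mul1r.
Qed.

Lemma meromorphic_zeta_cont m z : (0 < m)%N ->
  meromorphic_at (fun w => zeta_cont (m%:R * w) : C) (z : C).
Proof.
move=> m0; have [Dz|Dz] := eqVneq (zeta_den m z) 0; last first.
  by apply: meromorphic_holomorphic; exact: holomorphic_zeta_cont.
exists 1%N, (zeta_pole m z); split; first exact: holomorphic_zeta_pole.
rewrite near_withinE; apply: nearW => w wz; rewrite expr1.
exact: zeta_poleE.
Qed.

Lemma meromorphicM (f g : C -> C) (z : C) : meromorphic_at f z -> meromorphic_at g z ->
  meromorphic_at (fun w => f w * g w : C) z.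
Proof.
move=> [k [h [Hh Eh]]] [k' [h' [Hh' Eh']]].
exists (k + k')%N, (fun w => h w * h' w); split; first exact: holomorphicM.
near=> w; rewrite exprD.
have <- : (w - z) ^+ k * f w = h w by near: w.
have <- : (w - z) ^+ k' * g w = h' w by near: w.
by ring.
Unshelve. all: by end_near. Qed.

Lemma meromorphic_prod l z : all (leq 1) l ->
  meromorphic_at (fun w => \prod_(m <- l) zeta_cont (m%:R * w) : C) (z : C).
Proof.
elim: l => [_|m l IH /= /andP[m0 l0]].
  apply: meromorphic_holomorphic.
  have -> : (fun w => \prod_(m <- [::]) zeta_cont (m%:R * w) : C) = (fun=> 1).
    by apply/funext => w; rewrite big_nil.
  by apply: holomorphic_entire => w; exists 0; exact: has_cderiv_const.
have -> : (fun w => \prod_(m <- m :: l) zeta_cont (m%:R * w) : C) =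
    (fun w => zeta_cont (m%:R * w) * \prod_(m <- l) zeta_cont (m%:R * w) : C).
  by apply/funext => w; rewrite big_cons.
by apply: meromorphicM; [exact: meromorphic_zeta_cont|exact: IH].
Qed.

Lemma holomorphic_prod l z : (forall m, m \in l -> zeta_den m z != 0) ->
  holomorphic_at (fun w => \prod_(m <- l) zeta_cont (m%:R * w) : C) (z : C).
Proof.
elim: l => [_|m l IH H].
  have -> : (fun w => \prod_(m <- [::]) zeta_cont (m%:R * w) : C) = (fun=> 1).
    by apply/funext => w; rewrite big_nil.
  by apply: holomorphic_entire => w; exists 0; exact: has_cderiv_const.
have -> : (fun w => \prod_(m <- m :: l) zeta_cont (m%:R * w) : C) =
    (fun w => zeta_cont (m%:R * w) * \prod_(m <- l) zeta_cont (m%:R * w) : C).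
  by apply/funext => w; rewrite big_cons.
apply: holomorphicM; first by apply: holomorphic_zeta_cont; rewrite H ?mem_head.
by apply: IH => k kl; apply: H; rewrite in_cons kl orbT.
Qed.

(** For real s the terms are positive and the first one is 1, so the nonempty partial sums stay at
    distance at least 1 from 0. *)
Lemma zeta_sum_neq0 (s : R[i]) : 1 < complex.Re s -> complex.Im s = 0 -> zeta_sum s != 0.
Proof.
move=> s1 s0; have sa := summable_cpow s1.
have ReE k : complex.Re (cpow (k.+1%:R : R) s) = expR (- complex.Re s * ln k.+1%:R).
  by rewrite /cpow /cexp !ReM !ImM /= !ReN !ImN s0 oppr0 !mulr0 mul0r !subr0 addr0 sin0 cos0 mulr1 mulr0 subr0.
have cz : series (fun k => cpow (k.+1%:R : R) s : C) @ \oo --> (zeta_sum s : C).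
  exact: abs_summable_cvg sa.
apply/eqP => z0; rewrite z0 in cz; have [N _ HN] := cvgCP cz ltr01.
have := HN N.+1 (leqnSn N); rewrite /= subr0 => h.
have := le_lt_trans (normc_ge_Re _) h; rewrite Re_series => h2.
have := le_lt_trans (ler_norm _) h2.
have -> : series (fun k => complex.Re (cpow (k.+1%:R : R) s)) N.+1 =
    \sum_(0 <= k < N.+1) expR (- complex.Re s * ln k.+1%:R).
  by apply: eq_bigr => k _; exact: ReE.
rewrite big_nat_recl // ln1 mulr0 expR0.
by apply/negP; rewrite -leNgt lerDl sumr_ge0 // => k _; rewrite expR_ge0.
Qed.

(** One Euler step gives eta(1) = (1 + T) / 2, with T the alternating sum of c k = 1/(k+1) -
    1/(k+2). The terms after c 0 = 1/2 telescope to at most 1/2 in absolute value, so |T - 1/2| <=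
    1/2 and T is not -1. *)
Lemma dirichlet_eta1_neq0 : dirichlet_eta (1 : R[i]) != 0.
Proof.
pose c (k : nat) : R := k.+1%:R^-1 - k.+2%:R^-1.
have c0 k : 0 <= c k.
  by rewrite subr_ge0 lef_pV2 ?posrE ?ltr0n // ler_nat.
have tE k : eta_term 1 1 k = (c k)%:C.
  by rewrite eta_termS !eta_term0 !cpow_real1 ?ltr0n // /c rmorphB.
have r2 : 2 <= complex.Re (1 : R[i]) + 1%:R by rewrite /=; lra.
rewrite (dirichlet_etaE r2) /eta_approx /eta_head big_nat1 expr1 eta_term0 cpow1.
rewrite mulr1 -[X in X + _]mulr1 -mulrDr mulf_neq0 // ?invr_eq0 ?pnatr_eq0 //.
have sa : abs_summable (eta_term 1 1 : nat -> R[i]) by exact: eta_term_summable.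
have ct : series (fun k => alt_sign R k * eta_term 1 1 k : C) @ \oo --> (eta_tail 1 1 : C).
  exact: abs_summable_cvg (abs_summable_alt sa).
have ct2 := cvgCB ct (cvg_cst ((c 0%N)%:C : C)).
have : normc (eta_tail 1 1 - (c 0%N)%:C) <= 2^-1.
  apply: (normc_lim_le (ct2 _)); exists 1%N => // -[//|n] _ /=.
  rewrite /series /= big_nat_recl // /alt_sign expr0 mul1r tE addrAC subrr add0r.
  apply: le_trans (le_normc_sum _ _ _) _.
  apply: (@le_trans _ _ (\sum_(0 <= i < n) c i.+1)).
    apply: ler_sum => i _; rewrite normcM normc_alt_sign mul1r tE normc_real.
    by rewrite ger0_norm.
  have -> : \sum_(0 <= i < n) c i.+1 = 2^-1 - n.+2%:R^-1.
    elim: n => [|n IH]; first by rewrite big_geq // subrr.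
    by rewrite big_nat_recr //= IH /c; ring.
  by rewrite gerDl oppr_le0 invr_ge0.
have -> : (c 0%N)%:C = 2^-1 :> R[i].
  by rewrite /c invr1 rmorphB /= fmorphV rmorph1 rmorph_nat; field.
move=> h; apply/eqP => E.
have := le_trans (normc_ge_Re _) h.
have -> : eta_tail 1 1 = -1 :> R[i] by apply: (addrI 1); rewrite E subrr.
have -> : complex.Re (-1 - 2^-1 : R[i]) = - (3 / 2).
  rewrite ReD !ReN (_ : (2^-1 : R[i]) = (2^-1)%:C) /=; first by field.
  by rewrite fmorphV rmorph_nat.
rewrite normrN ger0_norm; lra.
Qed.

(** The factor for m = 1 has residue eta(1) / ln 2, which is nonzero; the other factors are
    holomorphic near 1 and take there the nonzero values zeta(m), m = 2, 3, 3, 4. *)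
Lemma g22_cont_simple_pole : simple_pole_at (@g22_cont R : C -> C) (1 : C).
Proof.
have D1 : zeta_den 1 1 = 0 :> R[i].
  rewrite /zeta_den mulr1 cpow_real1 ?ltr0n // (natrC R 2) -rmorphM divff ?pnatr_eq0 //.
  by rewrite rmorph1 subrr.
have Rm m : (1 < m)%N -> 1 < complex.Re (m%:R : R[i]) by rewrite natrC /= ltr1n.
have lm m : m \in [:: 2; 3; 3; 4]%N -> (1 < m)%N by rewrite !inE => /or4P[] /eqP ->.
have Dm m : m \in [:: 2; 3; 3; 4]%N -> zeta_den m (1 : R[i]) != 0.
  move=> /lm m1; rewrite /zeta_den mulr1 subr_eq0; apply/eqP => E.
  by have := normc_2cpow2 (Rm m m1); rewrite -E normc1 ltxx.
exists (fun w => zeta_pole 1 1 w * \prod_(m <- [:: 2; 3; 3; 4]%N) zeta_cont (m%:R * w)).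
split.
- by apply: holomorphicM; [exact: holomorphic_zeta_pole|exact: holomorphic_prod].
- rewrite mulf_neq0 //.
    rewrite /zeta_pole mulr1 mul1r /expq eqxx mulf_neq0 ?dirichlet_eta1_neq0 //.
    by rewrite invr_eq0 -normc_eq0 normc_real normr_eq0 gt_eqF // ln_gt0 // ltr1n //.
  rewrite prodf_seq_neq0; apply/allP => m ml /=; rewrite mulr1.
  rewrite zeta_contE; last exact/Rm/lm.
  by apply: zeta_sum_neq0; [exact/Rm/lm|rewrite natrC].
rewrite near_withinE; apply: nearW => w wz.
by rewrite /g22_cont big_cons mulrA -(zeta_poleE D1 wz).
Qed.

Lemma g22_cont_meromorphic z : meromorphic_at (@g22_cont R : C -> C) (z : C).
Proof. exact: meromorphic_prod. Qed.

Lemma g22_dirichlet_converges (s : C) : 1 < complex.Re s ->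
  dirichlet_converges (fun n => g n 2 2) s.
Proof. by move=> /dir_sum_g22[_ Hc]; apply/cvg_ex; exists (g22_cont s). Qed.

Lemma g22_dirichlet_series (s : C) : 1 < complex.Re s ->
  g22_cont s = dirichlet_series (fun n => g n 2 2) s.
Proof. by move=> /dir_sum_g22[_ Hc]; apply/esym; exact: cvgC_lim Hc. Qed.

End Meromorphic.

(** * Divergence to the left of Re s = 1 *)

Section Divergence.
Variable R : realType.
Notation C := ((R[i])^o).

(** |e^(ix) - 1| <= |x| e^|x| <= 1/4 times 4/3, where e^(1/4) <= 4/3 follows from e^(-1/4) >= 1 -
    1/4. *)
Lemma Re_cexp_ge (x : R) : `|x| <= 4^-1 -> 2 / 3 <= complex.Re (cexp (x *i)).
Proof.
move=> x4; have h := normc_cexpB1 (x *i).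
have nx : normc (x *i) = `|x| by rewrite /= expr0n /= add0r sqrtr_sqr.
rewrite nx in h.
have e4 : expR (4^-1) <= 4 / 3 :> R.
  have := expR_ge1Dx (- 4^-1 : R); rewrite expRN => h1.
  have e0 : 0 < expR (4^-1) :> R by exact: expR_gt0.
  have := ler_wpM2r (ltW e0) h1; rewrite mulVf ?gt_eqF //; lra.
have h2 : `|x| * expR `|x| <= 4^-1 * (4 / 3).
  apply: (ler_pM (normr_ge0 _) (expR_ge0 _) x4).
  by apply: le_trans e4; rewrite ler_expR.
have := le_trans (normc_ge_Re _) (le_trans h h2).
rewrite ReD ReN (_ : complex.Re (1 : R[i]) = 1) // ler_norml => /andP[+ _]; lra.
Qed.

(* On a block (K M, (K+1) M] with 4 |t| <= K the phases n^(-it) stay within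
   1/4 of each other, so the M terms of modulus at least 1/n do not cancel. *)
Lemma dirichlet_diverges (a : nat -> nat) (s : C) :
  (forall n, (0 < n)%N -> (0 < a n)%N) -> complex.Re s < 1 ->
  ~ dirichlet_converges a s.
Proof.
move=> a0 s1 /cvg_ex[l cl]; set sg := complex.Re s in s1; set t := complex.Im s.
pose K := (Num.truncn (4 * `|t|)).+1.
have K0 : 0 < K%:R :> R by rewrite ltr0n.
have tK : `|t| * K%:R^-1 <= 4^-1.
  rewrite ler_pdivrMr //; have := truncnS_gt (4 * `|t|); rewrite -/K => /ltW; lra.
(* Half the lower bound for a block: two partial sums within e of the limit differ by less than 2
   e. *)
pose e : R := 2 / 3 / K.+1%:R / 2.
have e0 : 0 < e by rewrite /e !divr_gt0 ?ltr0n.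
have [N _ HN] := cvgCP cl e0.
pose M := N.+1; pose A := (K * M)%N.
have A0 : (0 < A)%N by rewrite muln_gt0.
have hA : (N <= A)%N by rewrite /A /M /K; nia.
have hB : (N <= A + M)%N by rewrite (leq_trans hA) // leq_addr.
pose D : R[i] := \sum_(A.+1 <= n < (A + M).+1) dir_coef a s n.
have ED : D = psum (dir_coef a s) (A + M) - psum (dir_coef a s) A.
  rewrite /psum [X in _ = X - _](big_cat_nat (_ : 1 <= A.+1)%N) //=; last by rewrite ltnS leq_addr.
  by rewrite addrAC subrr add0r.
have nD : normc D < e + e.
  rewrite ED (_ : _ - _ = (psum (dir_coef a s) (A + M) - l) - (psum (dir_coef a s) A - l)); last by ring.
  apply: le_lt_trans (le_normcB _ _) _; apply: ltrD; [exact: HN hB|exact: HN hA].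
(* Rotation by w, of modulus 1, brings the phase at the left end A of the block to 0. *)
pose w : R[i] := cexp ((t * ln A%:R) *i).
have nw : normc w = 1 by rewrite normc_cexp /= expR0.
have term n : (A < n <= A + M)%N ->
    2 / 3 * (n%:R)^-1 <= complex.Re (dir_coef a s n * w).
  move=> /andP[An nAM]; have n0 : (0 < n)%N by exact: leq_trans An.
  have n0R : 0 < n%:R :> R by rewrite ltr0n.
  have A0R : 0 < A%:R :> R by rewrite ltr0n.
  pose th := t * (ln A%:R - ln n%:R).
  have Ec : dir_coef a s n * w = ((a n)%:R * expR (- sg * ln n%:R))%:C * cexp (th *i).
    rewrite rmorphM /= -natrC -cexp_real /dir_coef -(mulrA (a n)%:R (cpow _ _)) -(mulrA (a n)%:R (cexp _)).
    congr (_ * _).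
    rewrite /cpow /w -!cexpD; congr cexp; apply: complex_eq; rewrite ?(ReD, ImD, ReM, ImM, ReN, ImN) /=.
      by rewrite -/sg -/t; ring.
    by rewrite -/sg -/t /th; ring.
  have lnn : 0 <= ln (n%:R : R) - ln A%:R <= K%:R^-1.
    apply/andP; split; first by rewrite subr_ge0 ler_ln ?posrE // ler_nat ltnW.
    rewrite -ln_div ?posrE //.
    have q : n%:R / A%:R = 1 + (n%:R - A%:R) / A%:R :> R by field; rewrite gt_eqF.
    rewrite q; apply: le_trans (le_ln1Dx _) _.
      apply: lt_le_trans (_ : 0 <= _); first by rewrite ltrN10.
      by rewrite divr_ge0 // subr_ge0 ler_nat ltnW.
    rewrite ler_pdivrMr // (_ : K%:R^-1 * A%:R = M%:R); last first.
      by rewrite /A natrM mulrA mulVf ?mul1r // gt_eqF.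
    by rewrite lerBlDl -natrD ler_nat.
  have thle : `|th| <= 4^-1.
    apply: le_trans tK; rewrite /th normrM ler_wpM2l // distrC.
    by case/andP: lnn => l1 l2; rewrite ger0_norm.
  have ReZ (x : R) (z : R[i]) : complex.Re (x%:C * z) = x * complex.Re z.
    by rewrite ReM mul0r subr0.
  rewrite Ec ReZ [leRHS]mulrC.
  have z0 : 0 <= 2 / 3 :> R by rewrite divr_ge0.
  have i0 : 0 <= (n%:R)^-1 :> R by rewrite invr_ge0.
  apply: (ler_pM z0 i0 (Re_cexp_ge thle)).
  apply: (@le_trans _ _ (1 * expR (- sg * ln n%:R))); last first.
    by rewrite ler_wpM2r ?expR_ge0 // ler1n a0.
  rewrite mul1r -[X in X^-1 <= _]lnK ?posrE // -expRN ler_expR -mulN1r.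
  by rewrite ler_wpM2r ?ln_ge0 ?ler1n // lerN2 ltW.
have Dw : 2 / 3 / K.+1%:R <= complex.Re (D * w).
  rewrite /D mulr_suml Re_sum.
  apply: (@le_trans _ _ (\sum_(A.+1 <= n < (A + M).+1) 2 / 3 * ((A + M)%N%:R)^-1)); last first.
    apply: ler_sum_nat => n /andP[An nAM].
    apply: le_trans (term n _); last by rewrite An -ltnS.
    rewrite ler_wpM2l ?divr_ge0 // lef_pV2 ?posrE ?ltr0n ?ler_nat ?addn_gt0 ?A0 //.
    exact: leq_trans An.
  rewrite sumr_const_nat subSS addKn -[leRHS]mulr_natr.
  rewrite (_ : A + M = K.+1 * M)%N; last by rewrite /A mulSn addnC.
  rewrite natrM invfM -!mulrA mulVf ?mulr1 //.
  by rewrite pnatr_eq0.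
have : complex.Re (D * w) <= normc D.
  apply: le_trans (ler_norm _) _; apply: le_trans (normc_ge_Re _) _.
  by rewrite normcM nw mulr1.
move=> h; have := le_lt_trans (le_trans Dw h) nD.
by rewrite /e -splitr ltxx.
Qed.

End Divergence.

(** * Asymptotics *)

Lemma eq_cvgn (T : topologicalType) (u v : nat -> T) (l : T) :
  (forall n, u n = v n) -> u @ \oo --> l -> v @ \oo --> l.
Proof. by move=> /funext ->. Qed.

Section Asymptotics.
Variable R : realType.
Notation C := ((R[i])^o).

Lemma cvg_Re (u : nat -> C) (l : C) : u @ \oo --> l ->
  (fun n => complex.Re (u n)) @ \oo --> complex.Re l.
Proof.
move=> ul; apply/cvgrPdist_lt => e e0; have [N _ HN] := cvgCP ul e0.
exists N => // n Nn; rewrite distrC -ReN -ReD.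
exact: le_lt_trans (normc_ge_Re _) (HN n Nn).
Qed.

Lemma cpow_nat (x : R) m : 0 < x -> cpow x m%:R = (x ^- m)%:C.
Proof.
move=> x0; rewrite -[m%:R]mulr1 -cpowXn // cpow_real1 // exprn_gt0 //.
Qed.

Lemma cvg_zeta_sum_nat m : (1 < m)%N ->
  series (fun k => (k.+1%:R ^- m : R)) @ \oo --> complex.Re (zeta_sum (m%:R : R[i])).
Proof.
move=> m1; have m1R : 1 < complex.Re (m%:R : R[i]) by rewrite natrC /= ltr1n.
apply: eq_cvgn (cvg_Re (abs_summable_cvg (summable_cpow m1R))) => n.
rewrite Re_series; apply: eq_bigr => k _.
by rewrite cpow_nat ?ltr0n.
Qed.

Lemma Im_zeta_sum_nat m : (1 < m)%N -> zeta_sum (m%:R : R[i]) = (complex.Re (zeta_sum (m%:R : R[i])))%:C.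
Proof.
move=> m1; have m1R : 1 < complex.Re (m%:R : R[i]) by rewrite natrC /= ltr1n.
have c1 := abs_summable_cvg (summable_cpow m1R).
apply: (cvgC_unique c1).
have -> : series (fun k => cpow (k.+1%:R : R) m%:R : C) =
    (fun n => (series (fun k => (k.+1%:R ^- m : R)) n)%:C : C).
  apply/funext => n; rewrite /series /= rmorph_sum; apply: eq_bigr => k _.
  by rewrite cpow_nat ?ltr0n.
apply: cvgC_ReIm => /=; first exact: cvg_zeta_sum_nat.
exact: cvg_cst.
Qed.

Definition zetaR (m : nat) : R := complex.Re (zeta_sum (m%:R : R[i])).

Lemma zeta3E : zeta (3 : R) = zetaR 3.
Proof.
apply/cvg_lim => //; apply: eq_cvgn (@cvg_zeta_sum_nat 3 isT) => N.
rewrite [RHS]big_add1 /=.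
apply: eq_bigr => k _; rewrite powRN.
by rewrite powR_mulrn.
Qed.

(** The factor zeta(s) has all coefficients 1, so for fixed j the sum over i j <= n counts the i <=
    n / j. *)
Lemma sum_g22 (n : nat) : ((\sum_(1 <= m < n.+1) g m 2 2)%N%:R : R) =
  \sum_(1 <= j < n.+1) (power_conv [:: 2; 3; 3; 4]%N j)%:R * (n %/ j)%:R.
Proof.
pose u k : R := (power_count 1 k)%:R; pose v k : R := (power_conv [:: 2; 3; 3; 4]%N k)%:R.
have u1 i : (0 < i)%N -> u i = 1.
  move=> i0; rewrite /u /power_count (bigD1 ord_max) //= expn1 eqxx big1 // => j jn.
  by rewrite expn1; case: eqP => // E; case/eqP: jn; apply: val_inj.
transitivity (psum (mconv u v) n).
  rewrite natr_sum; apply: eq_big_nat => m /andP[m0 _].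
  rewrite g22_power_conv // -[power_conv _]/(dconv (power_count 1) (power_conv [:: 2; 3; 3; 4]%N)).
  rewrite /dconv /mconv natr_sum; apply: eq_bigr => i _.
  by rewrite natr_sum; apply: eq_bigr => j _; rewrite natrM.
rewrite /psum sum_mconv (exchange_big_dep_nat xpredT) //=; apply: eq_big_nat => j /andP[j0 jn].
rewrite -/(v j).
transitivity (\sum_(1 <= i < (n %/ j).+1) v j); last by rewrite sumr_const_nat subn1 /= mulr_natr.
rewrite [RHS](big_nat_widen _ _ n.+1); last by rewrite ltnS leq_div.
rewrite big_nat_cond [RHS]big_nat_cond; apply: eq_big => [i|i /andP[/andP[i0 _] _]].
  by rewrite /= !ltnS leq_divRL.
by rewrite u1 // mul1r.
Qed.

(** From above, floor(n / j) <= n / j. From below, keep only j <= J and use floor(n / j) >= n / j -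
    1: the loss is at most S / n, with S the sum of the first J coefficients. *)
Lemma cvg_average_floor (b : nat -> R) (B : R) : (forall j, 0 <= b j) ->
  psum (fun j => b j / j%:R) @ \oo --> B ->
  (fun n => (\sum_(1 <= j < n.+1) b j * (n %/ j)%:R) / n%:R) @ \oo --> B.
Proof.
move=> b0 cB.
have bj0 j : 0 <= b j / j%:R by rewrite divr_ge0.
apply/cvgrPdist_le => e e0; have e20 : 0 < e / 2 by rewrite divr_gt0.
have /cvgrPdist_le/(_ _ e20)[J _ HJ] := cB.
pose S := psum b J; have S0 : 0 <= S by exact: sumr_ge0.
exists (maxn J.+1 (Num.truncn (S / (e / 2))).+1) => // n; rewrite /= geq_max => /andP[Jn Sn].
have n0 : (0 < n)%N by exact: leq_trans Jn.
have n0R : 0 < n%:R :> R by rewrite ltr0n.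
have up : (\sum_(1 <= j < n.+1) b j * (n %/ j)%:R) / n%:R <= psum (fun j => b j / j%:R) n.
  rewrite ler_pdivrMr // /psum mulr_suml; apply: ler_sum_nat => j /andP[j0 _].
  rewrite -mulrA ler_wpM2l // mulrC ler_pdivlMr ?ltr0n // -natrM ler_nat.
  exact: leq_trunc_div.
have lo : psum (fun j => b j / j%:R) J - S / n%:R <=
    (\sum_(1 <= j < n.+1) b j * (n %/ j)%:R) / n%:R.
  rewrite ler_pdivlMr // mulrBl mulfVK ?gt_eqF // /S /psum mulr_suml -sumrB.
  rewrite [leRHS](big_cat_nat (_ : 1 <= J.+1)%N) //=; last by rewrite ltnS ltnW.
  apply: ler_wpDr; first by apply: sumr_ge0 => j _; exact: mulr_ge0.
  apply: ler_sum_nat => j /andP[j0 _]; have j0R : 0 < j%:R :> R by rewrite ltr0n.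
  rewrite -mulrA -[X in _ - X]mulr1 -mulrBr ler_wpM2l // lerBlDr mulrC ler_pdivrMr //.
  by rewrite natr1 -natrM ler_nat ltnW // ltn_ceil.
have SnE : S / n%:R <= e / 2.
  rewrite ler_pdivrMr // mulrC -ler_pdivrMr //.
  apply: ltW; apply: lt_le_trans (truncnS_gt _) _; by rewrite ler_nat.
have Jn' : (J <= n)%N by exact: ltnW.
have := HJ J (leqnn J); have := HJ n Jn'; rewrite /= !ler_norml => /andP[h1 h2] /andP[h3 h4].
lra.
Qed.

Lemma cvg_power_conv_over_id : psum (fun j => ((power_conv [:: 2; 3; 3; 4]%N j)%:R / j%:R : R)) @ \oo -->
  zetaR 2 * zetaR 4 * zetaR 3 ^+ 2.
Proof.
have [|_ Hc] := @dir_sum_power_conv R [:: 2; 3; 3; 4]%N 1.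
  by move=> m; rewrite !inE mulr1 natrC /= ltr1n => /or4P[] /eqP ->.
have -> : zetaR 2 * zetaR 4 * zetaR 3 ^+ 2 =
    complex.Re (\prod_(m <- [:: 2; 3; 3; 4]%N) zeta_sum (m%:R * 1 : R[i])).
  rewrite !big_cons big_nil !mulr1 (@Im_zeta_sum_nat 2) // (@Im_zeta_sum_nat 3) //.
  by rewrite (@Im_zeta_sum_nat 4) // -!rmorphM /= /zetaR; ring.
apply: eq_cvgn (cvg_Re Hc) => N.
rewrite /psum Re_sum; apply: eq_big_nat => j /andP[j0 _].
by rewrite /dir_coef cpow_real1 ?ltr0n // natrC -rmorphM.
Qed.

Lemma cvg_average_g22 :
  (fun n => (\sum_(1 <= m < n.+1) g m 2 2)%N%:R / n%:R : R) @ \oo -->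
  zetaR 2 * zetaR 4 * zetaR 3 ^+ 2.
Proof.
have := cvg_average_floor (fun j => ler0n _ _) cvg_power_conv_over_id.
by apply: eq_cvgn => n; rewrite sum_g22.
Qed.

End Asymptotics.

End Continuation.

(** * Special values *)

Section SpecialValues.
Import Normc.
Local Open Scope classical_set_scope.
Local Open Scope ring_scope.

Section ZetaEven.
Variable R : realType.
Local Notation pi := (@pi R).

Lemma sin_bounds (x : R) : 0 < x < pi / 2 -> sin x <= x /\ x * cos x <= sin x.
Proof.
move=> /andP[x0 xp].
have D t : t \in `]0, x[%R -> is_derive t 1 (@sin R) (cos t) by move=> _; exact: is_derive_sin.
have Ct : {within `[0, x], continuous (@sin R)}.
  exact/continuous_subspaceT/continuous_sin.
have [c] := MVT_segment (ltW x0) D Ct.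
rewrite in_itv /= sin0 !subr0 => /andP[c0 cx] ->; split.
  by rewrite -[leRHS]mul1r ler_wpM2r ?(ltW x0) // cos_le1.
rewrite mulrC ler_wpM2r ?(ltW x0) //.
have p0 := pi_gt0 R.
have [->//|cx'] := eqVneq c x.
rewrite ltW // ltr_cos ?in_itv /=; [|lra|lra].
by rewrite lt_neqAle cx'.
Qed.

Definition csc2 (x : R) : R := sin x ^- 2.

(** The bounds x cos x <= sin x <= x say that cot x <= 1 / x <= csc x, and csc^2 = 1 + cot^2. *)
Lemma csc2_bounds (x : R) : 0 < x < pi / 2 ->
  [/\ 0 <= x ^- 2, x ^- 2 <= csc2 x & csc2 x <= 1 + x ^- 2].
Proof.
move=> xI; have [h1 h2] := sin_bounds xI; have /andP[x0 xp] := xI.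
have s0 : 0 < sin x by exact: sin_gt0_pihalf.
have c0 : 0 < cos x by apply: cos_gt0_pihalf; apply/andP; split=> //; lra.
split; first by rewrite invr_ge0 exprn_ge0 // ltW.
  by rewrite /csc2 lef_pV2 ?posrE ?exprn_gt0 // lerXn2r ?nnegrE ?(ltW s0) ?(ltW x0).
have -> : csc2 x = 1 + (cos x / sin x) ^+ 2.
  rewrite /csc2; have := cos2Dsin2 x => E.
  have -> : 1 + (cos x / sin x) ^+ 2 = (cos x ^+ 2 + sin x ^+ 2) / sin x ^+ 2.
    by field; rewrite ?gt_eqF.
  by rewrite E mul1r.
rewrite lerD2l -exprVn lerXn2r ?nnegrE ?divr_ge0 ?invr_ge0 ?(ltW x0) ?(ltW c0) ?(ltW s0) //.
by rewrite ler_pdivrMr // mulrC ler_pdivlMr // mulrC.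
Qed.

(** With s = sin y and c = cos y, both the sum and the product of s^(-2) and c^(-2) equal 1 / (s
    c)^2 = 4 csc^2(2 y); the sum of squares is the square of the sum minus twice the product. *)
Lemma csc2_half (y : R) : 0 < y -> y < pi / 4 ->
  csc2 y + csc2 (pi / 2 - y) = 4 * csc2 (y *+ 2) /\
  csc2 y ^+ 2 + csc2 (pi / 2 - y) ^+ 2 = 16 * csc2 (y *+ 2) ^+ 2 - 8 * csc2 (y *+ 2).
Proof.
move=> y0 yp; have p0 := pi_gt0 R.
have s0 : sin y != 0 by rewrite gt_eqF // sin_gt0_pihalf // y0; lra.
have c0 : cos y != 0 by rewrite gt_eqF // cos_gt0_pihalf //; apply/andP; split; lra.
have -> : csc2 (pi / 2 - y) = cos y ^- 2.
  by rewrite /csc2 -opprB sinN sinBpihalf opprK.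
rewrite /csc2 sin_mulr2n; have E := cos2Dsin2 y.
have E2 : cos y ^+ 2 = 1 - sin y ^+ 2 by lra.
have D : 1 - sin y ^+ 2 != 0 by rewrite -E2 expf_neq0.
have -> : ((cos y * sin y) *+ 2) ^+ 2 = 4 * (1 - sin y ^+ 2) * sin y ^+ 2.
  by rewrite -E2; ring.
rewrite E2; split; field; rewrite s0 ?D //.
Qed.

(* Halving the angles shows that the sums of csc^2 and csc^4 over the odd
   multiples of pi / 2^(n+2) below pi / 2 satisfy explicit recursions; dividing
   by 4^n, resp. 16^n, gives the sums of the odd inverse squares and fourth
   powers in the limit. *)
Definition ang n k : R := (k.*2.+1)%:R * pi / (2 ^ n.+2)%:R.

Lemma ang_bounds n k : (k < 2 ^ n)%N -> 0 < ang n k < pi / 2.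
Proof.
move=> kn; have p0 := pi_gt0 R.
have d0 : 0 < (2 ^ n.+2)%:R :> R by rewrite ltr0n expn_gt0.
apply/andP; split; first by rewrite divr_gt0 ?mulr_gt0 ?ltr0n ?expn_gt0.
rewrite ltr_pdivrMr // -mulrA [ltLHS]mulrC ltr_pM2l //.
by rewrite mulrC ltr_pdivlMr ?ltr0n // -natrM ltr_nat !expnS; lia.
Qed.

Lemma ang_half n k : ang n.+1 k *+ 2 = ang n k.
Proof.
rewrite /ang (expnS _ n.+2) natrM; field.
by rewrite pnatr_eq0 -lt0n expn_gt0.
Qed.

Lemma ang_rev n k : (k < 2 ^ n)%N -> ang n.+1 (2 ^ n.+1 - k.+1) = pi / 2 - ang n.+1 k.
Proof.
move=> kn; rewrite /ang.
have -> : ((2 ^ n.+1 - k.+1).*2.+1)%:R = (2 ^ n.+2)%:R - (k.*2.+1)%:R :> R.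
  rewrite -natrB; last by rewrite !expnS; lia.
  by congr _%:R; rewrite !expnS in kn *; lia.
rewrite (expnS _ n.+2) natrM.
have : (2 ^ n.+2)%:R != 0 :> R by rewrite pnatr_eq0 -lt0n expn_gt0.
by move: ((2 ^ n.+2)%:R : R) => a a0; field.
Qed.

(** Pairs k with its mirror image, whose angle is complementary by [ang_rev]. *)
Lemma sum_double (F : nat -> R) n : \sum_(0 <= k < 2 ^ n.+1) F k =
  \sum_(0 <= k < 2 ^ n) (F k + F (2 ^ n.+1 - k.+1)%N).
Proof.
have e2 : (2 ^ n.+1 = 2 ^ n + 2 ^ n)%N by rewrite expnS mul2n addnn.
have sh (G : nat -> R) : \sum_(2 ^ n <= k < 2 ^ n.+1) G k = \sum_(0 <= k < 2 ^ n) G (k + 2 ^ n)%N.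
  by rewrite -[X in index_iota X _]add0n big_addn e2 addnK.
rewrite big_split /= (big_cat_nat (leq0n (2 ^ n)%N)) /=; last by rewrite e2 leq_addr.
congr (_ + _); rewrite big_nat_rev /= sh.
by apply: eq_big_nat => k /andP[_ kn]; congr F; lia.
Qed.

Definition csc_sum (p n : nat) : R := \sum_(0 <= k < 2 ^ n) csc2 (ang n k) ^+ p.

Lemma csc_sum1 n : csc_sum 1 n = 2 * 4 ^+ n.
Proof.
elim: n => [|n IH].
  rewrite /csc_sum expn0 big_nat1 expr1 expr0 /csc2 mulr1.
  have E : sin (ang 0 0) ^+ 2 = 2^-1.
    have := cos_mulr2n (ang 0 0); have -> : ang 0 0 *+ 2 = pi / 2.
      by rewrite /ang -[(2 ^ 2)%N]/4%N -[(0.*2.+1)%N]/1%N; field.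
    rewrite cos_pihalf; have := cos2Dsin2 (ang 0 0); lra.
  by rewrite E invrK.
rewrite /csc_sum sum_double exprS mulrCA -IH /csc_sum mulr_sumr.
apply: eq_big_nat => k /andP[_ kn]; rewrite !expr1 ang_rev //.
have /andP[a0 ap] := ang_bounds kn.
have := ang_half n k => E; rewrite (csc2_half _ _).1 ?E //; lra.
Qed.

Lemma csc_sum2 n : csc_sum 2 n = (8 * 16 ^+ n + 4 * 4 ^+ n) / 3.
Proof.
elim: n => [|n IH].
  have := csc_sum1 0; rewrite /csc_sum expn0 !big_nat1 expr1 !expr0 => ->; lra.
have -> : csc_sum 2 n.+1 = 16 * csc_sum 2 n - 8 * csc_sum 1 n.
  rewrite /csc_sum sum_double !mulr_sumr -sumrB.
  apply: eq_big_nat => k /andP[_ kn]; rewrite expr1 ang_rev //.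
  have /andP[a0 ap] := ang_bounds kn.
  have := ang_half n k => E; rewrite (csc2_half _ _).2 ?E //; lra.
by rewrite IH csc_sum1 !exprS; field.
Qed.

Definition odd_sum (m n : nat) : R := \sum_(0 <= k < 2 ^ n) (k.*2.+1)%:R ^- m.

Definition ang_sum (p n : nat) : R := \sum_(0 <= k < 2 ^ n) (ang n k ^- 2) ^+ p.

Lemma ang_sumE p n : ang_sum p n = (16 * 4 ^+ n / pi ^+ 2) ^+ p * odd_sum (2 * p) n.
Proof.
rewrite /ang_sum /odd_sum mulr_sumr; apply: eq_big_nat => k _.
rewrite exprM -exprVn -exprMn -[in RHS]exprVn; congr (_ ^+ p).
have -> : 16 * 4 ^+ n = (2 ^ n.+2)%:R ^+ 2 :> R.
  have -> : 4 ^+ n = (2 ^+ n) ^+ 2 :> R by rewrite -exprM mulnC exprM; congr (_ ^+ _); ring.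
  by rewrite natrX !exprS; ring.
rewrite /ang; have p0 : pi != 0 by rewrite gt_eqF // pi_gt0.
have : (2 ^ n.+2)%:R != 0 :> R by rewrite pnatr_eq0 -lt0n expn_gt0.
move: ((2 ^ n.+2)%:R : R) => a a0; have : (k.*2.+1)%:R != 0 :> R by rewrite pnatr_eq0.
by move: ((k.*2.+1)%:R : R) pi p0 => b q q0 b0; field; rewrite ?q0 ?a0 ?b0.
Qed.

Lemma ang_sum1_bounds n : 2 * 4 ^+ n - 2 ^+ n <= ang_sum 1 n <= 2 * 4 ^+ n.
Proof.
rewrite -csc_sum1 /ang_sum /csc_sum; apply/andP; split.
  have -> : 2 ^+ n = \sum_(0 <= k < 2 ^ n) 1 :> R.
    by rewrite sumr_const_nat subn0 natrX.
  rewrite -sumrB; apply: ler_sum_nat => k /andP[_ kn].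
  by have [_ _] := csc2_bounds (ang_bounds kn); rewrite !expr1; lra.
apply: ler_sum_nat => k /andP[_ kn].
by have [_ + _] := csc2_bounds (ang_bounds kn); rewrite !expr1.
Qed.

(** With b = ang^(-2), csc^4 <= (1 + b)^2 <= 1 + 2 csc^2 + b^2; the 2^n terms are summed. *)
Lemma ang_sum2_bounds n :
  csc_sum 2 n - 2 * csc_sum 1 n - 2 ^+ n <= ang_sum 2 n <= csc_sum 2 n.
Proof.
rewrite /ang_sum /csc_sum; apply/andP; split.
  have -> : 2 ^+ n = \sum_(0 <= k < 2 ^ n) 1 :> R.
    by rewrite sumr_const_nat subn0 natrX.
  rewrite mulr_sumr -!sumrB; apply: ler_sum_nat => k /andP[_ kn].
  have [h0 h1 h2] := csc2_bounds (ang_bounds kn); rewrite expr1.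
  move: (csc2 (ang n k)) (ang n k ^- 2) h0 h1 h2 => a b b0 ba a1.
  have : a ^+ 2 <= (1 + b) ^+ 2 by rewrite lerXn2r ?nnegrE //; lra.
  rewrite sqrrD; lra.
apply: ler_sum_nat => k /andP[_ kn].
have [h0 h1 _] := csc2_bounds (ang_bounds kn).
by rewrite lerXn2r ?nnegrE // (le_trans h0).
Qed.

Lemma cvg_of_geometric_error (u : nat -> R) (l K : R) :
  (forall n, `|l - u n| <= K * 2^-1 ^+ n) -> u @ \oo --> l.
Proof.
move=> H; have K0 : 0 <= K by have := le_trans (normr_ge0 _) (H 0%N); rewrite expr0 mulr1.
apply/cvgrPdist_le => e e0; have K1 : 0 < K + 1 by rewrite ltr_wpDl.
have half1 : `|2^-1 : R| < 1 by rewrite ger0_norm ?invr_ge0 // invf_lt1 // ltr1n.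
have /cvgrPdist_le/(_ _ (divr_gt0 e0 K1))[N _ HN] := cvg_expr half1.
exists N => // n Nn; apply: le_trans (H n) _.
have := HN n Nn; rewrite /= sub0r normrN ger0_norm ?exprn_ge0 ?invr_ge0 //.
rewrite ler_pdivlMr // => h; apply: le_trans h; rewrite mulrC ler_wpM2l ?exprn_ge0 ?invr_ge0 //.
by rewrite lerDl.
Qed.

Lemma cvg_odd_sum2 : odd_sum 2 @ \oo --> pi ^+ 2 / 8.
Proof.
have p0 := pi_gt0 R; have pn : pi != 0 by rewrite gt_eqF.
apply: (@cvg_of_geometric_error _ _ (pi ^+ 2 / 16)) => n.
have e40 : 0 < 4 ^+ n :> R by rewrite exprn_gt0.
have e20 : 0 < 2 ^+ n :> R by rewrite exprn_gt0.
have e42 : 4 ^+ n = 2 ^+ n * 2 ^+ n :> R by rewrite -exprMn; congr (_ ^+ _); ring.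
have -> : odd_sum 2 n = pi ^+ 2 / 16 * (4 ^+ n)^-1 * ang_sum 1 n.
  rewrite ang_sumE expr1 muln1; move: pi pn (4 ^+ n) (gt_eqF e40) => q qn a /negbT a0.
  by field; rewrite ?qn ?a0.
have /andP[h1 h2] := ang_sum1_bounds n.
have -> : pi ^+ 2 / 8 - pi ^+ 2 / 16 * (4 ^+ n)^-1 * ang_sum 1 n =
   pi ^+ 2 / 16 * (4 ^+ n)^-1 * (2 * 4 ^+ n - ang_sum 1 n) by field; rewrite ?gt_eqF.
rewrite normrM ger0_norm; last by rewrite mulr_ge0 ?divr_ge0 ?invr_ge0 ?exprn_ge0 // ltW.
rewrite -(mulrA (pi ^+ 2 / 16)); apply: ler_wpM2l.
  by rewrite divr_ge0 // exprn_ge0 // ltW.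
rewrite ger0_norm ?subr_ge0 //.
rewrite exprVn ler_pdivrMl // e42 mulfK ?gt_eqF //; lra.
Qed.

Lemma cvg_odd_sum4 : odd_sum 4 @ \oo --> pi ^+ 4 / 96.
Proof.
have p0 := pi_gt0 R; have pn : pi != 0 by rewrite gt_eqF.
(* With a = 2^n, the bounds on [ang_sum 2 n] differ from 8/3 a^4 by at most 8/3 a^2 + a, which 7 a^3
   generously majorizes as a >= 1. *)
apply: (@cvg_of_geometric_error _ _ (pi ^+ 4 / 256 * 7)) => n.
have e40 : 0 < 4 ^+ n :> R by rewrite exprn_gt0.
have e20 : 1 <= 2 ^+ n :> R by rewrite exprn_ege1 // ler1n.
have e20' : 0 < 2 ^+ n :> R by rewrite exprn_gt0.
have e42 : 4 ^+ n = 2 ^+ n * 2 ^+ n :> R by rewrite -exprMn; congr (_ ^+ _); ring.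
have e164 : 16 ^+ n = 4 ^+ n * 4 ^+ n :> R by rewrite -exprMn; congr (_ ^+ _); ring.
have -> : odd_sum 4 n = pi ^+ 4 / 256 * (16 ^+ n)^-1 * ang_sum 2 n.
  rewrite ang_sumE e164; move: pi pn (4 ^+ n) (gt_eqF e40) => q qn a /negbT a0.
  by field; rewrite ?qn ?a0.
have := ang_sum2_bounds n; rewrite csc_sum1 csc_sum2 => /andP[h1 h2].
have e160 : 0 < 16 ^+ n :> R by rewrite exprn_gt0.
have -> : pi ^+ 4 / 96 - pi ^+ 4 / 256 * (16 ^+ n)^-1 * ang_sum 2 n =
   pi ^+ 4 / 256 * ((16 ^+ n)^-1 * (8 / 3 * 16 ^+ n - ang_sum 2 n)) by field; rewrite ?gt_eqF.
have c0 : 0 <= pi ^+ 4 / 256 by apply: divr_ge0; rewrite ?ler0n // exprn_ge0 // (ltW p0).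
rewrite normrM (ger0_norm c0) -(mulrA (pi ^+ 4 / 256)); apply: (ler_wpM2l c0).
rewrite normrM gtr0_norm ?invr_gt0 // ler_pdivrMl // exprVn e164 e42.
rewrite e164 e42 in h1 h2; set a := 2 ^+ n in e20 e20' h1 h2 *.
have -> : a * a * (a * a) * (7 / a) = 7 * a * a * a by field; rewrite ?gt_eqF.
have a1 : a * 1 <= a * a by rewrite ler_pM2l.
have a2 : a * a * 1 <= a * a * a by rewrite ler_pM2l // mulr_gt0.
rewrite ler_norml; apply/andP; split; lra.
Qed.

(** The even terms of the series add up to 2^(-m) zeta(m). Partial sums are taken along powers of 2
    to match [odd_sum]. *)
Lemma zetaR_of_odd_sum m (L : R) : (1 < m)%N -> odd_sum m @ \oo --> L ->
  zetaR R m = L + 2 ^- m * zetaR R m.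
Proof.
move=> m1 cL; have cz := @cvg_zeta_sum_nat R m m1; rewrite -/(zetaR R m) in cz.
set s := series _ in cz.
have pw : (fun n => 2 ^ n)%N @ \oo --> \oo.
  move=> A [N _ HN]; exists N => // n /= Nn; apply: HN => /=.
  by apply: leq_trans Nn _; apply: ltnW; exact: ltn_expl.
have pw2 : (fun n => (2 ^ n).*2)%N @ \oo --> \oo.
  move=> A [N _ HN]; exists N => // n /= Nn; apply: HN => /=.
  apply: leq_trans Nn _; apply: ltnW; apply: leq_trans (ltn_expl n (isT : 1 < 2)%N) _.
  by rewrite -addnn leq_addr.
have E N : s N.*2 = \sum_(0 <= k < N) (k.*2.+1)%:R ^- m + 2 ^- m * s N.
  elim: N => [|N IH]; first by rewrite /s /series /= !big_geq // mulr0 addr0.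
  rewrite doubleS /s !seriesSr -/s IH big_nat_recr //= mulrDr.
  have -> : N.*2.+2%:R = 2 * N.+1%:R :> R by rewrite -natrM; congr _%:R; lia.
  by rewrite exprMn invfM; ring.
have c1 : (fun n => s (2 ^ n).*2) @ \oo --> zetaR R m by exact: (cvg_comp _ _ pw2 cz).
have c2 : (fun n => s (2 ^ n)%N) @ \oo --> zetaR R m by exact: (cvg_comp _ _ pw cz).
have c3 : (fun n => odd_sum m n + 2 ^- m * s (2 ^ n)%N) @ \oo --> L + 2 ^- m * zetaR R m.
  by apply: cvgD => //; apply: cvgMr.
have EE : (fun n => s (2 ^ n)%N.*2) = (fun n => odd_sum m n + 2 ^- m * s (2 ^ n)%N).
  by apply/funext => n; rewrite E.
rewrite EE in c1; exact: (cvg_unique _ c1 c3).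
Qed.

Lemma zetaR2 : zetaR R 2 = pi ^+ 2 / 6.
Proof. by have := @zetaR_of_odd_sum 2 _ isT cvg_odd_sum2; move: (pi ^+ 2) (zetaR R 2) => a b; lra. Qed.

Lemma zetaR4 : zetaR R 4 = pi ^+ 4 / 90.
Proof. by have := @zetaR_of_odd_sum 4 _ isT cvg_odd_sum4; move: (pi ^+ 4) (zetaR R 4) => a b; lra. Qed.

End ZetaEven.

(** * Numerical bounds for the growth constant *)

Section Numerics.
Variable R : realType.
Implicit Types u phi : nat -> R.

(** Beyond N the terms dominate a telescoping sum, and phi eventually falls below any positive e, so
    the tail is at least phi N. *)
Lemma series_add_telescope_le u phi (l : R) N : (forall k, 0 <= u k) ->
  (forall k, phi k - phi k.+1 <= u k) -> (forall k, phi k <= 2 / k.+1%:R) ->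
  series u @ \oo --> l -> series u N + phi N <= l.
Proof.
move=> u0 uphi phi0 ul.
have H n : series u N + phi N - phi (n + N)%N <= series u (n + N)%N.
  elim: n => [|n IH]; first by rewrite add0n addrK.
  by rewrite addSn seriesSr; have := uphi (n + N)%N; lra.
have sl n : series u n <= l.
  by rewrite -(cvg_lim _ ul) //; apply: le_series_lim => //; apply/cvg_ex; exists l.
apply/ler_addgt0Pr => e e0; have [n hn] : exists n, phi (n + N)%N <= e.
  exists (Num.truncn (2 / e)); apply: le_trans (phi0 _) _.
  rewrite ler_pdivrMr ?ltr0n // mulrC -ler_pdivrMr //.
  apply: ltW; apply: lt_le_trans (truncnS_gt _) _.
  by rewrite ler_nat ltnS leq_addr.
by have := H n; have := sl (n + N)%N; lra.
Qed.

Lemma series_add_telescope_ge u phi (l : R) N :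
  (forall k, (N <= k)%N -> u k <= phi k - phi k.+1) -> (forall k, 0 <= phi k) ->
  series u @ \oo --> l -> l <= series u N + phi N.
Proof.
move=> uphi phi0 ul.
have H n : series u (n + N)%N <= series u N + phi N - phi (n + N)%N.
  elim: n => [|n IH]; first by rewrite add0n addrK.
  by rewrite addSn seriesSr; have := uphi (n + N)%N (leq_addl _ _); lra.
rewrite -(cvg_lim _ ul) //; apply: limr_le; first by apply/cvg_ex; exists l.
exists N => // n /= Nn; rewrite -(subnK Nn).
by have := H (n - N)%N; have := phi0 (n - N + N)%N; lra.
Qed.

End Numerics.

Section ZetaBounds.
Variable R : realFieldType.

(* Constants are written in base 100 because numerals of an abstract field
   are unary. *)
Definition zeta2_lb : R :=
  1 + 64 / 10 ^+ 2 + 49 / 10 ^+ 4 + 34 / 10 ^+ 6 + 3 / 10 ^+ 8.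
Definition zeta3_lb : R :=
  1 + 20 / 10 ^+ 2 + 20 / 10 ^+ 4 + 56 / 10 ^+ 6 + 89 / 10 ^+ 8 + 8 / 10 ^+ 9.
Definition zeta2_ub : R := 1 + 64 / 10 ^+ 2 + 49 / 10 ^+ 4 + 44 / 10 ^+ 6.
Definition zeta3_ub : R :=
  1 + 20 / 10 ^+ 2 + 20 / 10 ^+ 4 + 58 / 10 ^+ 6 + 4 / 10 ^+ 7.

(** The added fraction is the tail bound [phi 14] of [zetaR2_ge]; in the next three lemmas 1 / 421,
    2 / 41 and 1 / 840 are likewise the tail bounds at 14, 20 and 20. *)
Lemma zeta2_lb_le : zeta2_lb <= \sum_(0 <= k < 14) k.+1%:R ^- 2 + 87 / 1262 :> R.
Proof. by rewrite !big_nat_recr //= big_geq // add0r /zeta2_lb; lra. Qed.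

Lemma zeta3_lb_le : zeta3_lb <= \sum_(0 <= k < 14) k.+1%:R ^- 3 + 1 / 421 :> R.
Proof. by rewrite !big_nat_recr //= big_geq // add0r /zeta3_lb; lra. Qed.

Lemma zeta2_ub_ge : \sum_(0 <= k < 20) k.+1%:R ^- 2 + 2 / 41 <= zeta2_ub :> R.
Proof. by rewrite !big_nat_recr //= big_geq // add0r /zeta2_ub; lra. Qed.

Lemma zeta3_ub_ge : \sum_(0 <= k < 20) k.+1%:R ^- 3 + 1 / 840 <= zeta3_ub :> R.
Proof. by rewrite !big_nat_recr //= big_geq // add0r /zeta3_ub; lra. Qed.

(** The true constant is about 2.5725009, so the lower bounds for zeta(2) and zeta(3) must be far
    sharper than the upper ones. *)
Lemma product_lb :
  257 / 10 ^+ 2 + 25 / 10 ^+ 4 <= 2 / 5 * zeta2_lb ^+ 3 * zeta3_lb ^+ 2.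
Proof. by rewrite /zeta2_lb /zeta3_lb; lra. Qed.

Lemma product_ub :
  2 / 5 * zeta2_ub ^+ 3 * zeta3_ub ^+ 2 < 257 / 10 ^+ 2 + 26 / 10 ^+ 4.
Proof. by rewrite /zeta2_ub /zeta3_ub; lra. Qed.

(** With y = x + 1/2 the rational function is y / (y^2 + 1/12), which matches the first two terms
    1/y - 1/(12 y^3) of the midpoint Euler-Maclaurin expansion of the tail. In [telescope3_lb], 1 /
    (2 y^2 + 1/2) plays the same part for cubes. *)
Lemma telescope2_lb (x : R) : 0 <= x ->
  (6 * x + 3) / (6 * x ^+ 2 + 6 * x + 2) -
  (6 * (x + 1) + 3) / (6 * (x + 1) ^+ 2 + 6 * (x + 1) + 2) <= (x + 1) ^- 2.
Proof.
move=> x0; rewrite -subr_ge0.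
have A : 0 < 6 * x ^+ 2 + 6 * x + 2 by nra.
have B : 0 < 6 * (x + 1) ^+ 2 + 6 * (x + 1) + 2 by nra.
have D : 0 < x + 1 by lra.
have -> : (x + 1) ^- 2 - ((6 * x + 3) / (6 * x ^+ 2 + 6 * x + 2) -
    (6 * (x + 1) + 3) / (6 * (x + 1) ^+ 2 + 6 * (x + 1) + 2)) =
  4 / ((x + 1) ^+ 2 * (6 * x ^+ 2 + 6 * x + 2) *
       (6 * (x + 1) ^+ 2 + 6 * (x + 1) + 2)).
  by field; rewrite (gt_eqF A) (gt_eqF B) (gt_eqF D).
by apply: divr_ge0 => //; rewrite !mulr_ge0 ?exprn_ge0 // ltW.
Qed.

Lemma telescope3_lb (x : R) : 0 <= x ->
  1 / (2 * x ^+ 2 + 2 * x + 1) - 1 / (2 * (x + 1) ^+ 2 + 2 * (x + 1) + 1)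
  <= (x + 1) ^- 3.
Proof.
move=> x0; rewrite -subr_ge0.
have A : 0 < 2 * x ^+ 2 + 2 * x + 1 by nra.
have B : 0 < 2 * (x + 1) ^+ 2 + 2 * (x + 1) + 1 by nra.
have D : 0 < x + 1 by lra.
have -> : (x + 1) ^- 3 - (1 / (2 * x ^+ 2 + 2 * x + 1) -
    1 / (2 * (x + 1) ^+ 2 + 2 * (x + 1) + 1)) =
  1 / ((x + 1) ^+ 3 * (2 * x ^+ 2 + 2 * x + 1) *
       (2 * (x + 1) ^+ 2 + 2 * (x + 1) + 1)).
  by field; rewrite (gt_eqF A) (gt_eqF B) (gt_eqF D).
by apply: divr_ge0 => //; rewrite !mulr_ge0 ?exprn_ge0 // ltW.
Qed.

Lemma telescope2_ub (x : R) : 0 <= x ->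
  (x + 1) ^- 2 <= 2 / (2 * x + 1) - 2 / (2 * (x + 1) + 1).
Proof.
move=> x0; rewrite -subr_ge0.
have A : 0 < 2 * x + 1 by lra.
have B : 0 < 2 * (x + 1) + 1 by lra.
have D : 0 < x + 1 by lra.
have -> : 2 / (2 * x + 1) - 2 / (2 * (x + 1) + 1) - (x + 1) ^- 2 =
  1 / ((x + 1) ^+ 2 * (2 * x + 1) * (2 * (x + 1) + 1)).
  by field; rewrite (gt_eqF A) (gt_eqF B) (gt_eqF D).
by apply: divr_ge0 => //; rewrite !mulr_ge0 ?exprn_ge0 // ltW.
Qed.

(** With n = x + 1, the right side is 1 / ((n - 1) n (n + 1)), and (n - 1)(n + 1) <= n^2. *)
Lemma telescope3_ub (x : R) : 0 < x ->
  (x + 1) ^- 3 <= 1 / (2 * x * (x + 1)) - 1 / (2 * (x + 1) * (x + 1 + 1)).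
Proof.
move=> x0; rewrite -subr_ge0.
have B : 0 < x + 1 + 1 by lra.
have D : 0 < x + 1 by lra.
have -> : 1 / (2 * x * (x + 1)) - 1 / (2 * (x + 1) * (x + 1 + 1)) - (x + 1) ^- 3 =
  1 / ((x + 1) ^+ 3 * x * (x + 1 + 1)).
  by field; rewrite (gt_eqF x0) (gt_eqF B) (gt_eqF D).
by apply: divr_ge0 => //; rewrite !mulr_ge0 ?exprn_ge0 // ltW.
Qed.
End ZetaBounds.

Section Main.
Variable R : realType.

Lemma zetaR2_ge : zeta2_lb R <= zetaR R 2.
Proof.
apply: le_trans (zeta2_lb_le R) _.
pose phi (k : nat) : R := (6 * k%:R + 3) / (6 * k%:R ^+ 2 + 6 * k%:R + 2).
have -> : 87 / 1262 = phi 14 by congr (_ / _); ring.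
apply: series_add_telescope_le (@cvg_zeta_sum_nat R 2 isT) => k.
- by rewrite invr_ge0 exprn_ge0.
- by rewrite /phi -[k.+1%:R]natr1; apply: telescope2_lb.
rewrite /phi -[k.+1%:R]natr1; have : 0 <= k%:R :> R by [].
move: (k%:R) => x x0; rewrite ler_pdivlMr ?ltr_wpDl //.
rewrite mulrAC ler_pdivrMr; nra.
Qed.

Lemma zetaR3_ge : zeta3_lb R <= zetaR R 3.
Proof.
apply: le_trans (zeta3_lb_le R) _.
pose phi (k : nat) : R := 1 / (2 * k%:R ^+ 2 + 2 * k%:R + 1).
have -> : 1 / 421 = phi 14 by congr (_ / _); ring.
apply: series_add_telescope_le (@cvg_zeta_sum_nat R 3 isT) => k.
- by rewrite invr_ge0 exprn_ge0.
- by rewrite /phi -[k.+1%:R]natr1; apply: telescope3_lb.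
rewrite /phi -[k.+1%:R]natr1; have : 0 <= k%:R :> R by [].
move: (k%:R) => x x0; rewrite ler_pdivlMr ?ltr_wpDl //.
rewrite mulrAC ler_pdivrMr; nra.
Qed.

Lemma zetaR2_le : zetaR R 2 <= zeta2_ub R.
Proof.
apply: le_trans (zeta2_ub_ge R).
pose phi (k : nat) : R := 2 / (2 * k%:R + 1).
have -> : 2 / 41 = phi 20 by congr (_ / _); ring.
apply: series_add_telescope_ge (@cvg_zeta_sum_nat R 2 isT) => k.
- by move=> _; rewrite /phi -[k.+1%:R]natr1; apply: telescope2_ub.
by rewrite divr_ge0 // addr_ge0 // mulr_ge0.
Qed.

Lemma zetaR3_le : zetaR R 3 <= zeta3_ub R.
Proof.
apply: le_trans (zeta3_ub_ge R).
pose phi (k : nat) : R := 1 / (2 * k%:R * (k%:R + 1)).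
have -> : 1 / 840 = phi 20 by congr (_ / _); ring.
apply: series_add_telescope_ge (@cvg_zeta_sum_nat R 3 isT) => k.
- move=> k20; rewrite /phi -[k.+1%:R]natr1; apply: telescope3_ub.
  by rewrite ltr0n; apply: leq_trans k20.
by rewrite divr_ge0 // mulr_ge0 // ?addr_ge0 // mulr_ge0.
Qed.

Lemma zetaR_product :
  zetaR R 2 * zetaR R 4 * zetaR R 3 ^+ 2 = pi ^+ 6 / 540 * zeta (3 : R) ^+ 2.
Proof.
rewrite zeta3E zetaR2 zetaR4; move: (pi : R) (zetaR R 3) => q z.
by field.
Qed.

(** As zeta(4) = 2/5 zeta(2)^2, bounds on the two rational series zeta(2) and zeta(3) bound the
    constant. *)
Lemma zetaR_product2 :
  zetaR R 2 * zetaR R 4 * zetaR R 3 ^+ 2 = 2 / 5 * zetaR R 2 ^+ 3 * zetaR R 3 ^+ 2.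
Proof.
rewrite zetaR2 zetaR4; move: (pi : R) (zetaR R 3) => q z.
by field.
Qed.

Lemma growth_constant_bounds :
  257 / 10 ^+ 2 + 25 / 10 ^+ 4 <= pi ^+ 6 / 540 * zeta (3 : R) ^+ 2
    < 257 / 10 ^+ 2 + 26 / 10 ^+ 4.
Proof.
rewrite -zetaR_product zetaR_product2; apply/andP; split.
- apply: le_trans (product_lb R) _.
  have l2 : 0 <= zeta2_lb R by rewrite /zeta2_lb !addr_ge0.
  have l3 : 0 <= zeta3_lb R by rewrite /zeta3_lb !addr_ge0.
  apply: ler_pM (lerXn2r _ _ _ _) => //.
  - by rewrite mulr_ge0 // exprn_ge0.
  - by rewrite exprn_ge0.
  - rewrite ler_wpM2l //; apply: lerXn2r => //; first exact: le_trans zetaR2_ge.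
    exact: zetaR2_ge.
  - exact: le_trans zetaR3_ge.
  exact: zetaR3_ge.
apply: le_lt_trans _ (product_ub R).
have l2 : 0 <= zetaR R 2.
  by apply: le_trans zetaR2_ge; rewrite /zeta2_lb !addr_ge0.
have l3 : 0 <= zetaR R 3.
  by apply: le_trans zetaR3_ge; rewrite /zeta3_lb !addr_ge0.
apply: ler_pM (lerXn2r _ _ _ _) => //.
- by rewrite mulr_ge0 // exprn_ge0.
- by rewrite exprn_ge0.
- rewrite ler_wpM2l //; apply: lerXn2r => //; first exact: le_trans zetaR2_le.
  exact: zetaR2_le.
- exact: le_trans zetaR3_le.
exact: zetaR3_le.
Qed.
End Main.

End SpecialValues.

Theorem mainTheorem2 (R : realType) :
  (forall p : nat, prime p ->
     mkseq (local_zeta 2 2 p) 20 =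
     [:: 1; 1; 2; 4; 6; 8; 13; 17; 23; 31; 40; 50; 65; 79; 97; 119; 143;
         169; 203; 237]%N) /\
  (abscissa_of_convergence (fun n => g n 2 2) (1 : R) /\
   exists F : (R[i])^o -> (R[i])^o,
     [/\ forall s, meromorphic_at F s,
         forall s : (R[i])^o, 1 < complex.Re s ->
           F s = dirichlet_series (fun n => g n 2 2) s
       & simple_pole_at F 1]) /\
  (asymp_equiv (fun n => (\sum_(1 <= m < n.+1) g m 2 2)%N%:R)
     (fun n => pi ^+ 6 / 540 * zeta (3 : R) ^+ 2 * n%:R) /\
   257 / 10 ^+ 2 + 25 / 10 ^+ 4
     <= pi ^+ 6 / 540 * zeta (3 : R) ^+ 2
     < 257 / 10 ^+ 2 + 26 / 10 ^+ 4).
Proof.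
split; first by move=> p; exact: local_zeta22.
split; first split.
- split=> s; first exact: g22_dirichlet_converges.
  by apply: dirichlet_diverges => n; exact: g22_gt0.
- exists (@g22_cont R); split.
  + exact: g22_cont_meromorphic.
  + exact: g22_dirichlet_series.
  + exact: g22_cont_simple_pole.
have bounds := growth_constant_bounds R.
split=> //; set c := pi ^+ 6 / 540 * _ in bounds *.
have c0 : c != 0.
  rewrite gt_eqF //; have /andP[+ _] := bounds; apply: lt_le_trans.
  by rewrite addr_gt0 // divr_gt0 // exprn_gt0.
have avg := @cvg_average_g22 R; rewrite zetaR_product -/c in avg.
have := cvgM avg (cvg_cst c^-1) => /(_ eventually_filter eventually_filter).
rewrite (divff c0) => cvg1; apply: eq_cvgn cvg1 => n.
by rewrite /= (invfM c) mulrAC mulrA.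
Qed.
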